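(* Let $\nu\ge-\frac12$ and $d_\nu=2\nu+2$. Let $0<\gamma<d_\nu$ and $1<p\le q<\frac{d_\nu}{\gamma}$. Assume that $s$ and $t$ satisfy $$1<s\le t<\infty,\qquad \frac1t=\frac1q-\frac{\gamma}{d_\nu},\qquad \frac st=\frac pq.$$ Then the Dunkl fractional integral operator $I_\gamma^\nu$ is bounded from $L^{p,q}(\mathbb{R},d\mu_\nu)$ to $L^{s,t}(\mathbb{R},d\mu_\nu)$, i.e. there is a constant $C>0$, independent of $f$, such that $$\|I_\gamma^\nu f\|_{L^{s,t}(\mathbb{R},d\mu_\nu)}\le C\,\|f\|_{L^{p,q}(\mathbb{R},d\mu_\nu)}\qquad\text{for all } f\in L^{p,q}(\mathbb{R},d\mu_\nu).$$
   Context: Fix a real number $\nu\ge-\frac12$ and put $d_\nu=2\nu+2$. Measure: $d\mu_\nu(x)=(2^{\nu+1}\Gamma(\nu+1))^{-1}|x|^{2\nu+1}dx$ on $\mathbb{R}$. Functions are complex-valued and measurable. Dunkl translation: for $x,y\in\mathbb{R}$, $\tau_x^\nu f(y)=\int_{\mathbb{R}}f(z)\,d\sigma_{x,y}(z)$, where $\sigma_{x,y}$ is the signed measure (with $\sigma_{x,0}=\delta_x$, $\sigma_{0,y}=\delta_y$, and, for $x,y\ne0$ and $\nu>-\frac12$, absolutely continuous with respect to $\mu_\nu$) given explicitly for $\nu>-\frac12$ by $$\tau_x^\nu f(y)=\frac{C_\nu}{2}\int_{-1}^{1}\Big[f(\rho_u)\Big(1+\frac{x+y}{\rho_u}\Big)+f(-\rho_u)\Big(1-\frac{x+y}{\rho_u}\Big)\Big](1+u)(1-u^2)^{\nu-\frac12}\,du,$$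 with $\rho_u=\sqrt{x^2+y^2+2xyu}$, $C_\nu=\frac{\Gamma(\nu+1)}{\sqrt\pi\,\Gamma(\nu+\frac12)}$, and $\frac{x+y}{\rho_u}$ read as $0$ when $\rho_u=0$. For $\nu=-\frac12$, $\tau_x^\nu f(y)=f(x+y)$. For $f$ locally integrable with respect to $\mu_\nu$, $\tau_x^\nu f(y)$ is defined for almost every $y$. One has $\tau_x^\nu f(y)=\tau_y^\nu f(x)$. Dunkl fractional integral operator: for $0<\gamma<d_\nu$, $$I_\gamma^\nu f(x)=\int_{\mathbb{R}}f(y)\,\tau_y^\nu K_\gamma^\nu(x)\,d\mu_\nu(y),\qquad K_\gamma^\nu(x)=|x|^{\gamma-d_\nu}.$$ Dunkl Morrey space: for $1\le p\le q<\infty$, $L^{p,q}(\mathbb{R},d\mu_\nu)$ is the set of locally integrable functions $f$ on $\mathbb{R}$ with $$\|f\|_{L^{p,q}(\mathbb{R},d\mu_\nu)}=\sup_{x\in\mathbb{R},\,r>0} r^{d_\nu(\frac1q-\frac1p)}\Big(\int_{B(0,r)}\tau_x^\nu(|f|^p)(y)\,d\mu_\nu(y)\Big)^{1/p}<\infty,$$ where $B(0,r)=(-r,r)$ (the norm is $+\infty$ if $|f|^p$ is not locally integrable). *)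

(* Defs.v *)
From HB Require Import structures.
From mathcomp Require Import all_boot all_order all_algebra.
From mathcomp Require Import complex.
From mathcomp Require Import all_classical all_reals all_analysis.
From mathcomp Require Import measurable_realfun.

Set Implicit Arguments.
Unset Strict Implicit.
Unset Printing Implicit Defensive.

Import Order.TTheory GRing.Theory Num.Theory.
Import numFieldNormedType.Exports.

Local Open Scope classical_set_scope.
Local Open Scope ring_scope.
Local Open Scope complex_scope.

Definition gamma_fun {R : realType} (s : R) : R :=
  \int[lebesgue_measure]_(u in `]0, +oo[) (u `^ (s - 1) * expR (- u)).

Definition cmodulus {R : realType} (z : R[i]) : R := ComplexField.Normc.normc z.

(* R[i] carries no sigma-algebra in the libraries; this is measurability for the
   Borel sets of the plane. *)
Definition cmeasurable {R : realType} (f : R -> R[i]) : Prop :=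
  measurable_fun setT (fun x => complex.Re (f x)) /\
  measurable_fun setT (fun x => complex.Im (f x)).

Definition cintegral {R : realType} {d : measure_display}
    {T : measurableType d} (mu : {measure set T -> \bar R}) (D : set T)
    (f : T -> R[i]) : R[i] :=
  (\int[mu]_(x in D) complex.Re (f x)) +i* (\int[mu]_(x in D) complex.Im (f x)).

Definition dunkl_dim {R : realType} (nu : R) : R := 2 * nu + 2.

Definition dunkl_density {R : realType} (nu x : R) : R :=
  (2 `^ (nu + 1) * gamma_fun (nu + 1))^-1 * `|x| `^ (2 * nu + 1).

Definition dunkl_measure {R : realType} (nu : R) :=
  fun A => (\int[lebesgue_measure]_(x in A) (dunkl_density nu x)%:E)%E.

Section dunkl_measure.
Context {R : realType}.
Variable nu : R.

Lemma gamma_fun_ge0 (s : R) : 0 <= gamma_fun s.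
Proof.
rewrite /gamma_fun /Rintegral fine_ge0// integral_ge0// => u _.
by rewrite lee_fin mulr_ge0 ?powR_ge0 ?expR_ge0.
Qed.

Lemma dunkl_density_ge0 (x : R) : 0 <= dunkl_density nu x.
Proof.
by rewrite mulr_ge0 ?invr_ge0 ?mulr_ge0 ?powR_ge0 ?gamma_fun_ge0.
Qed.

Lemma measurable_dunkl_density :
  measurable_fun [set: R] (dunkl_density nu).
Proof.
apply: measurable_funM => //.
apply: (measurableT_comp (measurable_powR _)) => //.
Qed.

Local Notation mu_nu := (dunkl_measure nu).

Let dunkl_measure0 : mu_nu set0 = 0%E.
Proof. by rewrite /dunkl_measure integral_set0. Qed.

Let dunkl_measure_ge0 A : (0 <= mu_nu A)%E.
Proof.
by rewrite /dunkl_measure integral_ge0// => x _; rewrite lee_fin dunkl_density_ge0.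
Qed.

Let dunkl_measure_sigma_additive : semi_sigma_additive mu_nu.
Proof.
move=> /= F mF tF mUF; rewrite /dunkl_measure; apply: cvg_toP.
  apply: ereal_nondecreasing_is_cvgn => m n mn.
  apply: lee_sum_nneg_natr => // k _ _; apply: integral_ge0 => /= x Fkx.
  by rewrite lee_fin dunkl_density_ge0.
rewrite ge0_integral_bigcup//=.
- apply/measurable_funTS/measurableT_comp => //.
  exact: measurable_dunkl_density.
- by move=> x _; rewrite lee_fin dunkl_density_ge0.
Qed.

HB.instance Definition _ := isMeasure.Build _ _ _ mu_nu
  dunkl_measure0 dunkl_measure_ge0 dunkl_measure_sigma_additive.

End dunkl_measure.

Section dunkl_translation.
Context {R : realType}.
Implicit Types (nu x y u : R) (f : R -> R).

Definition dunkl_const nu : R :=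
  gamma_fun (nu + 1) / (Num.sqrt pi * gamma_fun (nu + 2^-1)).

Definition dunkl_rho x y u : R :=
  Num.sqrt (x ^+ 2 + y ^+ 2 + 2 * x * y * u).

(* tau_x^nu f (y).  Division by 0 being 0, (x + y) / rho is 0 when rho = 0.
   For nu > -1/2 the formula also covers the degenerate cases, where it gives
   tau_x f (0) = f x and tau_0 f (y) = f y.  Where the integrand is not
   integrable the value is the default 0; for f locally integrable this
   concerns only a null set of y. *)
Definition dunkl_translation nu x f y : R :=
  if nu == - 2^-1 then f (x + y)
  else dunkl_const nu / 2 *
    \int[lebesgue_measure]_(u in `[-1, 1])
      ((f (dunkl_rho x y u) * (1 + (x + y) / dunkl_rho x y u) +
        f (- dunkl_rho x y u) * (1 - (x + y) / dunkl_rho x y u)) *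
       (1 + u) * (1 - u ^+ 2) `^ (nu - 2^-1)).

End dunkl_translation.

Section dunkl_fractional_integral.
Context {R : realType}.
Implicit Types (nu g x : R) (f : R -> R[i]).

(* The value at 0 is 0 instead of +oo, which changes nothing below since it is
   only met on null sets. *)
Definition dunkl_riesz_kernel nu g x : R := `|x| `^ (g - dunkl_dim nu).

(* Absolute convergence of the integral defining I_g^nu f (x). *)
Definition dunkl_fractional_defined nu g f x : Prop :=
  (dunkl_measure nu).-integrable setT
    (fun y => (cmodulus (f y) *
       dunkl_translation nu y (dunkl_riesz_kernel nu g) x)%:E).

Definition dunkl_fractional_integral nu g f x : R[i] :=
  cintegral (dunkl_measure nu) setT
    (fun y => f y * (dunkl_translation nu y (dunkl_riesz_kernel nu g) x)%:C).

End dunkl_fractional_integral.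

Section dunkl_morrey.
Context {R : realType}.
Implicit Types (nu p q : R) (f : R -> R[i]).

Definition dunkl_locally_integrable nu (h : R -> R) : Prop :=
  measurable_fun setT h /\
  forall K : set R, compact K ->
    (\int[dunkl_measure nu]_(x in K) `|h x|%:E < +oo)%E.

Definition dunkl_clocally_integrable nu f : Prop :=
  cmeasurable f /\ dunkl_locally_integrable nu (fun x => cmodulus (f x)).

Definition dunkl_morrey_norm nu p q f : \bar R :=
  if `[< dunkl_locally_integrable nu (fun x => cmodulus (f x) `^ p) >] then
    ereal_sup [set N | exists x r : R, 0 < r /\
      N = ((r `^ (dunkl_dim nu * (q^-1 - p^-1)))%:E *
           (\int[dunkl_measure nu]_(y in `](- r)%R, r[)
              (dunkl_translation nu x (fun z => cmodulus (f z) `^ p) y)%:E)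
             `^ p^-1)%E]
  else +oo%E.

Definition dunkl_morrey nu p q f : Prop :=
  dunkl_clocally_integrable nu f /\ (dunkl_morrey_norm nu p q f < +oo)%E.

End dunkl_morrey.

(* Main.v *)
From HB Require Import structures.
Require Import Defs.
From mathcomp Require Import all_boot all_order all_algebra.
From mathcomp Require Import complex.
From mathcomp Require Import all_classical all_reals all_analysis.
From mathcomp Require Import measurable_realfun.
From mathcomp Require Import ring lra.

Set Implicit Arguments.
Unset Strict Implicit.
Unset Printing Implicit Defensive.

Import Order.TTheory GRing.Theory Num.Theory.
Import numFieldNormedType.Exports.

Local Open Scope classical_set_scope.
Local Open Scope ring_scope.

(** Write V(x,r) = r max(|x|,r)^(2 nu+1).  Up to constants this is the measure of
the shell ||z| - |x|| < r, the shells form a doubling family, and the integral of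
tau_x F over (-r,r) is r^d / V(x,r) times the integral of F >= 0 over the shell:
the upper bound holds for each x, the lower one after adding the values at x and
-x, which removes the odd part of the signed translation kernel.  Hence the Morrey
norm is equivalent to a Morrey condition on shell averages.  Vitali's covering
lemma gives the weak type (1,1) bound for the shell maximal function M; truncating
F at dyadic levels on a double shell turns it into a Morrey bound for (M F)^p.
Finally the translated kernel is bounded by sums of normalized shell indicators,
so that Hedberg's argument yields
|I f| <= C (M |f|)^(1 - gamma q / d) ||f||^(gamma q / d), whose s-th power is
(M |f|)^p ||f||^(s - p). *)

(** * Densities and changes of variables *)

Section density.
Context {R : realType}.
Local Notation leb := (@lebesgue_measure R).
Local Open Scope ereal_scope.

Import HBNNSimple.

(** The Dunkl translation is signed: a translate of [|f|^p] may be negative, and mass of [f] near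
    [-x] can be invisible from [x]. Hence every estimate lives on shells, which are symmetric under
    [z -> -z], and the sign of the translation integrals in the target norm needs an argument of its
    own. The positive model is the Bessel translation of [F z + F (- z)]. It is self-adjoint because
    its kernel, taken relative to the weight, is symmetric in two sides of a triangle; integrals of
    translates thus reduce to translates of one interval indicator.

    The maximal function is never formed. Vitali's lemma yields measurable sets outside of which all
    averages over shells centred at a point obey a bound, and a dyadic series of their indicators
    stands for [(M F)^p], so that no supremum over uncountably many shells has to be measurable. As
    [F] is only locally integrable, the weak type bound is applied to pieces of [F] on a double
    shell, and large radii are left to the decay of the Morrey averages. The series is infinite on a
    null set only, which also yields absolute convergence of the fractional integral almost
    everywhere. *)

Lemma ge0_integral_density (m : {measure set (measurableTypeR R) -> \bar R}) (w : measurableTypeR R -> R)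
    (D : set (measurableTypeR R)) (h : measurableTypeR R -> \bar R) :
  measurable D -> measurable_fun setT w -> (forall x, 0 <= w x)%R ->
  (forall A, measurable A -> m A = \int[leb]_(x in A) (w x)%:E) ->
  measurable_fun D h -> (forall x, D x -> 0 <= h x) ->
  \int[m]_(x in D) h x = \int[leb]_(x in D) (h x * (w x)%:E).
Proof.
move=> mD mw w0 mE mh h0; pose f_ := nnsfun_approx mD mh.
have mwD : measurable_fun D (EFin \o w).
  by apply/measurable_funTS/measurableT_comp.
have cvgf x : D x -> EFin \o f_^~ x @ \oo --> h x.
  by move=> Dx; apply: cvg_nnsfun_approx.
have ndf x : {homo (fun n => (f_ n x)%:E) : a b / (a <= b)%N >-> a <= b}.
  by move=> a b ab; rewrite lee_fin; exact/lefP/nd_nnsfun_approx.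
have mf n : measurable_fun D (fun x : measurableTypeR R => (f_ n x)%:E).
  exact/measurable_EFinP/measurable_funTS.
transitivity (limn (fun n => \int[m]_(x in D) (f_ n x)%:E)).
  rewrite -monotone_convergence//.
  - by apply: eq_integral => x /set_mem Dx; apply/esym/cvg_lim => //; exact: cvgf.
  - by move=> n x _; rewrite lee_fin.
transitivity (limn (fun n => \int[leb]_(x in D) ((f_ n x)%:E * (w x)%:E))); last first.
  rewrite -monotone_convergence//.
  - apply: eq_integral => x /set_mem Dx; apply/cvg_lim => //.
    by apply: cvgeZr => //; exact: cvgf.
  - by move=> n; apply: emeasurable_funM => //; exact: mf.
  - by move=> n x _; rewrite mule_ge0// lee_fin.
  - by move=> x _ a b ab; apply: lee_wpmul2r; rewrite ?lee_fin// -lee_fin ndf.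
congr (limn _); apply/funext => n.
under eq_integral do rewrite fimfunE -fsumEFin//.
under [RHS]eq_integral.
  move=> x _; rewrite fimfunE -fsumEFin// ge0_mule_fsuml; last first.
    by move=> r; exact: nnfun_muleindic_ge0.
  over.
have mfi r : measurable_fun D (fun x : measurableTypeR R => (r * \1_(f_ n @^-1` [set r]) x)%:E).
  by apply/measurable_EFinP/measurable_funM.
rewrite !ge0_integral_fsum//; first last.
- by move=> r x _; rewrite nnfun_muleindic_ge0.
- by move=> r x _; rewrite mule_ge0 ?nnfun_muleindic_ge0// lee_fin.
- by move=> r; apply: emeasurable_funM => //; exact: mfi.
apply: eq_fsbigr => r _.
rewrite integralZl_indic_nnsfun// integral_indic// mE; last exact: measurableI.
have [r0|r0] := ltP r 0%R.
  rewrite preimage_nnfun0// set0I integral_set0 mule0.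
  by apply/esym/integral0_eq => x _; rewrite indicE in_set0 mulr0 mul0e.
rewrite -ge0_integralZl//.
- rewrite integral_mkcondl; apply: eq_integral => x _.
  rewrite patchE indicE; case: ifPn => _ /=; last by rewrite mulr0 mul0e.
  by rewrite mulr1.
- exact: measurableI.
- exact/measurable_funTS/measurableT_comp.
- by move=> x _; rewrite lee_fin.
Qed.

End density.

Section density_measure.
Context {R : realType} (w : R -> R).
Hypotheses (w0 : forall x, 0 <= w x) (mw : measurable_fun [set: R] w).
Local Open Scope ereal_scope.

(** The two proofs are arguments so that the measure structure, which depends on them, is inferred
    from the term alone. *)
Definition density_measure of (forall x, 0 <= w x)%R & measurable_fun [set: R] w :=
  fun A : set (measurableTypeR R) => \int[@lebesgue_measure R]_(x in A) (w x)%:E.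

Local Notation mu_w := (density_measure w0 mw).

Let density_measure0 : mu_w set0 = 0%E.
Proof. exact: integral_set0. Qed.

Let density_measure_ge0 A : (0 <= mu_w A)%E.
Proof. by apply: integral_ge0 => x _; rewrite lee_fin. Qed.

Let density_measure_sigma_additive : semi_sigma_additive mu_w.
Proof.
move=> /= F mF tF mUF; rewrite /density_measure; apply: cvg_toP.
  apply: ereal_nondecreasing_is_cvgn => m n mn.
  apply: lee_sum_nneg_natr => // k _ _; apply: integral_ge0 => x _.
  by rewrite lee_fin.
rewrite ge0_integral_bigcup//=.
- exact/measurable_funTS/measurableT_comp.
- by move=> x _; rewrite lee_fin.
Qed.

HB.instance Definition _ := isMeasure.Build _ _ _ mu_w
  density_measure0 density_measure_ge0 density_measure_sigma_additive.

End density_measure.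

Section change_of_variables.
Context {R : realType}.
Local Notation leb := (@lebesgue_measure R).
Local Open Scope ereal_scope.

(** By the fundamental theorem of calculus, the pushforward under [v] of the measure with density
    [v'] gives []a, b]] the mass [v (s b) - v (s a) = b - a], so it is Lebesgue measure by
    uniqueness. A zero of [v'] is allowed: the substitution made for the Bessel kernel has one at
    0. *)
Lemma ge0_integral_increasing_subst (v v' s : R -> R) (h : R -> \bar R) :
  (forall z, is_derive z (1%R : R) v (v' z)) -> continuous v' ->
  (forall z, 0 <= v' z)%R -> cancel s v ->
  {mono v : x y / (x < y)%R} ->
  measurable_fun [set: R] h -> (forall x, 0 <= h x) ->
  \int[leb]_x h x = \int[leb]_x (h (v x) * (v' x)%:E).
Proof.
move=> dv cv' v'0 vs vmono mh h0.
have mv' : measurable_fun [set: R] v' by exact: continuous_measurable_fun.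
have cv : continuous v.
  by move=> z; apply/differentiable_continuous/derivable1_diffP.
have mv : measurable_fun [set: R] v by exact: continuous_measurable_fun.
pose md : {measure set (measurableTypeR R) -> \bar R} := density_measure v'0 mv'.
pose pm : {measure set (measurableTypeR R) -> \bar R} :=
  @measure_function_pushforward__canonical__measure_function_Measure _ _
    (measurableTypeR R) (measurableTypeR R) R md v mv.
have pE A : measurable A -> leb A = pm A.
  apply: lebesgue_measure_unique => _ [[a b]] _ <- /=.
  rewrite /pushforward.
  have -> : v @^-1` `]a, b] = `]s a, s b]%classic.
    apply/seteqP; split => z; rewrite /= !in_itv/= => /andP[az zb].
      by rewrite -vmono vs az/= leNgt -vmono vs -leNgt.
    by rewrite -(vs a) vmono az/= -(vs b) leNgt vmono -leNgt.
  rewrite /md /density_measure lebesgue_measure_itv/= lte_fin.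
  case: ifPn => [ab|]; last first.
    by rewrite -leNgt -{1}(vs a) -{1}(vs b) leNgt vmono -leNgt => ba;
      rewrite set_itv_ge ?integral_set0// bnd_simp -leNgt.
  have sab : (s a < s b)%R by rewrite -vmono !vs.
  rewrite integral_itv_obnd_cbnd; last first.
    exact/measurable_funTS/measurableT_comp.
  rewrite (continuous_FTC2 (F := v))//.
  - by rewrite !vs.
  - exact: continuous_subspaceT.
  - split => //.
    + by apply: cvg_at_right_filter; exact: cv.
    + by apply: cvg_at_left_filter; exact: cv.
  - by move=> x _; rewrite derive1E; apply: derive_val.
transitivity (\int[pm]_x h x).
  by apply: eq_measure_integral => A mA _; exact: pE.
rewrite [LHS](@ge0_integral_pushforward _ _ (measurableTypeR R) (measurableTypeR R) R v mv md setT h)//= preimage_setT.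
rewrite (@ge0_integral_density _ md v')//.
exact: measurableT_comp.
Qed.

Lemma ge0_integral_opp (h : R -> \bar R) :
  measurable_fun [set: R] h -> (forall x, 0 <= h x) ->
  \int[leb]_x h x = \int[leb]_x h (- x)%R.
Proof.
move=> mh h0.
transitivity (\int[pushforward leb (-%R : _ -> measurableTypeR R)]_x h x).
  by apply: eq_measure_integral => A mA _; rewrite -[LHS]lebesgue_measureN.
by rewrite ge0_integral_pushforward.
Qed.

Lemma ge0_integral_shift (c : R) (h : R -> \bar R) :
  measurable_fun [set: R] h -> (forall x, 0 <= h x) ->
  \int[leb]_x h x = \int[leb]_x h (x + c)%R.
Proof.
move=> mh h0.
have dv z : is_derive z (1%R : R) (fun x : R => x + c)%R (cst 1%R z).
  by apply: is_derive_eq; rewrite addr0.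
rewrite (@ge0_integral_increasing_subst _ (cst 1%R) (fun x => x - c)%R h dv)//.
- by apply: eq_integral => x _; rewrite mule1.
- by move=> z; exact: cvg_cst.
- by move=> x; rewrite subrK.
- by move=> x y; rewrite ltrD2r.
Qed.

End change_of_variables.

(** * Measurability of integrals with a parameter *)

Section parametric_Rintegral.
Context d1 d2 (T1 : measurableType d1) (T2 : measurableType d2) (R : realType).
Variable m2 : {sigma_finite_measure set T2 -> \bar R}.
Local Open Scope ereal_scope.

Lemma measurable_fun_integral_param (h : T1 * T2 -> \bar R) (D : set T2) :
  measurable D -> measurable_fun [set: T1 * T2] h -> (forall z, 0 <= h z) ->
  measurable_fun [set: T1] (fun x => \int[m2]_(y in D) h (x, y)).
Proof.
move=> mD mh h0.
under eq_fun do rewrite integral_mkcond.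
pose g (z : T1 * T2) := h z * (\1_D z.2)%:E.
rewrite (_ : (fun _ => _) = fun x => \int[m2]_y g (x, y)).
  apply: measurable_fun_fubini_tonelli_F.
  - apply: emeasurable_funM => //; apply/measurable_EFinP.
    by apply: measurableT_comp => //; exact: measurable_indic.
  - by move=> z; rewrite mule_ge0// lee_fin.
apply/funext => x; apply: eq_integral => y _.
rewrite patchE /g indicE/=; case: ifPn => _; first by rewrite mule1.
by rewrite mule0.
Qed.

(** Integrability is not involved: the integrals of the positive and negative parts are measurable
    by Tonelli, and so are their extended difference and its image under [fine]. *)
Lemma measurable_fun_Rintegral_param (h : T1 * T2 -> R) (D : set T2) :
  measurable D -> measurable_fun [set: T1 * T2] h ->
  measurable_fun [set: T1] (fun x => (\int[m2]_(y in D) h (x, y))%R).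
Proof.
move=> mD mh; rewrite /Rintegral.
apply: (measurableT_comp (f := fine)) => //.
under eq_fun do rewrite integralE.
have mhE : measurable_fun [set: T1 * T2] (EFin \o h) by exact/measurable_EFinP.
apply: emeasurable_funB.
- rewrite [X in measurable_fun _ X](_ : _ =
      fun x => \int[m2]_(y in D) (EFin \o h)^\+ (x, y)).
    exact: (measurable_fun_integral_param mD (measurable_funepos mhE)
      (fun z => funepos_ge0 _ z)).
  by apply/funext => x; apply: eq_integral => y _; rewrite !funeposE.
- rewrite [X in measurable_fun _ X](_ : _ =
      fun x => \int[m2]_(y in D) (EFin \o h)^\- (x, y)).
    exact: (measurable_fun_integral_param mD (measurable_funeneg mhE)
      (fun z => funeneg_ge0 _ z)).
  by apply/funext => x; apply: eq_integral => y _; rewrite !funenegE.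
Qed.

End parametric_Rintegral.

Lemma powRD_gt0 (R : realType) (a r s : R) : 0 < a -> a `^ (r + s) = a `^ r * a `^ s.
Proof. by move=> a0; rewrite powRD// (gt_eqF a0) implybT. Qed.

(** * The Dunkl measure as a weighted Lebesgue measure *)

Section dunkl_basic.
Context {R : realType} (nu : R).
Local Notation leb := (@lebesgue_measure R).
Local Notation mu := (dunkl_measure nu).
Local Notation m := (2 * nu + 1).

Definition dunkl_cst : R := (2 `^ (nu + 1) * gamma_fun (nu + 1))^-1.

Lemma dunkl_cst_ge0 : 0 <= dunkl_cst.
Proof. by rewrite invr_ge0 mulr_ge0 ?powR_ge0// gamma_fun_ge0. Qed.

Lemma dunkl_densityE x : dunkl_density nu x = dunkl_cst * `|x| `^ m.
Proof. by []. Qed.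

Lemma ge0_integral_dunkl (D : set R) (h : R -> \bar R) :
  measurable D -> measurable_fun D h -> (forall x, D x -> 0 <= h x)%E ->
  (\int[mu]_(x in D) h x = \int[leb]_(x in D) (h x * (dunkl_density nu x)%:E))%E.
Proof.
move=> mD mh h0; apply: (@ge0_integral_density R mu) => //.
- exact: measurable_dunkl_density.
- exact: dunkl_density_ge0.
Qed.

Lemma ge0_integral_dunkl_opp (h : R -> \bar R) :
  measurable_fun [set: R] h -> (forall x, 0 <= h x)%E ->
  (\int[mu]_x h x = \int[mu]_x h (- x)%R)%E.
Proof.
move=> mh h0; rewrite !ge0_integral_dunkl//; last exact: measurableT_comp.
rewrite ge0_integral_opp.
- by apply: eq_integral => x _; rewrite !dunkl_densityE normrN.
- apply: emeasurable_funM => //; apply/measurable_EFinP.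
  exact: measurable_dunkl_density.
- by move=> x; rewrite mule_ge0// lee_fin dunkl_density_ge0.
Qed.

(** Tonelli with respect to [mu] needs this when the fractional integral is shown to be measurable
    in [x]. *)
Let dunkl_measure_sigma_finite : sigma_finite setT mu.
Proof.
pose F (n : nat) : set (measurableTypeR R) :=
  [set x | dunkl_density nu x <= n%:R] `&` `[- n%:R, n%:R]%classic.
have mF n : measurable (F n).
  apply: measurableI => //.
  rewrite -[X in measurable X]setTI.
  have := @measurable_fun_ler _ (measurableTypeR R) R setT (dunkl_density nu) (cst n%:R).
  apply => //; exact: measurable_dunkl_density.
exists F.
  apply/esym; rewrite -subTset => x _.
  have [k Hk] : exists k : nat, Num.max (dunkl_density nu x) `|x| <= k%:R.
    by exists (Num.truncn (Num.max (dunkl_density nu x) `|x|)).+1;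
      apply/ltW/truncnS_gt.
  move: Hk; rewrite ge_max => /andP[k1 k2].
  by exists k => //; split => //=; rewrite in_itv/= -ler_norml.
move=> n; split; first exact: mF.
rewrite /dunkl_measure.
apply: (@le_lt_trans _ _ (\int[leb]_(x in F n) cst n%:R%:E x)%E).
  apply: ge0_le_integral => //=.
  - by move=> x _; rewrite lee_fin dunkl_density_ge0.
  - by apply/measurable_EFinP/measurable_funTS; exact: measurable_dunkl_density.
  - by move=> x [+ _]; rewrite lee_fin.
rewrite integral_cst//.
apply: lte_mul_pinfty; rewrite ?lee_fin//.
apply: (@le_lt_trans _ _ (leb `[- n%:R, n%:R]%classic)).
  by apply: le_measure; rewrite ?inE//; move=> x [].
by rewrite lebesgue_measure_itv/=; case: ifPn => _; rewrite ?ltry// -EFinB ltry.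
Qed.

HB.instance Definition _ := @Measure_isSigmaFinite.Build _ _ _ mu
  dunkl_measure_sigma_finite.

End dunkl_basic.

(** * Shells *)

Section shell.
Context {R : realType}.
Implicit Types x r z : R.

Definition shell x r : set R := [set z | `| `|z| - `|x| | < r].

Lemma measurable_shell x r : measurable (shell x r).
Proof.
rewrite -[shell x r]setTI.
suff h : measurable_fun setT (fun z : R => `| `|z| - `|x| | < r) by exact: h.
apply: measurable_fun_ltr => //.
apply: measurableT_comp => //; exact: measurable_funB.
Qed.

Lemma subset_shell x y r r' : `| `|y| - `|x| | + r' <= r ->
  shell y r' `<=` shell x r.
Proof.
move=> h z; rewrite /shell/= => zy; apply: lt_le_trans h.
by rewrite (le_lt_trans (ler_distD `|y| _ _))// addrC ltrD2l.
Qed.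

Lemma subset_shell_itv x r : shell x r `<=` `[- (`|x| + r), `|x| + r]%classic.
Proof.
move=> z; rewrite /shell/= in_itv/= ltr_distl => /andP[_ zr].
by rewrite -ler_norml ltW.
Qed.

Context (m : R).
Hypothesis m0 : 0 <= m.

Definition shell_vol x r : R := r * (Num.max `|x| r) `^ m.

(** With [m = 2 nu + 1] this is [r^d / V(x, r)], in the form in which the spherical cap estimates
    produce it. *)
Definition shell_ratio x r : R := (r / Num.max `|x| r) `^ m.

Lemma max_norm_gt0 x r : 0 < r -> 0 < Num.max `|x| r.
Proof. by move=> r0; rewrite lt_max r0 orbT. Qed.

Lemma shell_vol_gt0 x r : 0 < r -> 0 < shell_vol x r.
Proof. by move=> r0; rewrite mulr_gt0// powR_gt0// max_norm_gt0. Qed.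

Lemma shell_ratioE x r : 0 < r -> shell_ratio x r = r `^ (m + 1) / shell_vol x r.
Proof.
move=> r0; have M0 := max_norm_gt0 x r0.
rewrite /shell_ratio /shell_vol powRM ?invr_ge0 ?(ltW r0) ?(ltW M0)//.
rewrite powRD_gt0// powRr1 ?(ltW r0)// invfM mulrA mulfK ?gt_eqF//.
by rewrite -powR_inv1 ?(ltW M0)// -powRrM mulN1r powRN.
Qed.

Lemma shell_vol_scale x r k : 0 < r -> 1 <= k ->
  shell_vol x (k * r) <= k `^ (m + 1) * shell_vol x r.
Proof.
move=> r0 k1; have k0 : 0 < k by exact: lt_le_trans k1.
rewrite /shell_vol powRD_gt0// powRr1 ?(ltW k0)//.
rewrite (_ : _ * k * _ = k * r * (k `^ m * Num.max `|x| r `^ m)); last by ring.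
rewrite ler_pM2l ?mulr_gt0//.
have M0 := max_norm_gt0 x r0.
rewrite -powRM ?(ltW k0) ?(ltW M0)//; apply: ge0_ler_powR => //; rewrite ?nnegrE.
- by rewrite le_max normr_ge0.
- by rewrite mulr_ge0 ?(ltW k0) ?(ltW M0).
- rewrite ge_max maxr_pMr ?(ltW k0)// le_max; apply/andP; split.
    by rewrite ler_peMl.
  by rewrite le_max lexx orbT.
Qed.

End shell.

Section dunkl_shell.
Context {R : realType} (nu : R).
Local Notation leb := (@lebesgue_measure R).
Local Notation mu := (dunkl_measure nu).
Local Notation m := (2 * nu + 1).
Hypothesis hnu : - 2^-1 <= nu.

Let m0 : 0 <= m. Proof. by move: hnu => ?; lra. Qed.

Lemma lebesgue_shell_le (x r : R) : 0 < r -> (leb (shell x r) <= (4 * r)%:E)%E.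
Proof.
move=> r0.
pose A : set R := `]`|x| - r, `|x| + r[%classic.
pose B : set R := `]- `|x| - r, - `|x| + r[%classic.
have AB : shell x r `<=` A `|` B.
  move=> z; rewrite /shell/= ltr_distl => /andP[z1 z2].
  have [z0|z0] := leP 0 z.
    by left; rewrite /A/= in_itv/=; rewrite -(ger0_norm z0) z1.
  right; rewrite /B/= in_itv/=; rewrite (ltr0_norm z0) in z1 z2.
  by apply/andP; split; move: z1 z2; rewrite ?(ltr0_norm z0)//; lra.
apply: (@le_trans _ _ (leb (A `|` B))).
  apply: le_measure; rewrite ?inE//; first exact: measurable_shell.
  by apply: measurableU; exact: measurable_itv.
have mA : measurable (A : set (measurableTypeR R)) by exact: measurable_itv.
have mB : measurable (B : set (measurableTypeR R)) by exact: measurable_itv.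
apply: (le_trans (measureU2 _ mA mB)).
rewrite /= !lebesgue_measure_itv/= !lte_fin !ifT; [|lra|lra].
by rewrite -!EFinB -EFinD lee_fin; lra.
Qed.

(** A shell lies in two intervals of length [2 r], whence the 4; on it [|z| <= 2 max(|x|, r)],
    whence the power of 2. *)
Definition shell_cst : R := 4 * dunkl_cst nu * 2 `^ m.

Lemma shell_cst_ge0 : 0 <= shell_cst.
Proof. by rewrite !mulr_ge0 ?powR_ge0 ?dunkl_cst_ge0. Qed.

Lemma dunkl_shell_le (x r : R) : 0 < r ->
  (mu (shell x r) <= (shell_cst * shell_vol m x r)%:E)%E.
Proof.
move=> r0; set M : R := Num.max `|x| r; have M0 : 0 < M by exact: max_norm_gt0.
pose c := dunkl_cst nu * (2 * M) `^ m.
have c0 : 0 <= c by rewrite mulr_ge0 ?powR_ge0 ?dunkl_cst_ge0.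
have mS : measurable (shell x r) by exact: measurable_shell.
apply: (@le_trans _ _ (\int[leb]_(z in shell x r) cst c%:E z)%E).
  apply: ge0_le_integral => //=.
  - by move=> z _; rewrite lee_fin dunkl_density_ge0.
  - by apply/measurable_EFinP/measurable_funTS; exact: measurable_dunkl_density.
  - move=> z zr; rewrite lee_fin dunkl_densityE.
    rewrite ler_wpM2l ?dunkl_cst_ge0// ge0_ler_powR ?nnegrE//.
      by rewrite mulr_ge0 ?(ltW M0).
    have := subset_shell_itv zr; rewrite /= in_itv/= -ler_norml => /le_trans; apply.
    by rewrite mulr_natl mulr2n lerD// /M le_max lexx ?orbT.
rewrite integral_cst// (@le_trans _ _ (c%:E * (4 * r)%:E)%E)//.
  by apply: lee_wpmul2l; rewrite ?lee_fin// lebesgue_shell_le.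
rewrite -EFinM lee_fin /c /shell_cst /shell_vol -/M powRM ?(ltW M0)//.
by rewrite le_eqVlt; apply/orP; left; apply/eqP; ring.
Qed.

End dunkl_shell.

(** * A derivative and an improper integral *)

Section calculus.
Context {R : realType}.
Local Notation leb := (@lebesgue_measure R).

(** [z |z|] extends the square on the half-line to an increasing continuously differentiable
    bijection of the line, as the substitution for the Bessel kernel requires. The quadratic error
    bound [key] covers all sign patterns, including a crossing of 0. *)
Lemma is_derive_signed_square (x : R) :
  is_derive x (1 : R) (fun z : R => z * `|z|) (2 * `|x|).
Proof.
have key h : `|(x + h) * `|x + h| - x * `|x| - 2 * `|x| * h| <= h ^+ 2.
  rewrite ler_norml; have [x0|x0] := leP 0 x; have [xh|xh] := leP 0 (x + h).
  - by rewrite (ger0_norm x0) (ger0_norm xh); nra.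
  - by rewrite (ger0_norm x0) (ltr0_norm xh); nra.
  - by rewrite (ltr0_norm x0) (ger0_norm xh); nra.
  - by rewrite (ltr0_norm x0) (ltr0_norm xh); nra.
have cv : h^-1 *: ((fun z : R => z * `|z|) (h *: (1 : R) + x) - x * `|x|)
    @[h --> (0 : R)^'] --> 2 * `|x|.
  apply/cvgrPdist_le => /= e e0; near=> h.
  have h0 : h != 0 by near: h; exact: nbhs_dnbhs_neq.
  have he : `|h| <= e.
    near: h; apply: dnbhs0_le; exact: e0.
  rewrite /GRing.scale/= mulr1 (addrC h); apply: le_trans he.
  rewrite -(ler_pM2l (x := `|h|)) ?normr_gt0// -normrM mulrBr mulVKf//.
  have := key h; rewrite -normrM -expr2 normrX real_normK ?num_real//.
  by rewrite distrC; apply: le_trans; rewrite le_eqVlt; apply/orP; left; apply/eqP; congr `|_|; ring.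
apply: DeriveDef.
- by apply/cvg_ex; exists (2 * `|x|).
- by apply/cvg_lim.
Unshelve. all: by end_near. Qed.

Lemma continuous_powR_gt0 (a x : R) : 0 < x -> {for x, continuous (fun w : R => w `^ a)}.
Proof.
move=> x0; apply: differentiable_continuous; apply/derivable1_diffP.
by have [] := is_derive1_powR a x0.
Qed.

(** For [a < 1] the integrand blows up at 0. The fundamental theorem is therefore applied on
    [[e / (n + 1), e]], the contribution of the lower endpoint is discarded, and monotone
    convergence gives the limit. *)
Lemma ge0_integral_powR_le (a e : R) : 0 < a -> 0 < e ->
  (\int[leb]_(w in `]0%R, e]) (w `^ (a - 1))%:E <= (e `^ a / a)%:E)%E.
Proof.
move=> a0 e0.
pose F (n : nat) : set (measurableTypeR R) := `[e / n.+1%:R, e]%classic.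
have mp : measurable_fun [set: R] (fun w : R => (w `^ (a - 1))%:E).
  by apply/measurable_EFinP; exact: measurable_powR.
have -> : `]0, e]%classic = \bigcup_n F n.
  apply/seteqP; split => [w /=|w [n _]]; rewrite /F/= !in_itv/= => /andP[w0 we].
    exists (Num.truncn (e / w)) => //=; rewrite in_itv/= we andbT.
    by rewrite ler_pdivrMr// mulrC -ler_pdivrMr// ltW// truncnS_gt.
  by rewrite we andbT (lt_le_trans _ w0)// divr_gt0.
have ndF : nondecreasing_seq F.
  move=> k n kn; apply/subsetPset => w; rewrite /F/= !in_itv/= => /andP[w0 ->].
  rewrite andbT (le_trans _ w0)// ler_pM2l// lef_pV2 ?posrE//.
  by rewrite ler_nat.
have cv := @ge0_nondecreasing_set_cvg_integral _ (measurableTypeR R) R F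
  (fun w : R => (w `^ (a - 1))%:E) leb ndF.
have {}cv := cv (fun n => measurable_itv _) (fun n => measurable_funTS mp)
  (fun n x _ => powR_ge0 _ _).
rewrite -(cvg_lim _ cv)//; apply: lime_le; first exact: (cvgP _ cv).
near=> n.
have en0 : 0 < e / n.+1%:R by rewrite divr_gt0.
have ene : e / n.+1%:R < e.
  rewrite ltr_pdivrMr// ltr_pMr// ltr1n ltnS.
  (* For [n = 0] the interval is a single point, and the fundamental theorem asks for a
     nondegenerate one. *)
  by near: n; exists 1%N => //.
rewrite /F (continuous_FTC2 (F := fun w : R => w `^ a / a) ene).
- by rewrite -EFinB lee_fin lerBlDr lerDl divr_ge0 ?powR_ge0 ?ltW.
- apply/continuous_subspace_itv => w; rewrite in_itv/= => /andP[w0 _].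
  by apply: continuous_powR_gt0; exact: lt_le_trans w0.
- split.
  + move=> w; rewrite in_itv/= => /andP[w0 _].
    apply: derivableM => //; apply: derivable_powR.
    by rewrite in_itv/= andbT (lt_trans _ w0).
  + apply: cvg_at_right_filter; apply: cvgMl; exact: continuous_powR_gt0.
  + apply: cvg_at_left_filter; apply: cvgMl; exact: continuous_powR_gt0.
- move=> w; rewrite in_itv/= => /andP[w0 _].
  have {}w0 : 0 < w by exact: lt_trans w0.
  have dp := is_derive1_powR a w0.
  rewrite derive1E; have : is_derive w (1 : R) (fun w : R => w `^ a / a) (w `^ (a - 1)).
    apply: is_derive_eq; rewrite /GRing.scale/= mulr0 add0r mulrCA.
    by rewrite mulVKf// gt_eqF.
  by move=> ?; exact: derive_val.
Unshelve. all: by end_near. Qed.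

End calculus.

(** * Bessel translation of even functions *)

Section bessel.
Context {R : realType}.
Variable nu : R.
Local Notation leb := (@lebesgue_measure R).
Local Notation m := (2 * nu + 1).
Implicit Types (G : R -> R) (x y z r u : R).

Definition bessel_weight u : R := (1 - u ^+ 2) `^ (nu - 2^-1).

Lemma bessel_weight_ge0 u : 0 <= bessel_weight u.
Proof. exact: powR_ge0. Qed.

Lemma measurable_bessel_weight : measurable_fun [set: R] bessel_weight.
Proof.
apply: (measurableT_comp (measurable_powR _)).
by apply: measurable_funB => //; exact: measurable_funX.
Qed.

Lemma measurable_dunkl_rho :
  measurable_fun [set: (R * R) * R] (fun w => dunkl_rho w.1.1 w.1.2 w.2).
Proof.
apply: (measurableT_comp (continuous_measurable_fun (@sqrt_continuous R))).
have m11 : measurable_fun [set: (R * R) * R] (fun w => w.1.1).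
  exact: (measurableT_comp measurable_fst).
have m12 : measurable_fun [set: (R * R) * R] (fun w => w.1.2).
  exact: (measurableT_comp measurable_snd).
apply: measurable_funD.
  by apply: measurable_funD; exact: measurable_funX.
by apply: measurable_funM => //; apply: measurable_funM => //; exact: measurable_funM.
Qed.

(* [dunkl_const nu] times this is the Bessel translation of an even [G]. *)
Definition bessel G x y : \bar R :=
  (\int[leb]_(u in `[(-1)%R, 1%R]) (G (dunkl_rho x y u) * bessel_weight u)%:E)%E.

Lemma bessel_ge0 G x y : (forall z, 0 <= G z) -> (0 <= bessel G x y)%E.
Proof.
by move=> G0; apply: integral_ge0 => u _; rewrite lee_fin mulr_ge0// bessel_weight_ge0.
Qed.

Lemma measurable_bessel_integrand G : measurable_fun [set: R] G ->
  measurable_fun [set: (R * R) * R]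
    (fun w => (G (dunkl_rho w.1.1 w.1.2 w.2) * bessel_weight w.2)%:E).
Proof.
move=> mG; apply/measurable_EFinP; apply: measurable_funM.
  exact: (measurableT_comp mG measurable_dunkl_rho).
exact: (measurableT_comp measurable_bessel_weight).
Qed.

Lemma measurable_bessel G : measurable_fun [set: R] G -> (forall z, 0 <= G z) ->
  measurable_fun [set: R * R] (fun w => bessel G w.1 w.2).
Proof.
move=> mG G0.
apply: (@measurable_fun_integral_param _ _ _ _ R leb _ _ _ (measurable_bessel_integrand mG)) => //.
by move=> w; rewrite lee_fin mulr_ge0// bessel_weight_ge0.
Qed.

Lemma besselC G x y : bessel G x y = bessel G y x.
Proof.
apply: eq_integral => u _; congr (G _ * _)%:E.
by rewrite /dunkl_rho; congr Num.sqrt; ring.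
Qed.

Lemma ge0_integral_opp_itv (h : R -> \bar R) :
  measurable_fun [set: R] h -> (forall u, 0 <= h u)%E ->
  (\int[leb]_(u in `[(-1)%R, 1%R]) h u = \int[leb]_(u in `[(-1)%R, 1%R]) h (- u)%R)%E.
Proof.
move=> mh h0; rewrite integral_mkcond [RHS]integral_mkcond ge0_integral_opp.
- apply: eq_integral => u _; rewrite !patchE.
  have -> // : (- u \in `[(-1)%R, 1%R]%classic) = (u \in `[(-1)%R, 1%R]%classic).
  by rewrite !mem_setE !in_itv/= lerN2 lerNl andbC.
- by apply/(measurable_restrictT _ _).1 => //; exact: measurable_funTS.
- by move=> u; rewrite patchE; case: ifP.
Qed.

Lemma besselNl G x y : measurable_fun [set: R] G -> (forall z, 0 <= G z) ->
  bessel G (- x) y = bessel G x y.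
Proof.
move=> mG G0; rewrite /bessel [RHS]ge0_integral_opp_itv.
- apply: eq_integral => u _; congr (G _ * _)%:E.
    by rewrite /dunkl_rho; congr Num.sqrt; ring.
  by rewrite /bessel_weight sqrrN.
- have := measurable_bessel_integrand mG.
  by move=> /(@measurable_fun_pair2 _ _ _ _ _ _ _ (x, y)).
- by move=> u; rewrite lee_fin mulr_ge0// bessel_weight_ge0.
Qed.

Lemma besselNr G x y : measurable_fun [set: R] G -> (forall z, 0 <= G z) ->
  bessel G x (- y) = bessel G x y.
Proof. by move=> mG G0; rewrite besselC besselNl// besselC. Qed.

Lemma bessel_norm G x y : measurable_fun [set: R] G -> (forall z, 0 <= G z) ->
  bessel G `|x| `|y| = bessel G x y.
Proof.
move=> mG G0; have [x0|x0] := leP 0 x; have [y0|y0] := leP 0 y;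
  by rewrite ?(ger0_norm x0) ?(ltr0_norm x0) ?(ger0_norm y0) ?(ltr0_norm y0)
    ?besselNl ?besselNr.
Qed.

(** By the law of cosines, minus the cosine of the angle between the sides [x] and [y] of a triangle
    with sides [x], [y], [z]. *)
Definition bessel_angle x y z : R := (z ^+ 2 - x ^+ 2 - y ^+ 2) / (2 * x * y).

(* [z / (x * y)] is the derivative of [bessel_angle x y] at [z], the inverse of
   [u |-> dunkl_rho x y u]. *)
Definition bessel_kernel x y z : R :=
  if 0 <= 1 - bessel_angle x y z ^+ 2 then
    bessel_weight (bessel_angle x y z) * (z / (x * y))
  else 0.

Lemma bessel_subst G x y : 0 < x -> 0 < y ->
  measurable_fun [set: R] G -> (forall z, 0 <= G z) ->
  bessel G x y = (\int[leb]_(z in `]0%R, +oo[) (G z * bessel_kernel x y z)%:E)%E.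
Proof.
move=> x0 y0 mG G0; have k0 : 0 < 2 * x * y by rewrite !mulr_gt0.
(* [v] is [bessel_angle x y] with [z ^ 2] replaced by its increasing extension [f], and [s] is its
   inverse. *)
pose f z : R := z * `|z|.
pose v z : R := (f z - x ^+ 2 - y ^+ 2) / (2 * x * y).
pose v' z : R := `|z| / (x * y).
pose t u : R := 2 * x * y * u + x ^+ 2 + y ^+ 2.
pose s u : R := Num.sg (t u) * Num.sqrt `|t u|.
have fs u : f (s u) = t u.
  rewrite /f /s normrM normr_sg.
  have [->|tu] := eqVneq (t u) 0; first by rewrite sgr0 !mul0r.
  rewrite /= mul1r (ger0_norm (sqrtr_ge0 _)) -mulrA -expr2 sqr_sqrtr//.
  by rewrite -numEsg.
have vs : cancel s v.
  by move=> u; rewrite /v fs /t; field; rewrite ?gt_eqF.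
have fmono : {homo f : a b / a < b}.
  move=> a b ab; rewrite /f; have [a0|a0] := leP 0 a; have [b0|b0] := leP 0 b.
  - by rewrite (ger0_norm a0) (ger0_norm b0); nra.
  - by move: (lt_trans (le_lt_trans a0 ab) b0); rewrite ltxx.
  - by rewrite (ltr0_norm a0) (ger0_norm b0); nra.
  - by rewrite (ltr0_norm a0) (ltr0_norm b0); nra.
have vmono : {mono v : a b / a < b}.
  apply: leW_mono; apply: le_mono => a b /fmono ab.
  by rewrite /v ltr_pM2r ?invr_gt0// !ltrD2r.
have dv z : is_derive z (1 : R) v (v' z).
  have df : is_derive z (1 : R) f (2 * `|z|) := is_derive_signed_square z.
  rewrite /v; apply: is_derive_eq.
  by rewrite /v' /GRing.scale/= !subr0 mulr0 add0r; field; rewrite !gt_eqF.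
have cv' : continuous v'.
  by move=> z; apply: cvgMl; exact: norm_continuous.
have v'0 z : 0 <= v' z by rewrite divr_ge0// mulr_ge0 ?ltW.
pose H : R -> \bar R :=
  (fun u => (G (dunkl_rho x y u) * bessel_weight u)%:E) \_ `[(-1)%R, 1%R].
have mH : measurable_fun [set: R] H.
  apply/(measurable_restrictT _ _).1 => //; apply: measurable_funTS.
  by have /(@measurable_fun_pair2 _ _ _ _ _ _ _ (x, y)) := measurable_bessel_integrand mG.
have H0 u : (0 <= H u)%E.
  by rewrite /H patchE; case: ifP => _//; rewrite lee_fin mulr_ge0// bessel_weight_ge0.
rewrite /bessel integral_mkcond -/H.
rewrite (@ge0_integral_increasing_subst _ v v' s H dv cv' v'0 vs vmono mH H0).
rewrite [RHS]integral_mkcond; apply: eq_integral => z _; move: (z : R) => {}z.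
rewrite [RHS]patchE mem_setE in_itv/= andbT /H patchE mem_setE in_itv/=.
have [z0|z0|z0] := ltgtP 0 z.
- have fz : f z = z ^+ 2 by rewrite /f ger0_norm ?expr2// ltW.
  have vE : v z = bessel_angle x y z by rewrite /v fz.
  have rE : dunkl_rho x y (v z) = z.
    rewrite /dunkl_rho vE (_ : _ + _ = z ^+ 2); last first.
      by rewrite /bessel_angle; field; rewrite !gt_eqF.
    by rewrite sqrtr_sqr ger0_norm// ltW.
  rewrite rE vE /bessel_kernel subr_ge0 -ler_norml.
  have -> : (bessel_angle x y z ^+ 2 <= 1) = (`|bessel_angle x y z| <= 1).
    by rewrite -[X in _ <= X](expr1n _ 2) -[X in X <= _]real_normK ?num_real// ler_pXn2r ?nnegrE.
  case: ifP => _; last by rewrite mulr0 mul0e.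
  by rewrite -EFinM /v' (ger0_norm (ltW z0)) mulrA.
(* Since [x ^ 2 + y ^ 2 >= 2 x y], a negative [z] is sent below -1, outside the range of [u]; only
   positive [z] contribute. *)
- have : v z < -1.
    rewrite /v ltr_pdivrMr// /f ltr0_norm//.
    have zz : 0 < z * z by rewrite nmulr_rgt0.
    have := sqr_ge0 (x - y); nra.
  by rewrite ltNge => /negbTE -> /=; rewrite mul0e.
- by rewrite /v' -z0 normr0 mul0r mule0.
Qed.

Lemma bessel_kernel_ge0 x y z : 0 < x -> 0 < y -> 0 < z -> 0 <= bessel_kernel x y z.
Proof.
move=> x0 y0 z0; rewrite /bessel_kernel; case: ifP => // _.
by rewrite mulr_ge0 ?powR_ge0// divr_ge0 ?mulr_ge0 ?ltW.
Qed.

(** [P] and [Q] are squared sines of two angles of the triangle with sides [x], [y], [z]. Both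
    [x^2 y^2 P] and [x^2 z^2 Q] are four times its squared area, which gives [PQ]; where no triangle
    exists both are negative and both kernels vanish. *)
Lemma bessel_kernelC x y z : 0 < x -> 0 < y -> 0 < z ->
  bessel_kernel x y z * y `^ m = bessel_kernel x z y * z `^ m.
Proof.
move=> x0 y0 z0; rewrite /bessel_kernel /bessel_weight.
set P := 1 - _ ^+ 2; set Q := 1 - bessel_angle x z y ^+ 2.
have PQ : P * y ^+ 2 = Q * z ^+ 2.
  by rewrite /P /Q /bessel_angle; field; rewrite !gt_eqF.
have y20 : 0 < y ^+ 2 by rewrite exprn_gt0.
have z20 : 0 < z ^+ 2 by rewrite exprn_gt0.
have -> : (0 <= P) = (0 <= Q).
  by rewrite -(pmulr_lge0 P y20) PQ pmulr_lge0.
case: ifP => Q0; last by rewrite !mul0r.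
have P0 : 0 <= P by rewrite -(pmulr_lge0 P y20) PQ pmulr_lge0.
have pE (w : R) : 0 < w -> w `^ m = (w ^+ 2) `^ (nu - 2^-1) * w ^+ 2.
  move=> w0; rewrite -powR_mulrn ?(ltW w0)// -powRrM -powRD_gt0//.
  by congr (_ `^ _); field.
have E : P `^ (nu - 2^-1) * (y ^+ 2) `^ (nu - 2^-1) =
         Q `^ (nu - 2^-1) * (z ^+ 2) `^ (nu - 2^-1).
  by rewrite -!powRM ?(ltW y20) ?(ltW z20)// PQ.
rewrite !pE//.
transitivity ((P `^ (nu - 2^-1) * (y ^+ 2) `^ (nu - 2^-1)) * (y * z / x)).
  by field; rewrite !gt_eqF.
by rewrite E; field; rewrite !gt_eqF.
Qed.

Lemma measurable_inv : measurable_fun [set: R] (fun w : R => w^-1).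
Proof.
rewrite (_ : (fun _ => _) = (fun w => w * (w ^+ 2) `^ (-1))).
  apply: measurable_funM => //; apply: (measurableT_comp (measurable_powR _)).
  exact: measurable_funX.
apply/funext => w; rewrite powR_inv1 ?sqr_ge0//.
have [->|w0] := eqVneq w 0; first by rewrite invr0 mul0r.
by rewrite expr2 invfM mulrA divff// mul1r.
Qed.

Lemma measurable_bessel_kernel x :
  measurable_fun [set: R * R] (fun w => bessel_kernel x w.1 w.2).
Proof.
have mi : measurable_fun [set: R] (fun w : R => w^-1) by exact: measurable_inv.
have ma : measurable_fun [set: R * R] (fun w => bessel_angle x w.1 w.2).
  apply: measurable_funM.
    apply: measurable_funB; last exact: measurable_funX.
    by apply: measurable_funB => //; exact: measurable_funX.
  by apply: (measurableT_comp mi); exact: measurable_funM.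
apply: measurable_fun_ifT => //.
  apply: measurable_fun_ler => //; apply: measurable_funB => //.
  exact: measurable_funX.
apply: measurable_funM; first exact: (measurableT_comp measurable_bessel_weight).
apply: measurable_funM => //.
by apply: (measurableT_comp mi); exact: measurable_funM.
Qed.

(** On the nonnegative numbers to which it is applied this is the indicator of [(-r, r)]. *)
Definition indic_lt r : R -> R := \1_(`]-oo, r[%classic).

Lemma measurable_indic_lt r : measurable_fun [set: R] (indic_lt r).
Proof. exact: measurable_indic. Qed.

Lemma indic_ltE r z : indic_lt r z = (z < r)%R%:R.
Proof. by rewrite /indic_lt indicE mem_setE in_itv. Qed.

Lemma indic_lt_ge0 r z : 0 <= indic_lt r z.
Proof. by rewrite indic_ltE ler0n. Qed.

(** Tonelli for the kernel form of the translation; [bessel_kernelC] then exchanges the roles of [y]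
    and [z]. *)
Lemma bessel_duality_gt0 G x r : 0 < x ->
  measurable_fun [set: R] G -> (forall z, 0 <= G z) ->
  (\int[leb]_(y in `]0%R, +oo[) (bessel G x y * (indic_lt r y * y `^ m)%:E) =
   \int[leb]_(z in `]0%R, +oo[) (bessel (indic_lt r) x z * (G z * z `^ m)%:E))%E.
Proof.
move=> x0 mG G0.
have mp : measurable_fun [set: R] (fun w : R => w `^ m) by exact: measurable_powR.
pose D : set (measurableTypeR R) := `]0%R, +oo[%classic.
have mD : measurable D by exact: measurable_itv.
have D0 z : D z -> 0 < z by rewrite /D/= in_itv/= andbT.
have m1D : measurable_fun [set: R] (\1_D : R -> R) by exact: measurable_indic.
pose h1 (w : R * R) : \bar R :=
  ((indic_lt r w.1 * w.1 `^ m) * (G w.2 * bessel_kernel x w.1 w.2))%:E.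
have mh1 : measurable_fun [set: R * R] h1.
  apply/measurable_EFinP; apply: measurable_funM.
    apply: measurable_funM; first exact: (measurableT_comp (measurable_indic_lt r)).
    exact: (measurableT_comp mp).
  apply: measurable_funM; first exact: (measurableT_comp mG).
  exact: measurable_bessel_kernel.
transitivity (\int[leb]_(y in D) \int[leb]_(z in D) h1 (y, z))%E.
  apply: eq_integral => y /set_mem /D0 y0.
  rewrite bessel_subst// muleC -ge0_integralZl//.
  - apply/measurable_EFinP/measurable_funTS; apply: measurable_funM => //.
    by have /(@measurable_fun_pair2 _ _ _ _ _ _ _ y) := measurable_bessel_kernel x.
  - by move=> z /D0 z0; rewrite lee_fin mulr_ge0// bessel_kernel_ge0.
  - by rewrite lee_fin mulr_ge0 ?powR_ge0// indic_lt_ge0.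
transitivity (\int[leb]_(z in D) \int[leb]_(y in D) h1 (y, z))%E.
  (* Tonelli is applied on the whole plane to a function that is nonnegative everywhere, whereas the
     kernel may be negative off the positive quadrant; the indicators cut it off. *)
  pose g (w : R * R) := (h1 w * (\1_D w.1 * \1_D w.2)%:E)%E.
  have mg : measurable_fun [set: R * R] g.
    apply: emeasurable_funM => //; apply/measurable_EFinP; apply: measurable_funM.
      exact: (measurableT_comp m1D measurable_fst).
    exact: (measurableT_comp m1D measurable_snd).
  have g0 w : (0 <= g w)%E.
    rewrite /g !indicE.
    case: (boolP (w.1 \in D)) => [/set_mem/D0 w10|_]; last by rewrite mul0r mule0.
    case: (boolP (w.2 \in D)) => [/set_mem/D0 w20|_]; last by rewrite mulr0 mule0.
    rewrite !mulr1 mule1 lee_fin mulr_ge0// mulr_ge0// ?powR_ge0 ?indic_lt_ge0//.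
    exact: bessel_kernel_ge0.
  transitivity (\int[leb]_y \int[leb]_z g (y, z))%E.
    rewrite integral_mkcond; apply: eq_integral => y _; rewrite patchE.
    rewrite /g/= indicE; case: ifPn => yD.
      rewrite integral_mkcond; apply: eq_integral => z _; rewrite patchE indicE mul1r.
      by case: ifPn => _; rewrite ?mule1 ?mule0.
    by rewrite integral0_eq// => z _; rewrite mul0r mule0.
  etransitivity; first exact: (@fubini_tonelli _ _ (measurableTypeR R)
    (measurableTypeR R) R leb leb g mg g0).
  rewrite [RHS]integral_mkcond; apply: eq_integral => z _; rewrite patchE.
  rewrite /g/= !indicE; case: ifPn => zD.
    rewrite [RHS]integral_mkcond; apply: eq_integral => y _; rewrite patchE indicE mulr1.
    by case: ifPn => _; rewrite ?mule1 ?mule0.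
  by rewrite integral0_eq// => y _; rewrite mulr0 mule0.
apply: eq_integral => z /set_mem /D0 z0.
rewrite (bessel_subst x0 z0 (@measurable_indic_lt r) (indic_lt_ge0 r)).
rewrite muleC -ge0_integralZl//.
- apply: eq_integral => y /set_mem /D0 y0; congr EFin.
  rewrite /h1/= mulrCA -!mulrA; congr (_ * _).
  by rewrite [in RHS]mulrCA; congr (_ * _); rewrite mulrC bessel_kernelC// mulrC.
- apply/measurable_EFinP/measurable_funTS; apply: measurable_funM => //.
    exact: measurable_indic_lt.
  by have /(@measurable_fun_pair2 _ _ _ _ _ _ _ z) := measurable_bessel_kernel x.
- by move=> y /D0 y0; rewrite lee_fin mulr_ge0 ?indic_lt_ge0// bessel_kernel_ge0.
- by rewrite lee_fin mulr_ge0 ?powR_ge0.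
Qed.

End bessel.

Lemma indic_shell (R : realType) (x r z : R) :
  \1_(shell x r) z = (`| `|z| - `|x| | < r)%R%:R :> R.
Proof.
by rewrite indicE; congr (nat_of_bool _)%:R; apply/idP/idP => [/set_mem|/mem_set].
Qed.

(** * Self-adjointness of the Bessel translation *)

Section duality.
Context {R : realType}.
Variable nu : R.
Local Notation leb := (@lebesgue_measure R).
Local Notation mu := (dunkl_measure nu).
Local Notation m := (2 * nu + 1).
Implicit Types (G : R -> R) (x y z r u : R).

Lemma ge0_integral_dunkl_even (h : R -> \bar R) :
  measurable_fun [set: R] h -> (forall x, 0 <= h x)%E ->
  (forall x, h (- x) = h x) ->
  (\int[mu]_x h x = (2 * dunkl_cst nu)%:E *
     \int[leb]_(x in `]0%R, +oo[) (h x * (x `^ m)%:E))%E.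
Proof.
move=> mh h0 hN.
have mm : measurable_fun [set: R] (fun x : R => `|x| `^ m).
  by apply: (measurableT_comp (measurable_powR _)).
pose k x := (h x * (`|x| `^ m)%:E)%E.
have mk : measurable_fun [set: R] k by apply: emeasurable_funM => //; exact/measurable_EFinP.
have k0 x : (0 <= k x)%E by rewrite mule_ge0// lee_fin powR_ge0.
rewrite ge0_integral_dunkl//.
transitivity (\int[leb]_x ((dunkl_cst nu)%:E * k x))%E.
  by apply: eq_integral => x _; rewrite dunkl_densityE EFinM muleCA.
rewrite (ge0_integralZl_EFin leb measurableT (fun x _ => k0 x) mk (dunkl_cst_ge0 nu)).
rewrite mulrC EFinM -muleA; congr (_ * _)%E.
have -> : (\int[leb]_(x in `]0%R, +oo[) (h x * (x `^ m)%:E) =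
          \int[leb]_(x in `]0%R, +oo[) k x)%E.
  by apply: eq_integral => x /set_mem/=; rewrite in_itv/= andbT => x0;
    rewrite /k ger0_norm// ltW.
have -> : [set: R] = `]-oo, 0%R]%classic `|` `]0%R, +oo[%classic.
  by apply/seteqP; split => x //= _; rewrite !in_itv/= andbT; case: (leP x 0); [left|right].
rewrite ge0_integral_setU//; last 2 first.
- exact: measurable_funTS.
- apply/disj_setPS => x /=; rewrite !in_itv/= andbT => -[x0 x1].
  by move: (lt_le_trans x1 x0); rewrite ltxx.
have -> : (\int[leb]_(x in `]-oo, 0%R]) k x = \int[leb]_(x in `]-oo, 0%R]) k (- x)%R)%E.
  by apply: eq_integral => x _; rewrite /k hN normrN.
rewrite -ge0_integration_by_substitution0//.
rewrite -integral_itv_obnd_cbnd; last exact: measurable_funTS.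
by rewrite -[X in (X + X)%E]mul1e -ge0_muleDl// -EFinD; congr (_ * _)%E.
Qed.

Lemma bessel0l G y : measurable_fun [set: R] G -> (forall z, 0 <= G z) ->
  bessel nu G 0 y =
  ((G `|y|)%:E * \int[leb]_(u in `[(-1)%R, 1%R]) (bessel_weight nu u)%:E)%E.
Proof.
move=> mG G0; rewrite -ge0_integralZl ?lee_fin//.
- apply: eq_integral => u _; rewrite -EFinM /dunkl_rho; congr (G _ * _)%:E.
  by rewrite expr0n/= mulr0 mul0r mul0r addr0 add0r sqrtr_sqr.
- by apply/measurable_EFinP/measurable_funTS; exact: measurable_bessel_weight.
- by move=> u _; rewrite lee_fin bessel_weight_ge0.
Qed.

Lemma bessel_duality G x r : measurable_fun [set: R] G ->
  (forall z, 0 <= G z) -> (forall z, G (- z) = G z) ->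
  (\int[mu]_(y in `](- r)%R, r[) bessel nu G x y =
   \int[mu]_z (bessel nu (indic_lt r) x z * (G z)%:E))%E.
Proof.
move=> mG G0 GN.
have mI := @measurable_indic_lt R r.
have I0 := @indic_lt_ge0 R r.
have mIn : measurable_fun [set: R] (fun y : R => indic_lt r `|y|).
  exact: (measurableT_comp mI).
have mb (H : R -> R) : measurable_fun [set: R] H -> (forall z, 0 <= H z) ->
    measurable_fun [set: R] (fun y : R => bessel nu H x y).
  by move=> mH H0; have /(@measurable_fun_pair2 _ _ _ _ _ _ _ x) := measurable_bessel nu mH H0.
transitivity (\int[mu]_y (bessel nu G x y * (indic_lt r `|y|)%:E))%E.
  rewrite integral_mkcond; apply: eq_integral => y _; rewrite patchE.
  rewrite mem_setE in_itv/= -ltr_norml indic_ltE.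
  by case: ifP => _; rewrite ?mule1 ?mule0.
(* The kernel form divides by [x]. At [x = 0] the translation of an even function is its product
   with the total weight, and the identity is immediate. *)
have [x0|x0] := eqVneq x 0.
  apply: eq_integral => y _; rewrite x0 !bessel0l//.
  have -> : G `|y| = G y by case: (ger0P y).
  by rewrite muleC [X in (_ * X)%E]muleC muleA.
rewrite !ge0_integral_dunkl_even//; first last.
- by move=> y; rewrite besselNr// normrN.
- by move=> y; rewrite mule_ge0 ?lee_fin// bessel_ge0.
- by apply: emeasurable_funM; [exact: mb|exact/measurable_EFinP].
- by move=> y; rewrite besselNr// GN.
- by move=> y; rewrite mule_ge0 ?lee_fin// bessel_ge0.
- by apply: emeasurable_funM; [exact: mb|exact/measurable_EFinP].
congr (_ * _)%E.
have x0' : 0 < `|x| by rewrite normr_gt0.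
transitivity (\int[leb]_(y in `]0%R, +oo[) (bessel nu G `|x| y * (indic_lt r y * y `^ m)%:E))%E.
  apply: eq_integral => y /set_mem/=; rewrite in_itv/= andbT => y0.
  by rewrite -[in LHS]bessel_norm// (ger0_norm (ltW y0)) EFinM muleA.
rewrite bessel_duality_gt0//.
apply: eq_integral => z /set_mem/=; rewrite in_itv/= andbT => z0.
by rewrite -[in RHS]bessel_norm// (ger0_norm (ltW z0)) EFinM muleA.
Qed.

End duality.

(** * Bessel translations of interval indicators *)

Section bessel_bounds.
Context {R : realType}.
Variable nu : R.
Hypothesis hnu : - 2^-1 < nu.
Local Notation leb := (@lebesgue_measure R).
Local Notation m := (2 * nu + 1).
Local Notation a := (nu + 2^-1).
Implicit Types (x y z r u : R).

Let a0 : 0 < a. Proof. by move: hnu => ?; lra. Qed.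

Let m0 : 0 <= m. Proof. by move: hnu => ?; lra. Qed.

(** Both signs of the exponent are treated, since [nu - 2^-1] is negative for [nu < 2^-1]. *)
Lemma powR_between (e t k : R) : 1 <= t -> t <= k ->
  Num.min 1 (k `^ e) <= t `^ e <= Num.max 1 (k `^ e).
Proof.
move=> t1 tk; have t0 : 0 < t by exact: lt_le_trans t1.
have k1 := le_trans t1 tk.
have [e0|e0] := leP 0 e.
  have h1 : 1 <= t `^ e by rewrite -(powRr0 t) ler_powR.
  have h2 : t `^ e <= k `^ e by apply: ge0_ler_powR; rewrite ?nnegrE// ltW// (lt_le_trans t0).
  by rewrite ge_min h1 le_max h2 orbT.
have h1 : t `^ e <= 1 by rewrite -(powRr0 t) ler_powR// ltW.
have h2 : k `^ e <= t `^ e.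
  have k0 : 0 < k := lt_le_trans t0 tk.
  rewrite -(opprK e) !(powRN _ (- e)) lef_pV2 ?posrE ?powR_gt0//.
  by apply: ge0_ler_powR; rewrite ?nnegrE ?oppr_ge0// ltW.
by rewrite ge_min h2 orbT le_max h1.
Qed.

(** For [x] and [z] of the same sign, [rho < r] confines [u] to such a neighbourhood of -1. There
    the weight behaves like [(1 + u)^(nu - 1/2)], so the cap weighs about [e^(nu + 1/2)]. *)
Definition bessel_cap (e : R) : \bar R :=
  (\int[leb]_(u in `[(-1)%R, (-1 + e)%R]) (bessel_weight nu u)%:E)%E.

Let mw : measurable_fun [set: R] (fun u : R => (bessel_weight nu u)%:E).
Proof. by apply/measurable_EFinP; exact: measurable_bessel_weight. Qed.

Let w0 u : (0 <= (bessel_weight nu u)%:E)%E.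
Proof. by rewrite lee_fin bessel_weight_ge0. Qed.

Let weightM u : -1 <= u -> u <= 0 -> bessel_weight nu u =
  (1 - u) `^ (nu - 2^-1) * (u + 1) `^ (nu - 2^-1).
Proof.
move=> u1 u0; rewrite -powRM; [|lra|lra].
by congr (_ `^ _); ring.
Qed.

Lemma bessel_cap_le : exists2 C : R, 0 < C &
  forall e : R, 0 < e -> e <= 1 -> (bessel_cap e <= (C * e `^ a)%:E)%E.
Proof.
(* On the cap [1 - u] lies in [[1, 2]], so [c2] bounds its power; the power of [1 + u] integrates to
   at most [e^a / a]. *)
pose c2 := Num.max 1 (2 `^ (nu - 2^-1) : R).
have c20 : 0 < c2 by rewrite lt_max ltr01.
exists (c2 / a); first by rewrite divr_gt0.
move=> e e0 e1.
pose g (w : R) : \bar R := (fun v : R => (v `^ (nu - 2^-1))%:E) \_ `[0, e] w.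
have mg : measurable_fun [set: R] g.
  apply/(measurable_restrictT _ _).1 => //; apply: measurable_funTS.
  by apply/measurable_EFinP; exact: measurable_powR.
have g0 w : (0 <= g w)%E by rewrite /g patchE; case: ifP => // _; rewrite lee_fin powR_ge0.
apply: (@le_trans _ _ (\int[leb]_(u in `[(-1)%R, (-1 + e)%R]) (c2%:E * g (u + 1)%R))%E).
  apply: ge0_le_integral => //.
  - exact: measurable_funTS.
  - apply: measurable_funTS; apply: emeasurable_funM => //.
    by apply: (measurableT_comp mg); exact: measurable_funD.
  - move=> u /=; rewrite in_itv/= => /andP[u1 u2].
    rewrite /g patchE mem_set/=; last by rewrite in_itv/=; apply/andP; split; lra.
    rewrite -EFinM lee_fin weightM//; last by lra.
    rewrite ler_wpM2r ?powR_ge0//.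
    by have /andP[] := @powR_between (nu - 2^-1) (1 - u) 2 ltac:(lra) ltac:(lra).
apply: (@le_trans _ _ (\int[leb]_u (c2%:E * g (u + 1)%R))%E).
  apply: ge0_subset_integral => //.
  - apply: emeasurable_funM => //.
    by apply: (measurableT_comp mg); exact: measurable_funD.
  - by move=> u _; rewrite mule_ge0// lee_fin ltW.
rewrite ge0_integralZl ?lee_fin ?(ltW c20)//; last first.
  by apply: (measurableT_comp mg); exact: measurable_funD.
rewrite -(ge0_integral_shift 1 mg g0) -integral_mkcond.
rewrite mulrAC -mulrA EFinM; apply: lee_wpmul2l; first by rewrite lee_fin ltW.
rewrite -integral_itv_obnd_cbnd; last first.
  by apply/measurable_EFinP/measurable_funTS; exact: measurable_powR.
have -> : nu - 2^-1 = a - 1 by field.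
exact: ge0_integral_powR_le.
Qed.

Lemma bessel_cap_ge : exists2 c : R, 0 < c &
  forall e : R, 0 < e -> e <= 1 -> ((c * e `^ a)%:E <= bessel_cap e)%E.
Proof.
pose c1 := Num.min 1 (2 `^ (nu - 2^-1) : R).
have c10 : 0 < c1 by rewrite lt_min ltr01 powR_gt0.
(* Only the upper half of the cap is kept. There [e / (u + 1)] lies in [[1, 2]], and [c3] bounds its
   power from below; the exponent is negated because of the inversion. *)
pose c3 := Num.min 1 (2 `^ (- (nu - 2^-1)) : R).
have c30 : 0 < c3 by rewrite lt_min ltr01 powR_gt0.
exists (c1 * c3 / 2); first by rewrite divr_gt0// mulr_gt0.
move=> e e0 e1.
pose k : R := c1 * (c3 * e `^ (nu - 2^-1)).
apply: (@le_trans _ _ (\int[leb]_(u in `[(-1 + e / 2)%R, (-1 + e)%R]) cst k%:E u)%E).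
  rewrite integral_cst//= lebesgue_measure_itv/= lte_fin ifT; last by lra.
  rewrite -EFinB -EFinM lee_fin /k.
  have -> : a = nu - 2^-1 + 1 by field.
  rewrite powRD_gt0// powRr1 ?(ltW e0)//.
  by rewrite le_eqVlt; apply/orP; left; apply/eqP; field.
apply: (@le_trans _ _ (\int[leb]_(u in `[(-1 + e / 2)%R, (-1 + e)%R]) (bessel_weight nu u)%:E)%E).
  apply: ge0_le_integral => //.
  - by move=> u _; rewrite lee_fin !mulr_ge0 ?powR_ge0// ltW.
  - exact: measurable_funTS.
  - move=> u /=; rewrite in_itv/= => /andP[u1 u2]; rewrite lee_fin.
    rewrite weightM; [|lra|lra]; apply: ler_pM => //.
    + exact: ltW.
    + by rewrite mulr_ge0 ?powR_ge0// ltW.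
    + by have /andP[] := @powR_between (nu - 2^-1) (1 - u) 2 ltac:(lra) ltac:(lra).
    + have u0 : 0 < u + 1 by lra.
      have -> : u + 1 = e * (e / (u + 1))^-1 by field; rewrite !gt_eqF.
      have eu0 : 0 < e / (u + 1) by rewrite divr_gt0.
      rewrite powRM ?invr_ge0 ?(ltW e0) ?(ltW eu0)// mulrC ler_wpM2l ?powR_ge0//.
      have -> : (e / (u + 1))^-1 = (e / (u + 1)) `^ (-1) by rewrite powR_inv1 ?(ltW eu0).
      rewrite -powRrM mulN1r.
      have h1 : 1 <= e / (u + 1) by rewrite ler_pdivlMr//; lra.
      have h2 : e / (u + 1) <= 2 by rewrite ler_pdivrMr//; lra.
      by have /andP[] := powR_between (- (nu - 2^-1)) h1 h2.
apply: ge0_subset_integral => //.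
- exact: measurable_funTS.
- by move=> u /=; rewrite !in_itv/= => /andP[u1 ->]; rewrite andbT; lra.
Qed.

Lemma bessel_weight_total : (\int[leb]_(u in `[(-1)%R, 1%R]) (bessel_weight nu u)%:E
  <= 2%:E * bessel_cap 1)%E.
Proof.
have -> : `[(-1)%R, 1%R]%classic = `[-1, 0]%classic `|` `]0, 1]%classic :> set R.
  apply/seteqP; split => u /=; rewrite !in_itv/=.
    by move=> /andP[-> ->] /=; rewrite andbT; case: (leP u 0); [left|right].
  by move=> [|] /andP[h1 h2]; apply/andP; split; lra.
rewrite ge0_integral_setU//; last 2 first.
- exact: measurable_funTS.
- apply/disj_setPS => u /=; rewrite !in_itv/= => -[/andP[_ h1] /andP[h2 _]].
  by move: (lt_le_trans h2 h1); rewrite ltxx.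
have -> : (2%:E * bessel_cap 1 = bessel_cap 1 + bessel_cap 1)%E.
  by rewrite -[X in (X + X)%E]mul1e -ge0_muleDl// -EFinD; congr (_ * _)%E.
rewrite /bessel_cap addNr; apply: leeD => //.
apply: (@le_trans _ _ (\int[leb]_(u in `[0%R, 1%R]) (bessel_weight nu u)%:E)%E).
  apply: ge0_subset_integral => //; first exact: measurable_funTS.
  by move=> u /=; rewrite !in_itv/= => /andP[/ltW -> ->].
rewrite integral_mkcond ge0_integral_opp.
- rewrite [X in (_ <= X)%E]integral_mkcond; apply: ge0_le_integral => //.
  + by move=> u _; rewrite patchE; case: ifP.
  + apply: (measurableT_comp (f := patch (fun=> 0%E) `[0%R, 1%R] (fun u : R => (bessel_weight nu u)%:E))) => //.
    by apply/(measurable_restrictT _ _).1 => //; exact: measurable_funTS.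
  + by apply/(measurable_restrictT _ _).1 => //; exact: measurable_funTS.
  + move=> u _; rewrite !patchE !mem_setE !in_itv/= oppr_ge0 lerNl andbC.
    by rewrite /bessel_weight sqrrN.
- by apply/(measurable_restrictT _ _).1 => //; exact: measurable_funTS.
- by move=> u; rewrite patchE; case: ifP.
Qed.

(** Both summands are nonnegative, so [rho < r] forces [|x - z| < r] and also a bound on [1 + u] of
    order [r^2 / (x z)]. *)
Lemma dunkl_rho_ge x z u : 0 <= x -> 0 <= z -> -1 <= u ->
  (x - z) ^+ 2 + 2 * x * z * (1 + u) = dunkl_rho x z u ^+ 2.
Proof.
move=> x0 z0 u1; rewrite /dunkl_rho sqr_sqrtr; first by ring.
have xz : 0 <= x * z * (1 + u) by rewrite !mulr_ge0//; lra.
by have := sqr_ge0 (x - z); nra.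
Qed.

Let mbi (x z r : R) :
  measurable_fun [set: R] (fun u : R => (indic_lt r (dunkl_rho x z u) * bessel_weight nu u)%:E).
Proof.
by have /(@measurable_fun_pair2 _ _ _ _ _ _ _ (x, z)) :=
  measurable_bessel_integrand nu (@measurable_indic_lt R r).
Qed.

Let bi0 (x z r u : R) : (0 <= (indic_lt r (dunkl_rho x z u) * bessel_weight nu u)%:E)%E.
Proof. by rewrite lee_fin mulr_ge0 ?bessel_weight_ge0 ?indic_lt_ge0. Qed.

(** Off the shell [rho >= |x - z| >= r]. On it, either [r] is comparable to [x] and the total weight
    is good enough, or [u] lies in a cap of size [(r / x)^2], of weight about [(r / x)^m]. *)
Lemma bessel_indic_le : exists2 C : R, 0 < C & forall x z r : R, 0 < r ->
  (bessel nu (indic_lt r) x z <= (C * shell_ratio m x r * \1_(shell x r) z)%:E)%E.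
Proof.
have [C C0 hC] := bessel_cap_le.
exists (2 * C * 2 `^ m); first by rewrite !mulr_gt0 ?powR_gt0.
move=> x z r r0.
rewrite -bessel_norm; [|exact: measurable_indic_lt|exact: indic_lt_ge0].
have -> : shell_ratio m x r = shell_ratio m `|x| r by rewrite /shell_ratio normr_id.
have -> : \1_(shell x r) z = \1_(shell `|x| r) `|z| :> R.
  by rewrite !indic_shell !normr_id.
move: (`|x| : R) (`|z| : R) (normr_ge0 x) (normr_ge0 z) => {}x {}z x0 z0.
rewrite indicE; have [/set_mem|] := boolP (z \in shell x r); last first.
  rewrite notin_setE /shell/= (ger0_norm x0) (ger0_norm z0) => /negP; rewrite -leNgt => xzr.
  rewrite mulr0 /bessel integral0_eq// => u /=; rewrite in_itv/= => /andP[u1 u2].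
  rewrite indic_ltE; have -> : (dunkl_rho x z u < r) = false; last by rewrite mul0r.
  apply/negbTE; rewrite -leNgt -(@ler_pXn2r _ 2)// ?nnegrE ?sqrtr_ge0 ?(ltW r0)//.
  rewrite -dunkl_rho_ge//; apply: (@le_trans _ _ ((x - z) ^+ 2)).
    by rewrite -[leRHS]real_normK ?num_real// distrC ler_pXn2r ?nnegrE ?(ltW r0).
  by rewrite lerDl !mulr_ge0//; lra.
rewrite mulr1 /shell/= (ger0_norm x0) (ger0_norm z0) => zx.
have M0 := max_norm_gt0 x r0.
(* For [x <= 2 r] one has [2^m shell_ratio >= 1], which explains the power of 2 in the constant. *)
have [x2r|x2r] := leP x (2 * r).
  apply: (@le_trans _ _ (\int[leb]_(u in `[(-1)%R, 1%R]) (bessel_weight nu u)%:E)%E).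
    apply: ge0_le_integral => //.
    - apply: measurable_funTS; exact: mbi.
    - exact: measurable_funTS.
    - move=> u _; rewrite lee_fin ler_piMl ?bessel_weight_ge0//.
      by rewrite indic_ltE; case: ltP.
  apply: (le_trans bessel_weight_total).
  apply: (@le_trans _ _ (2%:E * (C * 1 `^ a)%:E)%E).
    by apply: lee_wpmul2l => //; exact: hC.
  rewrite powR1 mulr1 -EFinM lee_fin -mulrA ler_peMr ?mulr_ge0 ?(ltW C0)//.
  rewrite /shell_ratio -powRM//; last by rewrite divr_ge0 ?(ltW r0) ?(ltW M0).
  rewrite -[leLHS](_ : 1 `^ m = 1); last by rewrite powR1.
  apply: ge0_ler_powR; rewrite ?nnegrE//.
    by rewrite mulr_ge0// divr_ge0 ?(ltW r0) ?(ltW M0).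
  rewrite mulrA ler_pdivlMr// mul1r ge_max (ger0_norm x0) x2r/=; lra.
have xr : r < x by lra.
have xp : 0 < x by lra.
have zx2 : x < 2 * z.
  by move: zx; rewrite ltr_norml => /andP[z1 z2]; lra.
have zp : 0 < z by lra.
(* As [z > x / 2], beyond this cap [2 x z (1 + u) >= x^2 e = r^2], hence [rho >= r]. *)
pose e := (r / x) ^+ 2.
have rx1 : r / x <= 1 by rewrite ler_pdivrMr// mul1r ltW.
have e0 : 0 < e by rewrite exprn_gt0// divr_gt0.
have e1 : e <= 1 by rewrite exprn_ile1// divr_ge0// ltW.
have E : shell_ratio m x r = e `^ a.
  rewrite /shell_ratio (ger0_norm x0) max_l ?(ltW xr)// /e.
  rewrite -powR_mulrn ?divr_ge0 ?(ltW r0)// -powRrM; congr (_ `^ _); by field.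
apply: (@le_trans _ _ (bessel_cap e)).
  rewrite /bessel_cap /bessel integral_mkcond [X in (_ <= X)%E]integral_mkcond.
  apply: ge0_le_integral => //.
  - by move=> u _; rewrite patchE; case: ifP.
  - by apply/(measurable_restrictT _ _).1 => //; apply: measurable_funTS; exact: mbi.
  - by apply/(measurable_restrictT _ _).1 => //; exact: measurable_funTS.
  - move=> u _; rewrite !patchE !mem_setE !in_itv/=.
    have [u1/=|u1] := leP (-1) u; last by [].
    have [ue|ue] := leP u (-1 + e).
      case: ifP => _; last exact: w0.
      rewrite lee_fin ler_piMl ?bessel_weight_ge0//.
      by rewrite indic_ltE; case: ltP.
    case: ifP => // u2; rewrite indic_ltE.
    have -> : (dunkl_rho x z u < r) = false; last by rewrite mul0r.
    apply/negbTE; rewrite -leNgt -(@ler_pXn2r _ 2)// ?nnegrE ?sqrtr_ge0 ?(ltW r0)//.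
    rewrite -dunkl_rho_ge//; have := sqr_ge0 (x - z).
    have ex : e * x ^+ 2 = r ^+ 2 by rewrite /e; field; rewrite gt_eqF.
    have h1 : x * x * e <= 2 * x * z * e.
      by rewrite ler_wpM2r ?(ltW e0)//; nra.
    have h2 : 2 * x * z * e <= 2 * x * z * (1 + u).
      by rewrite ler_wpM2l ?mulr_ge0//; lra.
    by lra.
apply: (le_trans (hC e e0 e1)); rewrite lee_fin E ler_wpM2r ?powR_ge0//.
have m1 : 1 <= 2 `^ m :> R by have := @ler_powR R 2 ltac:(lra) 0 m m0; rewrite powRr0.
nra.
Qed.

Lemma bessel_indic_ge : exists2 c : R, 0 < c & forall x z r : R, 0 < r ->
  ((c * shell_ratio m x r * \1_(shell x (r / 2)) z)%:E <= bessel nu (indic_lt r) x z)%E.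
Proof.
have [c c0 hc] := bessel_cap_ge.
exists (c * 4^-1 `^ a); first by rewrite mulr_gt0 ?powR_gt0.
move=> x z r r0.
rewrite -bessel_norm; [|exact: measurable_indic_lt|exact: indic_lt_ge0].
have -> : shell_ratio m x r = shell_ratio m `|x| r by rewrite /shell_ratio normr_id.
have -> : \1_(shell x (r / 2)) z = \1_(shell `|x| (r / 2)) `|z| :> R.
  by rewrite !indic_shell !normr_id.
move: (`|x| : R) (`|z| : R) (normr_ge0 x) (normr_ge0 z) => {}x {}z x0 z0.
rewrite indicE; have [/set_mem|] := boolP (z \in shell x (r / 2)); last first.
  by move=> _; rewrite mulr0 bessel_ge0//; exact: indic_lt_ge0.
rewrite mulr1 /shell/= (ger0_norm x0) (ger0_norm z0) => zx.
pose M := Num.max x r.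
have M0 : 0 < M by rewrite lt_max r0 orbT.
have xM : x <= M by rewrite le_max lexx.
have rM : r <= M by rewrite le_max lexx orbT.
(* With [z <= 3/2 M], on this cap [2 x z (1 + u) <= 3/4 r^2]. The half radius gives
   [(x - z)^2 < r^2 / 4], so that [rho < r] on the whole cap. *)
pose e := 4^-1 * (r / M) ^+ 2.
have rM1 : r / M <= 1 by rewrite ler_pdivrMr// mul1r.
have rM0 : 0 < r / M by rewrite divr_gt0.
have e0 : 0 < e by rewrite mulr_gt0// exprn_gt0.
have e4 : e <= 4^-1.
  by rewrite /e -[leRHS]mulr1 ler_pM2l// exprn_ile1// ltW.
have e1 : e <= 1 by lra.
have E : c * 4^-1 `^ a * shell_ratio m x r = c * e `^ a.
  rewrite /shell_ratio (ger0_norm x0) -/M /e [in RHS]powRM ?exprn_ge0 ?(ltW rM0)//.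
  rewrite -[LHS]mulrA; congr (_ * _); congr (_ * _).
  rewrite -powR_mulrn ?(ltW rM0)// -powRrM; congr (_ `^ _); by field.
rewrite E; apply: (le_trans (hc e e0 e1)).
rewrite /bessel_cap integral_mkcond [X in (_ <= X)%E]integral_mkcond.
apply: ge0_le_integral => //.
- by move=> u _; rewrite patchE; case: ifP.
- by apply/(measurable_restrictT _ _).1 => //; exact: measurable_funTS.
- by apply/(measurable_restrictT _ _).1 => //; apply: measurable_funTS; exact: mbi.
- move=> u _; rewrite !patchE !mem_setE !in_itv/=.
  have [u1/=|u1] := leP (-1) u; last by [].
  have [ue|ue] := leP u (-1 + e); last by case: ifP.
  have -> : u <= 1 by lra.
  rewrite indic_ltE; have -> : (dunkl_rho x z u < r) = true; last by rewrite mul1r.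
  rewrite -(@ltr_pXn2r _ 2)// ?nnegrE ?sqrtr_ge0 ?(ltW r0)//.
  rewrite -dunkl_rho_ge//.
  have h1 : (x - z) ^+ 2 < (r / 2) ^+ 2.
    by rewrite -[ltLHS]real_normK ?num_real// distrC ltr_pXn2r ?nnegrE ?divr_ge0 ?(ltW r0).
  have h2 : 2 * x * z * (1 + u) <= 2 * x * z * e.
    by rewrite ler_wpM2l ?mulr_ge0//; lra.
  have zM : z <= 3 / 2 * M.
    by move: zx; rewrite ltr_norml => /andP[z1 z2]; lra.
  have h3 : x * z <= M * (3 / 2 * M) by apply: ler_pM.
  have h4 : x * z * e <= M * (3 / 2 * M) * e by rewrite ler_wpM2r ?(ltW e0).
  have h5 : M * (3 / 2 * M) * e = 3 / 8 * r ^+ 2 by rewrite /e; field; rewrite gt_eqF.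
  have h6 : (r / 2) ^+ 2 = r ^+ 2 / 4 by field.
  by lra.
Qed.

End bessel_bounds.

Section integral_misc.
Local Open Scope ereal_scope.

(** [f] may change sign and need not be integrable: its integral is at most that of its positive
    part. *)
Lemma integral_le_ge0 d (T : measurableType d) (R : realType)
    (m : {measure set T -> \bar R}) (D : set T) (f g : T -> \bar R) :
  measurable D -> measurable_fun D f -> measurable_fun D g ->
  (forall x, D x -> 0 <= g x) -> (forall x, D x -> f x <= g x) ->
  \int[m]_(x in D) f x <= \int[m]_(x in D) g x.
Proof.
move=> mD mf mg g0 fg; rewrite integralE.
apply: (@le_trans _ _ (\int[m]_(x in D) f^\+ x)).
  by rewrite geeDl// oppe_le0; apply: integral_ge0.
apply: ge0_le_integral => //.
- exact: measurable_funepos.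
- by move=> x Dx; rewrite funeposE ge_max fg// g0.
Qed.

Lemma fine_le_abse (R : realType) (e : \bar R) : (`|fine e|)%:E <= `|e|.
Proof. by case: e => [r||] //=; rewrite normr0 leey. Qed.

(** Stated for any reflection-invariant measure, since it serves both Lebesgue measure in [u] and
    [mu] in [y]. *)
Lemma integral_opp_sym (R : realType) (m : {measure set (measurableTypeR R) -> \bar R})
    (D : set R) (h : R -> \bar R) :
  (forall k : R -> \bar R, measurable_fun [set: R] k -> (forall x, 0 <= k x) ->
    \int[m]_x k x = \int[m]_x k (- x)%R) ->
  measurable D -> (forall x, D x -> D (- x)%R) -> measurable_fun [set: R] h ->
  \int[m]_(x in D) h x = \int[m]_(x in D) h (- x)%R.
Proof.
move=> H mD DN mh.
have key (k : R -> \bar R) : measurable_fun [set: R] k -> (forall x, 0 <= k x) ->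
    \int[m]_(x in D) k x = \int[m]_(x in D) k (- x)%R.
  move=> mk k0; rewrite integral_mkcond [RHS]integral_mkcond H.
  - apply: eq_integral => x _; rewrite !patchE.
    have -> // : (- x \in D)%R = (x \in D).
    by apply/idP/idP => /set_mem /DN; rewrite ?opprK => /mem_set.
  - by apply/(measurable_restrictT _ _).1 => //; exact: measurable_funTS.
  - by move=> x; rewrite patchE; case: ifP.
rewrite integralE [RHS]integralE; congr (_ - _).
- rewrite key//; last exact: measurable_funepos.
  by apply: eq_integral => x _; rewrite !funeposE.
- rewrite key//; last exact: measurable_funeneg.
  by apply: eq_integral => x _; rewrite !funenegE.
Qed.

End integral_misc.

(** * Integrals of Dunkl translations *)

Section translation.
Context {R : realType}.
Variable nu : R.
Local Notation leb := (@lebesgue_measure R).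
Local Notation mu := (dunkl_measure nu).
Local Notation m := (2 * nu + 1).
Implicit Types (F : R -> R) (x y z r u : R).

Definition even_sum F z : R := F z + F (- z).

Lemma even_sum_ge0 F : (forall z, 0 <= F z) -> forall z, 0 <= even_sum F z.
Proof. by move=> F0 z; rewrite addr_ge0. Qed.

Lemma even_sumN F z : even_sum F (- z) = even_sum F z.
Proof. by rewrite /even_sum opprK addrC. Qed.

Lemma measurable_even_sum F : measurable_fun [set: R] F -> measurable_fun [set: R] (even_sum F).
Proof.
by move=> mF; apply: measurable_funD => //; exact: (measurableT_comp mF).
Qed.

Definition shell_int F x r : \bar R := (\int[mu]_(z in shell x r) (F z)%:E)%E.

Lemma shell_int_ge0 F x r : (forall z, 0 <= F z) -> (0 <= shell_int F x r)%E.
Proof. by move=> F0; apply: integral_ge0 => z _; rewrite lee_fin. Qed.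

Lemma shell_intE F x r : measurable_fun [set: R] F ->
  shell_int F x r = (\int[mu]_z (F z * \1_(shell x r) z)%:E)%E.
Proof.
move=> mF; rewrite /shell_int integral_mkcond; apply: eq_integral => z _.
by rewrite patchE indicE; case: ifP => _; rewrite ?mulr1 ?mulr0.
Qed.

Lemma shell_int_even_sum F x r : measurable_fun [set: R] F -> (forall z, 0 <= F z) ->
  shell_int (even_sum F) x r = (2%:E * shell_int F x r)%E.
Proof.
move=> mF F0; have mS := @measurable_shell R x r.
have mFN : measurable_fun [set: R] (fun z => F (- z)) by exact: (measurableT_comp mF).
rewrite /shell_int; under eq_integral do rewrite EFinD.
rewrite ge0_integralD//; last 4 first.
- by move=> z _; rewrite lee_fin.
- exact/measurable_EFinP/measurable_funTS.
- by move=> z _; rewrite lee_fin.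
- exact/measurable_EFinP/measurable_funTS.
rewrite -(@integral_opp_sym R mu (shell x r) (EFin \o F)).
- by rewrite -[X in (X + X)%E]mul1e -ge0_muleDl// -EFinD; congr (_ * _)%E.
- by move=> k mk k0; exact: ge0_integral_dunkl_opp.
- exact: mS.
- by move=> z; rewrite /shell/= normrN.
- exact/measurable_EFinP.
Qed.

Definition translation_integrand F x y u : R :=
  (F (dunkl_rho x y u) * (1 + (x + y) / dunkl_rho x y u) +
   F (- dunkl_rho x y u) * (1 - (x + y) / dunkl_rho x y u)) *
  (1 + u) * bessel_weight nu u.

Lemma dunkl_translationE F x y : nu != - 2^-1 ->
  dunkl_translation nu x F y = dunkl_const nu / 2 *
    \int[leb]_(u in `[-1, 1]) translation_integrand F x y u.
Proof. by rewrite /dunkl_translation => /negbTE ->. Qed.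

Lemma measurable_translation_integrand F : measurable_fun [set: R] F ->
  measurable_fun [set: (R * R) * R] (fun w => translation_integrand F w.1.1 w.1.2 w.2).
Proof.
move=> mF; have mr := @measurable_dunkl_rho R.
have m1 : measurable_fun [set: (R * R) * R] (fun w => w.1.1).
  exact: (measurableT_comp measurable_fst).
have m2 : measurable_fun [set: (R * R) * R] (fun w => w.1.2).
  exact: (measurableT_comp measurable_snd).
have mq : measurable_fun [set: (R * R) * R]
    (fun w => (w.1.1 + w.1.2) / dunkl_rho w.1.1 w.1.2 w.2).
  apply: measurable_funM; first exact: measurable_funD.
  exact: (measurableT_comp (@measurable_inv R)).
apply: measurable_funM; last exact: (measurableT_comp (measurable_bessel_weight nu)).
apply: measurable_funM; last exact: measurable_funD.
apply: measurable_funD; apply: measurable_funM.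
- exact: (measurableT_comp mF).
- exact: measurable_funD.
- by apply: (measurableT_comp mF); exact: measurableT_comp.
- exact: measurable_funB.
Qed.

Lemma measurable_dunkl_translation F : measurable_fun [set: R] F ->
  measurable_fun [set: R * R] (fun w => dunkl_translation nu w.1 F w.2).
Proof.
move=> mF; rewrite /dunkl_translation; case: (nu == - 2^-1).
  by apply: (measurableT_comp mF); exact: measurable_funD.
apply: measurable_funM => //.
exact: (@measurable_fun_Rintegral_param _ _ _ _ _ leb
  (fun w => translation_integrand F w.1.1 w.1.2 w.2) _ _
  (measurable_translation_integrand mF)).
Qed.

Lemma measurable_dunkl_translationr F x : measurable_fun [set: R] F ->
  measurable_fun [set: R] (fun y => dunkl_translation nu x F y).
Proof.
by move=> /measurable_dunkl_translation /(@measurable_fun_pair2 _ _ _ _ _ _ _ x).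
Qed.

(** The quotient [(x + y) / rho] is unbounded, but the factor [1 + u] compensates: from [(x + y)^2
    (1 + u) + (x - y)^2 (1 - u) = 2 rho^2] follows [|x + y| (1 + u) <= 2 rho]. The 4 is this 2 plus
    the bound 2 of [1 + u]. *)
Lemma translation_integrand_le F x y u : (forall z, 0 <= F z) -> -1 <= u -> u <= 1 ->
  `|translation_integrand F x y u| <=
  4 * (even_sum F (dunkl_rho x y u) * bessel_weight nu u).
Proof.
move=> F0 u1 u2; rewrite /translation_integrand /even_sum.
set p := dunkl_rho x y u; set t := (x + y) / p.
have u0 : 0 <= 1 + u by lra.
have h : `|t| * (1 + u) <= 2.
  rewrite /t; have [p0|p0] := eqVneq p 0.
    by rewrite p0 invr0 mulr0 normr0 mul0r.
  have pp : 0 < p by rewrite lt_def p0 sqrtr_ge0.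
  have E : p ^+ 2 = x ^+ 2 + y ^+ 2 + 2 * x * y * u.
    rewrite /p /dunkl_rho sqr_sqrtr//.
    have h1 := sqr_ge0 (x + y); have h2 := sqr_ge0 (x - y).
    have h3 : 0 <= (x + y) ^+ 2 * (1 + u) by rewrite mulr_ge0.
    have h4 : 0 <= (x - y) ^+ 2 * (1 - u) by rewrite mulr_ge0//; lra.
    by nra.
  rewrite normrM normfV (ger0_norm (ltW pp)) mulrAC ler_pdivrMr//.
  rewrite -(@ler_pXn2r _ 2)// ?nnegrE ?mulr_ge0 ?(ltW pp)//.
  rewrite exprMn real_normK ?num_real// exprMn E.
  have h2 : 0 <= (x - y) ^+ 2 * (1 - u) by rewrite mulr_ge0 ?sqr_ge0//; lra.
  have h3 : (x + y) ^+ 2 * (1 + u) <= 2 * (x ^+ 2 + y ^+ 2 + 2 * x * y * u) by lra.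
  have h4 : 0 <= x ^+ 2 + y ^+ 2 + 2 * x * y * u by rewrite -E exprn_ge0// ltW.
  rewrite expr2 mulrA; apply: (@le_trans _ _ (2 * (x ^+ 2 + y ^+ 2 + 2 * x * y * u) * (1 + u))).
    by rewrite ler_wpM2r.
  by nra.
rewrite !normrM (ger0_norm u0) (ger0_norm (bessel_weight_ge0 _ _)) mulrA.
rewrite ler_wpM2r ?bessel_weight_ge0//.
have /ler_normlP[h1 h2] : `|t * (1 + u)| <= 2 by rewrite normrM (ger0_norm u0).
have a0 := F0 p; have b0 := F0 (- p).
rewrite -[X in _ * X](ger0_norm u0) -normrM ler_norml.
have A1 : 0 <= F p * (2 - t * (1 + u)) by rewrite mulr_ge0//; lra.
have A2 : 0 <= F p * (2 + t * (1 + u)) by rewrite mulr_ge0//; lra.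
have B1 : 0 <= F (- p) * (2 - t * (1 + u)) by rewrite mulr_ge0//; lra.
have B2 : 0 <= F (- p) * (2 + t * (1 + u)) by rewrite mulr_ge0//; lra.
have A3 : 0 <= F p * (1 + u) by rewrite mulr_ge0.
have B3 : 0 <= F (- p) * (1 + u) by rewrite mulr_ge0.
have A4 : 0 <= F p * (1 - u) by rewrite mulr_ge0//; lra.
have B4 : 0 <= F (- p) * (1 - u) by rewrite mulr_ge0//; lra.
by apply/andP; split; lra.
Qed.

Lemma dunkl_translation_le F x y : nu != - 2^-1 -> 0 <= dunkl_const nu ->
  measurable_fun [set: R] F -> (forall z, 0 <= F z) ->
  ((`|dunkl_translation nu x F y|)%:E <=
    (2 * dunkl_const nu)%:E * bessel nu (even_sum F) x y)%E.
Proof.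
move=> nu12 c0 mF F0; rewrite dunkl_translationE// normrM.
rewrite (ger0_norm (divr_ge0 c0 _))// EFinM.
have -> : 2 * dunkl_const nu = dunkl_const nu / 2 * 4 by field.
rewrite [(_ * 4)%:E]EFinM -muleA; apply: lee_wpmul2l; first by rewrite lee_fin divr_ge0.
have mti : measurable_fun [set: R] (translation_integrand F x y).
  by have /(@measurable_fun_pair2 _ _ _ _ _ _ _ (x, y)) := measurable_translation_integrand mF.
have mbe : measurable_fun [set: R]
    (fun u => (even_sum F (dunkl_rho x y u) * bessel_weight nu u)%:E).
  by have /(@measurable_fun_pair2 _ _ _ _ _ _ _ (x, y)) :=
    measurable_bessel_integrand nu (measurable_even_sum mF).
rewrite /Rintegral (le_trans (fine_le_abse _))//.
rewrite (le_trans (le_abse_integral _ _ _))//.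
  exact/measurable_EFinP/measurable_funTS.
rewrite /bessel -ge0_integralZl//.
- apply: ge0_le_integral => //.
  + apply: measurable_funTS; apply: measurableT_comp => //; exact/measurable_EFinP.
  + by apply: measurable_funTS; apply: emeasurable_funM.
  + move=> u; rewrite /= in_itv/= => /andP[u1 u2].
    by rewrite lee_fin translation_integrand_le.
- exact: measurable_funTS.
- by move=> u _; rewrite lee_fin mulr_ge0 ?bessel_weight_ge0// even_sum_ge0.
Qed.

Lemma measurable_besselr (G : R -> R) x : measurable_fun [set: R] G -> (forall z, 0 <= G z) ->
  measurable_fun [set: R] (fun y => bessel nu G x y).
Proof.
by move=> mG G0; have /(@measurable_fun_pair2 _ _ _ _ _ _ _ x) := measurable_bessel nu mG G0.
Qed.

(** Duality moves the translation from [F] to the indicator of [(-r, r)], whose translate is bounded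
    by a multiple of the shell indicator. The extra 2 passes from [even_sum F] back to [F]. *)
Lemma bessel_shell_le : - 2^-1 < nu -> exists2 C : R, 0 < C &
  forall F x r, measurable_fun [set: R] F -> (forall z, 0 <= F z) -> 0 < r ->
  (\int[mu]_(y in `](- r)%R, r[) bessel nu (even_sum F) x y
    <= (C * shell_ratio m x r)%:E * shell_int F x r)%E.
Proof.
move=> hnu; have [C C0 hC] := bessel_indic_le hnu.
exists (C * 2); first by rewrite mulr_gt0.
move=> F x r mF F0 r0.
have mE := measurable_even_sum mF; have E0 := even_sum_ge0 F0.
have k0 : 0 <= C * shell_ratio m x r by rewrite mulr_ge0 ?powR_ge0// ltW.
rewrite bessel_duality//; last by move=> z; rewrite even_sumN.
have -> : ((C * 2 * shell_ratio m x r)%:E * shell_int F x r =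
          (C * shell_ratio m x r)%:E * shell_int (even_sum F) x r)%E.
  by rewrite shell_int_even_sum// muleA -EFinM; congr (_%:E * _)%E; ring.
have mI : measurable_fun [set: R] (fun z => (even_sum F z * \1_(shell x r) z)%:E).
  apply/measurable_EFinP; apply: measurable_funM => //.
  by apply: measurable_indic; exact: measurable_shell.
have I0 z : (0 <= (even_sum F z * \1_(shell x r) z)%:E)%E.
  by rewrite lee_fin mulr_ge0// indicE.
rewrite shell_intE// -ge0_integralZl//.
apply: ge0_le_integral => //.
- move=> z _; rewrite mule_ge0 ?lee_fin// bessel_ge0//; exact: indic_lt_ge0.
- apply: emeasurable_funM; last exact/measurable_EFinP.
  by apply: measurable_besselr; [exact: measurable_indic_lt|exact: indic_lt_ge0].
- exact: emeasurable_funM.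
- move=> z _; rewrite -EFinM.
  have -> : C * shell_ratio m x r * (even_sum F z * \1_(shell x r) z) =
    (C * shell_ratio m x r * \1_(shell x r) z) * even_sum F z by ring.
  by rewrite EFinM; apply: lee_wpmul2r; [rewrite lee_fin|exact: hC].
Qed.

Lemma bessel_shell_ge : exists2 c : R, 0 < c &
  forall F x r, measurable_fun [set: R] F -> (forall z, 0 <= F z) -> 0 < r ->
  ((c * shell_ratio m x r)%:E * shell_int F x (r / 2) <=
   \int[mu]_(y in `](- r)%R, r[) bessel nu (even_sum F) x y)%E.
Proof.
have [c c0 hc] := bessel_indic_ge nu.
exists (c * 2); first by rewrite mulr_gt0.
move=> F x r mF F0 r0.
have mE := measurable_even_sum mF; have E0 := even_sum_ge0 F0.
have k0 : 0 <= c * shell_ratio m x r by rewrite mulr_ge0 ?powR_ge0// ltW.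
rewrite bessel_duality//; last by move=> z; rewrite even_sumN.
have -> : ((c * 2 * shell_ratio m x r)%:E * shell_int F x (r / 2) =
          (c * shell_ratio m x r)%:E * shell_int (even_sum F) x (r / 2))%E.
  by rewrite shell_int_even_sum// muleA -EFinM; congr (_%:E * _)%E; ring.
have mI : measurable_fun [set: R] (fun z => (even_sum F z * \1_(shell x (r / 2)) z)%:E).
  apply/measurable_EFinP; apply: measurable_funM => //.
  by apply: measurable_indic; exact: measurable_shell.
have I0 z : (0 <= (even_sum F z * \1_(shell x (r / 2)) z)%:E)%E.
  by rewrite lee_fin mulr_ge0// indicE.
rewrite shell_intE// -ge0_integralZl//.
apply: ge0_le_integral => //.
- by move=> z _; rewrite mule_ge0.
- exact: emeasurable_funM.
- apply: emeasurable_funM; last exact/measurable_EFinP.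
  by apply: measurable_besselr; [exact: measurable_indic_lt|exact: indic_lt_ge0].
- move=> z _; rewrite -EFinM.
  have -> : c * shell_ratio m x r * (even_sum F z * \1_(shell x (r / 2)) z) =
    (c * shell_ratio m x r * \1_(shell x (r / 2)) z) * even_sum F z by ring.
  by rewrite EFinM; apply: lee_wpmul2r; [rewrite lee_fin|exact: hc].
Qed.

Definition translation_int F x r : \bar R :=
  (\int[mu]_(y in `](- r)%R, r[) (dunkl_translation nu x F y)%:E)%E.

Lemma translation_int_shift F x r : nu = - 2^-1 ->
  measurable_fun [set: R] F -> (forall z, 0 <= F z) ->
  translation_int F x r = (\int[mu]_(z in [set z | `|z - x| < r]%R) (F z)%:E)%E.
Proof.
move=> nuE mF F0.
have dE z : dunkl_density nu z = dunkl_cst nu.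
  rewrite dunkl_densityE nuE (_ : 2 * - 2^-1 + 1 = 0); last by field.
  by rewrite powRr0 mulr1.
have mA : measurable ([set z | `|z - x| < r]%R : set R).
  rewrite -[X in measurable X]setTI.
  suff h : measurable_fun setT (fun z : R => `|z - x| < r) by exact: h.
  apply: measurable_fun_ltr => //.
  by apply: measurableT_comp => //; exact: measurable_funB.
rewrite /translation_int !ge0_integral_dunkl//; last 4 first.
- exact/measurable_EFinP/measurable_funTS.
- by move=> z _; rewrite lee_fin.
- by apply/measurable_EFinP/measurable_funTS; exact: measurable_dunkl_translationr.
- by move=> z _; rewrite /dunkl_translation nuE eqxx lee_fin.
rewrite integral_mkcond [RHS]integral_mkcond [RHS](@ge0_integral_shift _ x).
- apply: eq_integral => y _; rewrite !patchE !dE.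
  rewrite mem_setE in_itv/= -ltr_norml.
  have -> : (y + x \in [set z | `|z - x| < r]%R) = (`|y| < r).
    by apply/idP/idP => [/set_mem/=|h]; rewrite ?addrK//; apply/mem_set; rewrite /= addrK.
  by case: ifP => // _; rewrite /dunkl_translation nuE eqxx addrC.
- apply/(measurable_restrictT _ _).1 => //; apply: measurable_funTS.
  apply: emeasurable_funM; apply/measurable_EFinP => //.
  exact: measurable_dunkl_density.
- move=> z; rewrite patchE; case: ifP => // _.
  by rewrite mule_ge0// lee_fin// dunkl_density_ge0.
Qed.

Lemma shell_ratio0 x r : shell_ratio 0 x r = 1.
Proof. by rewrite /shell_ratio powRr0. Qed.

Let m_eq0 : nu = - 2^-1 -> m = 0.
Proof. by move=> ->; field. Qed.

Lemma translation_int_le : - 2^-1 <= nu -> 0 <= dunkl_const nu ->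
  exists2 C : R, 0 < C &
  forall F x r, measurable_fun [set: R] F -> (forall z, 0 <= F z) -> 0 < r ->
  (translation_int F x r <= (C * shell_ratio m x r)%:E * shell_int F x r)%E.
Proof.
move=> hnu c0; have [nuE|nuN] := eqVneq nu (- 2^-1).
  exists 1 => // F x r mF F0 r0; rewrite m_eq0// shell_ratio0 mulr1 mul1e.
  rewrite translation_int_shift//; apply: ge0_subset_integral => //.
  - rewrite -[X in measurable X]setTI.
    suff h : measurable_fun setT (fun z : R => `|z - x| < r) by exact: h.
    apply: measurable_fun_ltr => //.
    by apply: measurableT_comp => //; exact: measurable_funB.
  - exact: measurable_shell.
  - exact/measurable_EFinP/measurable_funTS.
  - by move=> z _; rewrite lee_fin.
  - by move=> z /=; apply: le_lt_trans; exact: ler_dist_dist.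
have {}hnu : - 2^-1 < nu by rewrite lt_def nuN.
have [C C0 hC] := bessel_shell_le hnu.
(* The added 1 keeps the constant positive, as [dunkl_const nu] is only known to be nonnegative
   here. *)
exists (2 * dunkl_const nu * C + 1).
  by rewrite ltr_pwDr//; apply: mulr_ge0; [exact: mulr_ge0|exact: ltW].
move=> F x r mF F0 r0.
have mE := measurable_even_sum mF; have E0 := even_sum_ge0 F0.
apply: (@le_trans _ _ ((2 * dunkl_const nu)%:E *
    \int[mu]_(y in `](- r)%R, r[) bessel nu (even_sum F) x y)%E).
  rewrite -ge0_integralZl//; last 3 first.
  - by apply: measurable_funTS; exact: measurable_besselr.
  - by move=> y _; exact: bessel_ge0.
  - by rewrite lee_fin mulr_ge0.
  apply: integral_le_ge0 => //.
  - apply/measurable_EFinP/measurable_funTS; exact: measurable_dunkl_translationr.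
  - by apply: measurable_funTS; apply: emeasurable_funM => //; exact: measurable_besselr.
  - by move=> y _; rewrite mule_ge0 ?bessel_ge0// lee_fin mulr_ge0.
  - move=> y _; apply: le_trans (dunkl_translation_le _ _ _ _ _ _) => //.
    by rewrite lee_fin ler_norm.
apply: (@le_trans _ _ ((2 * dunkl_const nu)%:E * ((C * shell_ratio m x r)%:E * shell_int F x r))%E).
  by apply: lee_wpmul2l; [rewrite lee_fin mulr_ge0|exact: hC].
rewrite muleA -EFinM; apply: lee_wpmul2r; first exact: shell_int_ge0.
by rewrite lee_fin mulrA ler_wpM2r ?powR_ge0// lerDl.
Qed.

End translation.

Lemma fin_num_halves (R : realType) (a : \bar R) :
  a \is a fin_num -> a = ((2^-1)%:E * (a + a))%E.
Proof. by case: a => // a _; rewrite -EFinD -EFinM; congr EFin; field. Qed.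

(** * Lower bound for integrals of translations *)

Section translation_lower.
Context {R : realType}.
Variable nu : R.
Local Notation leb := (@lebesgue_measure R).
Local Notation mu := (dunkl_measure nu).
Local Notation m := (2 * nu + 1).
Implicit Types (F : R -> R) (x y z r u : R).

Lemma measurable_translation_integrandr F x y : measurable_fun [set: R] F ->
  measurable_fun [set: R] (translation_integrand nu F x y).
Proof.
by move=> mF; have /(@measurable_fun_pair2 _ _ _ _ _ _ _ (x, y)) :=
  measurable_translation_integrand nu mF.
Qed.

Lemma integrable_translation_integrand F x y :
  measurable_fun [set: R] F -> (forall z, 0 <= F z) ->
  (bessel nu (even_sum F) x y < +oo)%E ->
  leb.-integrable `[(-1), 1]%classic (EFin \o translation_integrand nu F x y).
Proof.
move=> mF F0 fin.
have mti := measurable_translation_integrandr x y mF.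
have mbe : measurable_fun [set: R]
    (fun u => (even_sum F (dunkl_rho x y u) * bessel_weight nu u)%:E).
  by have /(@measurable_fun_pair2 _ _ _ _ _ _ _ (x, y)) :=
    measurable_bessel_integrand nu (measurable_even_sum mF).
apply/integrableP; split; first exact/measurable_EFinP/measurable_funTS.
apply: (@le_lt_trans _ _ (4%:E * bessel nu (even_sum F) x y)%E); last first.
  by apply: lte_mul_pinfty.
rewrite /bessel -ge0_integralZl//.
- apply: ge0_le_integral => //.
  + apply: measurable_funTS; apply: measurableT_comp => //; exact/measurable_EFinP.
  + by apply: measurable_funTS; apply: emeasurable_funM.
  + move=> u; rewrite /= in_itv/= => /andP[u1 u2].
    by rewrite lee_fin translation_integrand_le.
- exact: measurable_funTS.
- by move=> u _; rewrite lee_fin mulr_ge0 ?bessel_weight_ge0// even_sum_ge0.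
Qed.

Lemma Rintegral_opp_itv (h : R -> R) : measurable_fun [set: R] h ->
  \int[leb]_(u in `[-1, 1]) h u = \int[leb]_(u in `[-1, 1]) h (- u).
Proof.
move=> mh; rewrite /Rintegral; congr fine.
apply: (@integral_opp_sym R leb `[-1, 1]%classic (EFin \o h)) => //.
- by move=> k mk k0; exact: ge0_integral_opp.
- by move=> x /=; rewrite !in_itv/= lerN2 lerNl andbC.
- exact/measurable_EFinP.
Qed.

(* Averaging over the signs of x and y leaves only the even, positive part of
   the signed translation kernel. *)
Lemma translation_four_sum F x y : nu != - 2^-1 ->
  measurable_fun [set: R] F -> (forall z, 0 <= F z) ->
  (bessel nu (even_sum F) x y < +oo)%E ->
  (dunkl_translation nu x F y + dunkl_translation nu (- x) F y) +
  (dunkl_translation nu x F (- y) + dunkl_translation nu (- x) F (- y)) =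
  2 * dunkl_const nu * fine (bessel nu (even_sum F) x y).
Proof.
move=> nuN mF F0 fin.
have mE := measurable_even_sum mF; have E0 := even_sum_ge0 F0.
have I1 := integrable_translation_integrand mF F0 fin.
have fin4 : (bessel nu (even_sum F) (- x) (- y) < +oo)%E by rewrite besselNl// besselNr.
have fin2 : (bessel nu (even_sum F) (- x) y < +oo)%E by rewrite besselNl.
have fin3 : (bessel nu (even_sum F) x (- y) < +oo)%E by rewrite besselNr.
have I4 := integrable_translation_integrand mF F0 fin4.
have I2 := integrable_translation_integrand mF F0 fin2.
have I3 := integrable_translation_integrand mF F0 fin3.
have rN (a b u : R) : dunkl_rho (- a) b (- u) = dunkl_rho a b u.
  by rewrite /dunkl_rho; congr Num.sqrt; ring.
have rNr (a b u : R) : dunkl_rho a (- b) (- u) = dunkl_rho a b u.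
  by rewrite /dunkl_rho; congr Num.sqrt; ring.
have rNN (a b u : R) : dunkl_rho (- a) (- b) u = dunkl_rho a b u.
  by rewrite /dunkl_rho; congr Num.sqrt; ring.
rewrite !dunkl_translationE//.
set T1 := Rintegral _ _ _; set T2 := Rintegral _ _ _.
set T3 := Rintegral _ _ _; set T4 := Rintegral _ _ _.
(* [(x, y)] and [(- x, - y)] share [rho] and have opposite quotients [(x + y) / rho], so their sum
   keeps the factor [2 (1 + u)]. After [u -> - u] the other pair keeps [2 (1 - u)]; together they
   give 4. *)
transitivity (dunkl_const nu / 2 * ((T1 + T4) + (T2 + T3))); first by ring.
have E14 : T1 + T4 = \int[leb]_(u in `[-1, 1])
    (2 * (1 + u) * (even_sum F (dunkl_rho x y u) * bessel_weight nu u)).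
  rewrite /T1 /T4 -RintegralD//; apply: eq_Rintegral => u _.
  rewrite /translation_integrand rNN /even_sum -opprD mulNr; ring.
have E23 : T2 + T3 = \int[leb]_(u in `[-1, 1])
    (2 * (1 - u) * (even_sum F (dunkl_rho x y u) * bessel_weight nu u)).
  rewrite /T2 /T3 -RintegralD// Rintegral_opp_itv; last first.
    by apply: measurable_funD; exact: measurable_translation_integrandr.
  apply: eq_Rintegral => u _.
  rewrite /translation_integrand rN rNr /even_sum /bessel_weight sqrrN.
  by rewrite -(opprB y) (addrC (- x)) mulNr; ring.
have mbe : measurable_fun [set: R]
    (fun u => even_sum F (dunkl_rho x y u) * bessel_weight nu u).
  apply/measurable_EFinP.
  by have /(@measurable_fun_pair2 _ _ _ _ _ _ _ (x, y)) :=
    measurable_bessel_integrand nu mE.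
have be0 u : 0 <= even_sum F (dunkl_rho x y u) * bessel_weight nu u.
  by rewrite mulr_ge0 ?bessel_weight_ge0.
have Ib : leb.-integrable `[(-1), 1]%classic
    (EFin \o (fun u : R => even_sum F (dunkl_rho x y u) * bessel_weight nu u)).
  apply/integrableP; split; first exact/measurable_EFinP/measurable_funTS.
  by under eq_integral do rewrite /= ger0_norm//.
have J (k : R -> R) : measurable_fun [set: R] k ->
    (forall u, -1 <= u -> u <= 1 -> `|k u| <= 4) ->
    leb.-integrable `[(-1), 1]%classic
      (EFin \o (fun u : R => k u * (even_sum F (dunkl_rho x y u) * bessel_weight nu u))).
  move=> mk k4; apply: (@le_integrable _ (measurableTypeR R) R leb _ _ _
    (EFin \o (fun u : R => 4 * (even_sum F (dunkl_rho x y u) * bessel_weight nu u)))) => //.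
  - by apply/measurable_EFinP/measurable_funTS; exact: measurable_funM.
  - move=> u /=; rewrite in_itv/= => /andP[u1 u2].
    rewrite lee_fin !normrM ler_wpM2r//.
    by rewrite [leRHS]ger0_norm// k4.
  - by have := integrableZl _ 4 Ib; apply.
rewrite E14 E23 -RintegralD//; last 2 first.
- apply: (J (fun u => 2 * (1 + u))).
    by apply: measurable_funM => //; exact: measurable_funD.
  by move=> u u1 u2; rewrite ler_norml; apply/andP; split; lra.
- apply: (J (fun u => 2 * (1 - u))).
    by apply: measurable_funM => //; exact: measurable_funB.
  by move=> u u1 u2; rewrite ler_norml; apply/andP; split; lra.
have -> : fine (bessel nu (even_sum F) x y) = \int[leb]_(u in `[-1, 1])
  (even_sum F (dunkl_rho x y u) * bessel_weight nu u) by [].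
transitivity (dunkl_const nu / 2 * (4 * \int[leb]_(u in `[-1, 1])
  (even_sum F (dunkl_rho x y u) * bessel_weight nu u))); last by field.
congr (_ * _); rewrite -RintegralZl//; apply: eq_Rintegral => u _; ring.
Qed.

(** The interval being symmetric, [y] may be replaced by [- y], so twice the right-hand side is the
    integral of the sum in [translation_four_sum]. That identity needs a finite Bessel translation,
    which finiteness of the shell integrals of [F] provides almost everywhere. *)
Lemma translation_int_ge : - 2^-1 <= nu -> (nu != - 2^-1 -> 0 < dunkl_const nu) ->
  exists2 c : R, 0 < c &
  forall F x r, measurable_fun [set: R] F -> (forall z, 0 <= F z) ->
  (forall y s, (shell_int nu F y s < +oo)%E) -> 0 < r ->
  ((c * shell_ratio m x r)%:E * shell_int nu F x (r / 2) <=
   translation_int nu F x r + translation_int nu F (- x) r)%E.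
Proof.
move=> hnu cpos; have [nuE|nuN] := eqVneq nu (- 2^-1).
  have mE0 : m = 0 by rewrite nuE; field.
  exists 1 => // F x r mF F0 Ffin r0; rewrite mE0 shell_ratio0 mulr1 mul1e.
  rewrite !translation_int_shift//.
  have mA y : measurable ([set z | `|z - y| < r]%R : set R).
    rewrite -[X in measurable X]setTI.
    suff h : measurable_fun setT (fun z : R => `|z - y| < r) by exact: h.
    apply: measurable_fun_ltr => //.
    by apply: measurableT_comp => //; exact: measurable_funB.
  have mFE : measurable_fun [set: R] (EFin \o F) by exact/measurable_EFinP.
  have mP y : measurable_fun [set: R] ((EFin \o F) \_ [set z | `|z - y| < r]%R).
    exact: (measurable_restrictT (EFin \o F) (mA y)).1 (measurable_funTS mFE).
  rewrite /shell_int integral_mkcond [X in (_ <= X + _)%E]integral_mkcond.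
  rewrite [X in (_ <= _ + X)%E]integral_mkcond -ge0_integralD//; first last.
  - exact: mP.
  - by move=> z _; rewrite patchE; case: ifP => //; rewrite lee_fin.
  - exact: mP.
  - by move=> z _; rewrite patchE; case: ifP => //; rewrite lee_fin.
  apply: ge0_le_integral => //.
  - by move=> z _; rewrite patchE; case: ifP => //; rewrite lee_fin.
  - apply/(measurable_restrictT _ _).1; first exact: measurable_shell.
    exact: measurable_funTS.
  - apply: emeasurable_funD.
      exact: mP.
    exact: mP.
  - move=> z _; rewrite !patchE.
    case: ifPn => [/set_mem|_]; last first.
      by apply: adde_ge0; case: ifP => //; rewrite lee_fin.
    rewrite /shell/= => zx.
    (* A point of the shell is close to [x] if it has the sign of [x], and to [- x] otherwise. *)
    have [h|h] := leP 0 (z * x).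
      rewrite [X in (_ <= X + _)%E]ifT; last first.
        apply/mem_set => /=; have -> : `|z - x| = `| `|z| - `|x| |; last by lra.
        have [z0|z0] := leP 0 z; have [x0|x0] := leP 0 x.
        + by rewrite (ger0_norm z0) (ger0_norm x0).
        + have -> : z = 0 by apply/eqP; rewrite eq_le z0 andbT -(nmulr_lge0 z x0).
          by rewrite normr0 !sub0r !normrN normr_id.
        + have -> : x = 0.
            by apply/eqP; rewrite eq_le x0 andbT -(nmulr_rge0 x z0).
          by rewrite normr0 !subr0 normr_id.
        + by rewrite (ltr0_norm z0) (ltr0_norm x0) -opprD normrN.
      by rewrite leeDl//; case: ifP => //; rewrite lee_fin.
    rewrite [X in (_ <= _ + X)%E]ifT; last first.
      apply/mem_set => /=; have -> : `|z - - x| = `| `|z| - `|x| |; last by lra.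
      have [z0|z0] := leP 0 z; have [x0|x0] := leP 0 x.
      + by move: h; rewrite ltNge mulr_ge0.
      + by rewrite (ger0_norm z0) (ltr0_norm x0).
      + by rewrite (ltr0_norm z0) (ger0_norm x0) -opprD normrN opprK.
      + by move: h; rewrite ltNge nmulr_lge0// ltW.
    by rewrite leeDr//; case: ifP => //; rewrite lee_fin.
have {}hnu : - 2^-1 < nu by rewrite lt_def nuN.
have {cpos} c0 := cpos nuN.
have [C C0 hC] := bessel_shell_le hnu.
have [c c10 hc] := bessel_shell_ge nu.
exists (dunkl_const nu * c); first by rewrite mulr_gt0.
move=> F x r mF F0 Ffin r0.
have mE := measurable_even_sum mF; have E0 := even_sum_ge0 F0.
pose D : set (measurableTypeR R) := `](- r), r[%classic.
have mD : measurable D by exact: measurable_itv.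
pose b y := bessel nu (even_sum F) x y.
have mb : measurable_fun [set: R] b by exact: measurable_besselr.
have b0 y : (0 <= b y)%E by exact: bessel_ge0.
have Ib : mu.-integrable D b.
  apply/integrableP; split; first exact: measurable_funTS.
  under eq_integral do rewrite gee0_abs//.
  apply: (le_lt_trans (hC F x r mF F0 r0)).
  by apply: lte_mul_pinfty => //; rewrite lee_fin mulr_ge0 ?powR_ge0// ltW.
have mt y : measurable_fun [set: R] (fun z => (dunkl_translation nu y F z)%:E).
  by apply/measurable_EFinP; exact: measurable_dunkl_translationr.
have mtN y : measurable_fun [set: R] (fun z => (dunkl_translation nu y F (- z))%:E).
  exact: (measurableT_comp (mt y)).
have It y k : (y = x) \/ (y = - x) -> (forall z, k z = z) \/ (forall z, k z = - z) ->
    measurable_fun [set: R] (fun z => (dunkl_translation nu y F (k z))%:E) ->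
    mu.-integrable D (fun z => (dunkl_translation nu y F (k z))%:E).
  move=> yx kz mk.
  apply: (@le_integrable _ (measurableTypeR R) R mu _ _ _ (fun z => (2 * dunkl_const nu)%:E * b z)%E) => //.
  - exact: measurable_funTS.
  - move=> z _; apply: (le_trans (dunkl_translation_le _ _ nuN (ltW c0) mF F0)).
    rewrite gee0_abs; last by rewrite mule_ge0// lee_fin mulr_ge0// ltW.
    by rewrite /b; case: yx => ->; case: kz => ->; rewrite ?besselNl// ?besselNr.
  - exact: integrableZl.
have I1 := It x id (or_introl erefl) (or_introl (fun=> erefl)) (mt _).
have I2 := It (- x) id (or_intror erefl) (or_introl (fun=> erefl)) (mt _).
have I3 := It x -%R (or_introl erefl) (or_intror (fun=> erefl)) (mtN _).
have I4 := It (- x) -%R (or_intror erefl) (or_intror (fun=> erefl)) (mtN _).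
have TE y : translation_int nu F y r = (\int[mu]_(z in D) (dunkl_translation nu y F (- z))%:E)%E.
  rewrite /translation_int (@integral_opp_sym R mu D (fun z => (dunkl_translation nu y F z)%:E))//.
  - by move=> k mk k0; exact: ge0_integral_dunkl_opp.
  - by move=> z; rewrite /D/= !in_itv/= ltrN2 ltrNl andbC.
set T1 := translation_int nu F x r; set T2 := translation_int nu F (- x) r.
have T12 : (T1 + T2 + (T1 + T2) = (2 * dunkl_const nu)%:E * \int[mu]_(z in D) b z)%E.
  rewrite -integralZl//.
  have E1 : (T1 + T2 = \int[mu]_(z in D) ((dunkl_translation nu x F z)%:E +
      (dunkl_translation nu (- x) F z)%:E))%E.
    exact: (esym (integralD mD I1 I2)).
  have E2 : (T1 + T2 = \int[mu]_(z in D) ((dunkl_translation nu x F (- z))%:E +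
      (dunkl_translation nu (- x) F (- z))%:E))%E.
    by rewrite /T1 /T2 !TE; exact: (esym (integralD mD I3 I4)).
  have E3 := integralD mD (integrableD mD I1 I2) (integrableD mD I3 I4).
  rewrite {1}E1 E2 -E3.
  apply: ae_eq_integral => //.
  - exact: (measurable_funTS (emeasurable_funD (emeasurable_funD (mt x) (mt (- x)))
      (emeasurable_funD (mtN x) (mtN (- x))))).
  - by apply: measurable_funTS; apply: emeasurable_funM.
  have := integrable_ae mD Ib; apply: filterS => z h Dz.
  have bf := h Dz.
  rewrite -!EFinD translation_four_sum//; last by rewrite -ge0_fin_numE//.
  by rewrite EFinM fineK.
have fT1 : T1 \is a fin_num by exact: (integrable_fin_num mD I1).
have fT2 : T2 \is a fin_num by exact: (integrable_fin_num mD I2).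
clearbody T1 T2; clear TE.
have -> : (T1 + T2 = (dunkl_const nu)%:E * \int[mu]_(z in D) b z)%E.
  have fT : (T1 + T2)%E \is a fin_num by rewrite fin_numD fT1 fT2.
  rewrite [LHS](fin_num_halves fT).
  by rewrite T12 muleA -EFinM; congr (_%:E * _)%E; field.
rewrite -mulrA EFinM -muleA; apply: lee_wpmul2l; first by rewrite lee_fin ltW.
exact: hc.
Qed.

End translation_lower.

(** * Geometric and dyadic series *)

Section series_bounds.
Context {R : realType}.
Implicit Types (u : nat -> \bar R) (a q e c s : R).

Lemma nneseries_le_bound u (M : \bar R) : (forall n, 0 <= u n)%E ->
  (forall n, \sum_(0 <= i < n) u i <= M)%E -> (\sum_(i <oo) u i <= M)%E.
Proof.
move=> u0 uM; apply: lime_le; first by apply: is_cvg_nneseries => n _ _; exact: u0.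
by apply: nearW.
Qed.

Lemma nneseries_term_le u k : (forall n, 0 <= u n)%E -> (u k <= \sum_(i <oo) u i)%E.
Proof.
move=> u0; apply: (@le_trans _ _ (\sum_(0 <= i < k.+1) u i)%E).
  by rewrite big_nat_recr//= leeDr// sume_ge0.
by apply: nneseries_lim_ge => n _ _; exact: u0.
Qed.

Lemma geometric_nneseries_le a q : 0 <= a -> 0 < q -> q < 1 ->
  (\sum_(i <oo) (a * q ^+ i)%:E <= (a / (1 - q))%:E)%E.
Proof.
move=> a0 q0 q1; have q1' : 0 < 1 - q by rewrite subr_gt0.
apply: nneseries_le_bound => n; first by rewrite lee_fin mulr_ge0// exprn_ge0// ltW.
have -> : (\sum_(0 <= i < n) (a * q ^+ i)%:E = (a * (1 - q ^+ n) / (1 - q))%:E)%E.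
  elim: n => [|n IH]; first by rewrite big_geq// expr0 subrr mulr0 mul0r.
  rewrite big_nat_recr//= IH -EFinD exprS; congr EFin; field.
  by rewrite gt_eqF.
by rewrite lee_fin ler_pM2r ?invr_gt0// ler_piMr// lerBlDr lerDl exprn_ge0// ltW.
Qed.

Lemma powR_gt1 a e : 1 < a -> 0 < e -> 1 < a `^ e.
Proof.
move=> a1 e0; have := @gt0_ltr_powR R e e0 1 a; rewrite powR1; apply => //.
- by rewrite nnegrE.
- by rewrite nnegrE (le_trans ler01)// ltW.
Qed.

Lemma powR_rad c s e (j : nat) : 0 < c -> 0 < s ->
  (s * c ^+ j) `^ e = s `^ e * (c `^ e) ^+ j.
Proof.
move=> c0 s0; rewrite powRM ?exprn_ge0 ?(ltW s0) ?(ltW c0)//; congr (_ * _).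
elim: j => [|j IH]; first by rewrite !expr0 powR1.
by rewrite !exprS powRM ?exprn_ge0 ?(ltW c0)// IH.
Qed.

(* The exponents of the two radii [s / 2 ^ j] and [s * 2 ^ j] share an index. *)
Lemma dyadic_radius s (rho : R) : 0 < s -> 0 < rho ->
  exists j, (s * 2^-1 ^+ j / 2 <= rho < s * 2^-1 ^+ j) \/
            (s * 2 ^+ j / 2 <= rho < s * 2 ^+ j).
Proof.
move=> s0 rho0; have [rs|rs] := ltP rho s.
  have ex : exists n, s * 2^-1 ^+ n.+1 <= rho.
    have := @cvg_geometric R 1 2^-1 (ltac:(rewrite ger0_norm; lra)).
    move=> /cvgrPdist_lt /(_ (rho / s) (divr_gt0 rho0 s0)) [N _ hN].
    exists N; have := hN N.+1 (leqnSn N).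
    rewrite /geometric/= mul1r sub0r normrN ger0_norm ?exprn_ge0 ?invr_ge0//.
    by rewrite ltr_pdivlMr// mulrC => /ltW.
  have h1 := ex_minnP ex; case: h1 => j hj jmin.
  exists j; left; apply/andP; split.
    by move: hj; rewrite exprSr mulrA.
  case: j hj jmin => [|j] hj jmin; first by rewrite expr0 mulr1.
  by rewrite ltNge; apply/negP => /jmin; rewrite ltnn.
have ex : exists n, rho < s * 2 ^+ n.+1.
  exists (Num.truncn (rho / s)).
  rewrite mulrC -ltr_pdivrMr//; apply: (lt_le_trans (truncnS_gt _)).
  by rewrite -natrX ler_nat ltnW// ltn_expl.
have h1 := ex_minnP ex; case: h1 => j hj jmin.
exists j.+1; right; apply/andP; split; last by [].
rewrite exprSr mulrA mulfK//.
case: j hj jmin => [|j] hj jmin; first by rewrite expr0 mulr1.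
by rewrite leNgt; apply/negP => /jmin; rewrite ltnn.
Qed.

End series_bounds.

Lemma measurable_nneseries d (T : measurableType d) (R : realType)
    (h : nat -> T -> \bar R) :
  (forall k x, 0 <= h k x)%E -> (forall k, measurable_fun [set: T] (h k)) ->
  measurable_fun [set: T] (fun x => \sum_(i <oo) h i x)%E.
Proof.
move=> h0 mh.
rewrite (_ : (fun _ => _) = fun x => (\sum_(i <oo | i \in xpredT) h i x)%E).
  exact: ge0_emeasurable_sum.
by apply/funext => x; apply: eq_eseriesl => i.
Qed.

(** * The translated Riesz kernel *)

Section kernel_bound.
Context {R : realType}.
Variables (nu g : R).
Hypotheses (hnu : - 2^-1 <= nu) (g0 : 0 < g) (gd : g < dunkl_dim nu).
Local Notation leb := (@lebesgue_measure R).
Local Notation mu := (dunkl_measure nu).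
Local Notation m := (2 * nu + 1).
Local Notation d := (dunkl_dim nu).
Local Notation K := (dunkl_riesz_kernel nu g).
Implicit Types (x y z r u s : R).

Let gd0 : g - d < 0. Proof. by rewrite subr_lt0. Qed.

Lemma riesz_kernel_ge0 x : 0 <= K x.
Proof. exact: powR_ge0. Qed.

Lemma riesz_kernel_norm x : K `|x| = K x.
Proof. by rewrite /dunkl_riesz_kernel normr_id. Qed.

Lemma riesz_kernelN x : K (- x) = K x.
Proof. by rewrite /dunkl_riesz_kernel normrN. Qed.

Lemma measurable_riesz_kernel : measurable_fun [set: R] K.
Proof. by apply: (measurableT_comp (measurable_powR _)). Qed.

Lemma powR_antitone (a b e : R) : 0 < a -> a <= b -> e <= 0 -> b `^ e <= a `^ e.
Proof.
move=> a0 ab e0; have b0 := lt_le_trans a0 ab.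
rewrite -(opprK e) !(powRN _ (- e)) lef_pV2 ?posrE ?powR_gt0//.
by apply: ge0_ler_powR; rewrite ?nnegrE ?oppr_ge0// ltW.
Qed.

(** On the layer [s / 2 <= rho < s] it is comparable to the kernel; the indicator reaches down to 0
    so that the Bessel translates of interval indicators apply. *)
Definition riesz_step s (rho : R) : R := s `^ (g - d) * indic_lt s rho.

Lemma riesz_step_ge0 s rho : 0 <= riesz_step s rho.
Proof. by rewrite mulr_ge0 ?powR_ge0 ?indic_lt_ge0. Qed.

Lemma riesz_kernel_le_step s rho : 0 < s -> 0 < rho -> s / 2 <= rho < s ->
  K rho <= 2 `^ (d - g) * riesz_step s rho.
Proof.
move=> s0 rho0 /andP[h1 h2].
rewrite /riesz_step indic_ltE h2 mulr1 /dunkl_riesz_kernel ger0_norm ?(ltW rho0)//.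
apply: (@le_trans _ _ ((s / 2) `^ (g - d))).
  by apply: powR_antitone => //; [rewrite divr_gt0|exact: ltW].
rewrite powRM ?invr_ge0 ?(ltW s0)// mulrC ler_wpM2r ?powR_ge0//.
by rewrite -powR_inv1// -powRrM mulN1r opprB.
Qed.

(** The base scale [s] is free, and Hedberg's argument optimizes it. Some dyadic layer around [s]
    contains [rho], and its term alone suffices. *)
Lemma riesz_kernel_le s rho : 0 < s -> 0 <= rho ->
  ((K rho)%:E <= (2 `^ (d - g))%:E *
    \sum_(j <oo) (riesz_step (s * 2^-1 ^+ j) rho + riesz_step (s * 2 ^+ j) rho)%:E)%E.
Proof.
move=> s0; have S0 n : (0 <= (riesz_step (s * 2^-1 ^+ n) rho +
    riesz_step (s * 2 ^+ n) rho)%:E)%E by rewrite lee_fin addr_ge0// riesz_step_ge0.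
rewrite le_eqVlt => /predU1P[<-|rho0].
  (* At 0 the kernel takes the value 0, so the bound is trivial there. *)
  rewrite /dunkl_riesz_kernel normr0 powR0 ?lt_eqF//.
  by rewrite mule_ge0 ?lee_fin ?powR_ge0// nneseries_ge0// => n _ _; rewrite lee_fin addr_ge0// riesz_step_ge0.
have [j hj] := dyadic_radius s0 rho0.
apply: le_trans (lee_wpmul2l _ (nneseries_term_le j S0)); last by rewrite lee_fin powR_ge0.
rewrite -EFinM lee_fin mulrDr.
case: hj => hj.
  apply: (le_trans (riesz_kernel_le_step _ rho0 hj)).
    by rewrite mulr_gt0// exprn_gt0.
  by rewrite lerDl mulr_ge0 ?powR_ge0 ?riesz_step_ge0.
apply: (le_trans (riesz_kernel_le_step _ rho0 hj)).
  by rewrite mulr_gt0// exprn_gt0.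
by rewrite lerDr mulr_ge0 ?powR_ge0 ?riesz_step_ge0.
Qed.

(** Up to a constant, this bounds the Bessel translate of [riesz_step s]. Since [shell_ratio] is
    [s^d / V], its integral against [F] is [s^g] times the integral of [F] over the shell divided by
    [V]. *)
Definition shell_step x s y : R :=
  s `^ (g - d) * shell_ratio m x s * \1_(shell x s) y.

Lemma shell_step_ge0 x s y : 0 <= shell_step x s y.
Proof. by rewrite !mulr_ge0 ?powR_ge0// indicE. Qed.

Lemma measurable_shell_step x s : measurable_fun [set: R] (shell_step x s).
Proof.
apply: measurable_funM => //; apply: measurable_indic; exact: measurable_shell.
Qed.

Lemma measurable_riesz_step s : measurable_fun [set: R] (riesz_step s).
Proof. by apply: measurable_funM => //; exact: measurable_indic_lt. Qed.

(** The kernel is decomposed before it is translated: each layer is a multiple of an interval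
    indicator, to which [bessel_indic_le] applies. *)
Lemma translation_kernel_le : exists2 C : R, 0 < C & forall x y s, 0 < s ->
  ((`|dunkl_translation nu y K x|)%:E <= C%:E *
    \sum_(j <oo) (shell_step x (s * 2^-1 ^+ j) y + shell_step x (s * 2 ^+ j) y)%:E)%E.
Proof.
have [nuE|nuN] := eqVneq nu (- 2^-1).
  exists (2 `^ (d - g)); first exact: powR_gt0.
  move=> x y s s0; rewrite /dunkl_translation nuE eqxx -nuE.
  rewrite ger0_norm ?riesz_kernel_ge0// -riesz_kernel_norm.
  apply: (le_trans (riesz_kernel_le s0 (normr_ge0 _))).
  apply: lee_wpmul2l; first by rewrite lee_fin powR_ge0.
  apply: lee_nneseries => [n _ _|n _]; first by rewrite lee_fin addr_ge0 ?riesz_step_ge0.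
  have key w : riesz_step w `|y + x| <= shell_step x w y.
    rewrite /riesz_step /shell_step -mulrA ler_wpM2l ?powR_ge0//.
    have -> : m = 0 by rewrite nuE; field.
    rewrite shell_ratio0 mul1r indic_ltE indic_shell.
    case: (ltP `|y + x| w) => // h; rewrite (le_lt_trans _ h)//.
    by rewrite -[X in _ - X]normrN -[X in y + X]opprK ler_dist_dist.
  by rewrite lee_fin lerD.
have hnu1 : - 2^-1 < nu by rewrite lt_def nuN.
have [C C0 hC] := bessel_indic_le hnu1.
have c0 : 0 <= dunkl_const nu.
  by rewrite divr_ge0// ?gamma_fun_ge0// mulr_ge0// ?gamma_fun_ge0// sqrtr_ge0.
(* The first factors come from [dunkl_translation_le], the second 2 from the evenness of the kernel,
   and the power of 2 from the dyadic layers. *)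
pose A := 2 * dunkl_const nu * (2 * 2 `^ (d - g)).
have A0 : 0 <= A by rewrite /A mulr_ge0// mulr_ge0// powR_ge0.
exists (A * C + 1); first by rewrite ltr_pwDr//; apply: mulr_ge0 => //; exact: ltW.
move=> x y s s0.
apply: (@le_trans _ _ ((A * C)%:E * \sum_(j <oo)
  (shell_step x (s * 2^-1 ^+ j) y + shell_step x (s * 2 ^+ j) y)%:E)%E); last first.
  apply: lee_wpmul2r; last by rewrite lee_fin lerDl.
  by apply: nneseries_ge0 => n _ _; rewrite lee_fin addr_ge0 ?shell_step_ge0.
apply: (le_trans (dunkl_translation_le _ _ nuN c0 measurable_riesz_kernel riesz_kernel_ge0)).
rewrite [(A * C)%:E]EFinM /A [(_ * (2 * _))%:E]EFinM -!muleA.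
apply: lee_wpmul2l; first by rewrite lee_fin mulr_ge0.
have mst w : measurable_fun [set: R]
    (fun u => (riesz_step w (dunkl_rho y x u) * bessel_weight nu u)%:E).
  by have /(@measurable_fun_pair2 _ _ _ _ _ _ _ (y, x)) :=
    measurable_bessel_integrand nu (measurable_riesz_step w).
have st0 w u : 0 <= riesz_step w (dunkl_rho y x u) * bessel_weight nu u.
  by rewrite mulr_ge0 ?riesz_step_ge0 ?bessel_weight_ge0.
pose t j u := ((riesz_step (s * 2^-1 ^+ j) (dunkl_rho y x u) * bessel_weight nu u)%:E +
   (riesz_step (s * 2 ^+ j) (dunkl_rho y x u) * bessel_weight nu u)%:E)%E.
have t0 j u : (0 <= t j u)%E by rewrite adde_ge0// lee_fin.
have mt j : measurable_fun [set: R] (t j) by exact: emeasurable_funD.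
have bst w : 0 < w -> (\int[leb]_(u in `[(-1)%R, 1%R])
    (riesz_step w (dunkl_rho y x u) * bessel_weight nu u)%:E <= (C * shell_step x w y)%:E)%E.
  move=> w0.
  have -> : (\int[leb]_(u in `[(-1)%R, 1%R]) (riesz_step w (dunkl_rho y x u) * bessel_weight nu u)%:E
      = (w `^ (g - d))%:E * bessel nu (indic_lt w) y x)%E.
    rewrite /bessel -ge0_integralZl//.
    - by apply: eq_integral => u _; rewrite -EFinM mulrA.
    - apply: measurable_funTS.
      by have /(@measurable_fun_pair2 _ _ _ _ _ _ _ (y, x)) :=
        measurable_bessel_integrand nu (@measurable_indic_lt R w).
    - by move=> u _; rewrite lee_fin mulr_ge0 ?indic_lt_ge0 ?bessel_weight_ge0.
    - by rewrite lee_fin powR_ge0.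
  have -> : C * shell_step x w y = w `^ (g - d) * (C * shell_ratio m x w * \1_(shell x w) y).
    by rewrite /shell_step; ring.
  rewrite [leRHS]EFinM; apply: lee_wpmul2l; first by rewrite lee_fin powR_ge0.
  by rewrite besselC; exact: hC.
apply: (@le_trans _ _ ((2 * 2 `^ (d - g))%:E *
    \int[leb]_(u in `[(-1)%R, 1%R]) (\sum_(j <oo) t j u))%E).
  rewrite -ge0_integralZl//.
  - apply: ge0_le_integral => //.
    + by move=> u _; rewrite lee_fin mulr_ge0 ?bessel_weight_ge0// even_sum_ge0//; exact: riesz_kernel_ge0.
    + apply: measurable_funTS.
      by have /(@measurable_fun_pair2 _ _ _ _ _ _ _ (y, x)) :=
        measurable_bessel_integrand nu (measurable_even_sum measurable_riesz_kernel).
    + apply: measurable_funTS; apply: emeasurable_funM => //.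
      exact: measurable_nneseries.
    + move=> u _.
      have -> : even_sum K (dunkl_rho y x u) * bessel_weight nu u =
        2 * (bessel_weight nu u * K (dunkl_rho y x u)).
        by rewrite /even_sum riesz_kernelN; ring.
      rewrite EFinM [in leRHS]EFinM -muleA; apply: lee_wpmul2l => //.
      rewrite EFinM; apply: (le_trans (lee_wpmul2l _ (riesz_kernel_le s0 (sqrtr_ge0 _)))).
        by rewrite lee_fin bessel_weight_ge0.
      rewrite muleCA; apply: lee_wpmul2l; first by rewrite lee_fin powR_ge0.
      rewrite -nneseriesZl; last by move=> n _; rewrite lee_fin addr_ge0 ?riesz_step_ge0.
      apply: lee_nneseries => [n _ _|n _].
        by rewrite mule_ge0 ?lee_fin ?bessel_weight_ge0// addr_ge0 ?riesz_step_ge0.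
      by rewrite /t -EFinM -EFinD lee_fin le_eqVlt; apply/orP; left; apply/eqP; ring.
  - by apply: measurable_funTS; exact: measurable_nneseries.
  - by move=> u _; exact: nneseries_ge0.
rewrite (@integral_nneseries _ (measurableTypeR R) R leb _ (measurable_itv _) t
  (fun n => measurable_funTS (mt n)) (fun n u _ => t0 n u)).
apply: lee_wpmul2l; first by rewrite lee_fin mulr_ge0// powR_ge0.
rewrite -nneseriesZl; last by move=> n _; rewrite lee_fin addr_ge0 ?shell_step_ge0.
apply: lee_nneseries => [n _ _|n _]; first by apply: integral_ge0.
rewrite /t ge0_integralD//; last 4 first.
- by move=> u _; rewrite lee_fin.
- exact: (measurable_funTS (mst _)).
- by move=> u _; rewrite lee_fin.
- exact: (measurable_funTS (mst _)).
by rewrite -EFinM mulrDr EFinD leeD// bst// mulr_gt0// exprn_gt0.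
Qed.

(** Extended values make the pointwise estimates meaningful at every [x]; finiteness amounts to
    absolute convergence of the fractional integral. *)
Definition riesz_majorant (F : R -> R) x : \bar R :=
  (\int[mu]_y (F y * `|dunkl_translation nu y K x|)%:E)%E.

Lemma measurable_translation_kernel :
  measurable_fun [set: R * R] (fun w => dunkl_translation nu w.2 K w.1).
Proof.
have := measurable_dunkl_translation nu measurable_riesz_kernel.
move=> h; apply: (measurableT_comp h (f := fun w => dunkl_translation nu w.1 K w.2)
  (g := fun w : R * R => (w.2, w.1))).
exact: measurable_fun_pair.
Qed.

Lemma shell_ratio_vol x s e : 0 < s ->
  s `^ e * shell_ratio m x s * shell_vol m x s = s `^ (e + d).
Proof.
move=> s0; rewrite shell_ratioE// -mulrA divfK ?gt_eqF ?shell_vol_gt0//.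
by rewrite -powRD_gt0//; congr (_ `^ _); rewrite /dunkl_dim; ring.
Qed.

Lemma shell_step_int (F : R -> R) x s : measurable_fun [set: R] F -> (forall z, 0 <= F z) ->
  (\int[mu]_y (F y * shell_step x s y)%:E =
   (s `^ (g - d) * shell_ratio m x s)%:E * shell_int nu F x s)%E.
Proof.
move=> mF F0; rewrite shell_intE// -ge0_integralZl//.
- apply: eq_integral => y _; rewrite -EFinM; congr EFin; rewrite /shell_step; ring.
- apply/measurable_EFinP; apply: measurable_funM => //.
  by apply: measurable_indic; exact: measurable_shell.
- by move=> y _; rewrite lee_fin mulr_ge0// indicE.
- by rewrite lee_fin mulr_ge0 ?powR_ge0.
Qed.

(* Hedberg's argument: [s] splits the kernel into the part controlled by the
   averages [A] and the part controlled by their decay [N r ^ (- b)]. *)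
Lemma riesz_majorant_le (b : R) : g < b -> exists2 C : R, 0 < C &
  forall (F : R -> R) (A N x s : R), measurable_fun [set: R] F -> (forall z, 0 <= F z) ->
  0 <= A -> 0 <= N -> 0 < s ->
  (forall r, 0 < r -> (shell_int nu F x r <= (A * shell_vol m x r)%:E)%E) ->
  (forall r, 0 < r -> (shell_int nu F x r <= (N * r `^ (- b) * shell_vol m x r)%:E)%E) ->
  (riesz_majorant F x <= (C * (s `^ g * A + s `^ (g - b) * N))%:E)%E.
Proof.
move=> gb; have [C C0 hC] := translation_kernel_le.
(* The ratios of the two geometric series: small scales contribute [(s / 2^j)^g], summable as
   [0 < g]; large ones contribute [(s 2^j)^(g - b)], summable as [g < b]. *)
pose q1 : R := 2^-1 `^ g; pose q2 : R := 2 `^ (g - b).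
have q10 : 0 < q1 by rewrite powR_gt0.
have q20 : 0 < q2 by rewrite powR_gt0.
have q11 : q1 < 1.
  rewrite /q1 -powR_inv1// -powRrM mulN1r powRN invf_lt1 ?powR_gt0//.
  by rewrite powR_gt1// ltr1n.
have q21 : q2 < 1.
  rewrite /q2 -(opprB b) powRN invf_lt1 ?powR_gt0//.
  by rewrite powR_gt1 ?subr_gt0// ltr1n.
have p1 : 0 < (1 - q1)^-1 by rewrite invr_gt0 subr_gt0.
have p2 : 0 < (1 - q2)^-1 by rewrite invr_gt0 subr_gt0.
pose B := (1 - q1)^-1 + (1 - q2)^-1.
exists (C * B); first by rewrite mulr_gt0// addr_gt0.
move=> F A N x s mF F0 A0 N0 s0 hA hN.
have mtk : measurable_fun [set: R] (fun y => dunkl_translation nu y K x).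
  by have /(@measurable_fun_pair2 _ _ _ _ _ _ _ x) := measurable_translation_kernel.
pose t j y := ((F y * shell_step x (s * 2^-1 ^+ j) y)%:E +
   (F y * shell_step x (s * 2 ^+ j) y)%:E)%E.
have mst w : measurable_fun [set: R] (fun y => (F y * shell_step x w y)%:E).
  by apply/measurable_EFinP; apply: measurable_funM => //; exact: measurable_shell_step.
have st0 w y : (0 <= (F y * shell_step x w y)%:E)%E.
  by rewrite lee_fin mulr_ge0// shell_step_ge0.
have t0 j y : (0 <= t j y)%E by rewrite adde_ge0.
have mt j : measurable_fun [set: R] (t j) by exact: emeasurable_funD.
apply: (@le_trans _ _ (C%:E * \int[mu]_y (\sum_(j <oo) t j y))%E).
  rewrite /riesz_majorant -ge0_integralZl//; last 3 first.
  - exact: measurable_nneseries.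
  - by move=> y _; exact: nneseries_ge0.
  - by rewrite lee_fin ltW.
  apply: ge0_le_integral => //.
  - by move=> y _; rewrite lee_fin mulr_ge0.
  - apply/measurable_EFinP; apply: measurable_funM => //.
    exact: measurableT_comp.
  - by apply: emeasurable_funM => //; exact: measurable_nneseries.
  - move=> y _; rewrite EFinM.
    apply: (le_trans (lee_wpmul2l _ (hC x y s s0))); first by rewrite lee_fin.
    rewrite muleCA; apply: lee_wpmul2l; first by rewrite lee_fin ltW.
    rewrite -nneseriesZl; last by move=> n _; rewrite lee_fin addr_ge0 ?shell_step_ge0.
    apply: lee_nneseries => [n _ _|n _].
      by rewrite mule_ge0 ?lee_fin// addr_ge0 ?shell_step_ge0.
    by rewrite /t -EFinM -EFinD lee_fin mulrDr.
rewrite -mulrA EFinM; apply: lee_wpmul2l; first by rewrite lee_fin ltW.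
rewrite integral_nneseries//.
pose G1 := s `^ g * A; pose G2 := s `^ (g - b) * N.
have G10 : 0 <= G1 by rewrite mulr_ge0 ?powR_ge0.
have G20 : 0 <= G2 by rewrite mulr_ge0 ?powR_ge0.
apply: (@le_trans _ _ (\sum_(j <oo) ((G1 * q1 ^+ j)%:E + (G2 * q2 ^+ j)%:E))%E).
  apply: lee_nneseries => [n _ _|n _]; first by apply: integral_ge0.
  rewrite /t (@ge0_integralD _ (measurableTypeR R) R mu setT measurableT _ _
    (fun y _ => st0 _ y) (mst _) (fun y _ => st0 _ y) (mst _)).
  apply: leeD; rewrite shell_step_int//.
  - set w := s * 2^-1 ^+ n.
    have w0 : 0 < w by rewrite mulr_gt0// exprn_gt0.
    apply: (le_trans (lee_wpmul2l _ (hA w w0))); first by rewrite lee_fin mulr_ge0 ?powR_ge0.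
    rewrite -EFinM lee_fin [A * _]mulrC mulrA shell_ratio_vol// subrK.
    by rewrite /w powR_rad// /G1 /q1 le_eqVlt; apply/orP; left; apply/eqP; ring.
  - set w := s * 2 ^+ n.
    have w0 : 0 < w by rewrite mulr_gt0// exprn_gt0.
    apply: (le_trans (lee_wpmul2l _ (hN w w0))); first by rewrite lee_fin mulr_ge0 ?powR_ge0.
    rewrite -EFinM lee_fin [_ * shell_vol _ _ _]mulrC mulrA shell_ratio_vol// subrK.
    rewrite [N * _]mulrC mulrA -powRD_gt0// /w powR_rad// /G2 /q2.
    by rewrite le_eqVlt; apply/orP; left; apply/eqP; ring.
rewrite nneseriesD; last 2 first.
- by move=> i _ _; rewrite lee_fin mulr_ge0// exprn_ge0// ltW.
- by move=> i _ _; rewrite lee_fin mulr_ge0// exprn_ge0// ltW.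
apply: (@le_trans _ _ ((G1 / (1 - q1))%:E + (G2 / (1 - q2))%:E)%E).
  by apply: leeD; apply: geometric_nneseries_le.
rewrite -EFinD lee_fin -/G1 -/G2 /B.
have h1 : 0 <= (1 - q1)^-1 * G2 by rewrite mulr_ge0// ltW.
have h2 : 0 <= (1 - q2)^-1 * G1 by rewrite mulr_ge0// ltW.
lra.
Qed.

Lemma riesz_majorant_hedberg (b : R) : g < b -> exists2 C : R, 0 < C &
  forall (F : R -> R) (A N x : R), measurable_fun [set: R] F -> (forall z, 0 <= F z) ->
  0 < A -> 0 < N ->
  (forall r, 0 < r -> (shell_int nu F x r <= (A * shell_vol m x r)%:E)%E) ->
  (forall r, 0 < r -> (shell_int nu F x r <= (N * r `^ (- b) * shell_vol m x r)%:E)%E) ->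
  (riesz_majorant F x <= (C * (A `^ (1 - g / b) * N `^ (g / b)))%:E)%E.
Proof.
move=> gb; have b0 : 0 < b by exact: lt_trans gb.
have [C C0 hC] := riesz_majorant_le gb.
exists (C * 2); first by rewrite mulr_gt0.
move=> F A N x mF F0 A0 N0 hA hN.
(* The scale at which the two terms [s^g A] and [s^(g - b) N] are equal. *)
pose s := (N / A) `^ b^-1.
have s0 : 0 < s by rewrite powR_gt0// divr_gt0.
apply: (le_trans (hC F A N x s mF F0 (ltW A0) (ltW N0) s0 hA hN)).
have NA0 : 0 <= N / A by rewrite divr_ge0// ltW.
have AE e : A `^ (- e) = A^-1 `^ e by rewrite -powR_inv1 ?(ltW A0)// -powRrM mulN1r.
have E1 : s `^ g * A = A `^ (1 - g / b) * N `^ (g / b).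
  rewrite /s -powRrM powRM ?invr_ge0 ?(ltW N0) ?(ltW A0)//.
  rewrite powRD_gt0// powRr1 ?(ltW A0)// AE mulrC (mulrC b^-1); ring.
have E2 : s `^ (g - b) * N = A `^ (1 - g / b) * N `^ (g / b).
  rewrite /s -powRrM powRM ?invr_ge0 ?(ltW N0) ?(ltW A0)//.
  rewrite -AE; have -> : - (b^-1 * (g - b)) = 1 - g / b by field; rewrite gt_eqF.
  have -> : b^-1 * (g - b) = g / b - 1 by field; rewrite gt_eqF.
  by rewrite powRD_gt0// powR_inv1 ?(ltW N0)// mulrAC divfK ?gt_eqF// mulrC.
rewrite E1 E2 lee_fin; lra.
Qed.

End kernel_bound.

(** * Maximal inequalities *)

Section maximal.
Context {R : realType}.
Implicit Types (nu m x r : R).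

(* [shell x r] is the preimage of the interval of center [|x|] and radius [r] under
   the norm, so Vitali's lemma on the line applies. *)
Lemma shell_vitali (V : set (R * {posnum R})) (r : R) :
    (forall i, V i -> i.2%:num <= r) ->
  exists e : nat -> option (R * {posnum R}),
    [/\ forall n i, e n = Some i -> V i,
        trivIset setT (fun n => if e n is Some i then shell i.1 i.2%:num
                                else set0) &
        forall i, V i -> shell i.1 i.2%:num `<=`
          \bigcup_n (if e n is Some j then shell j.1 (6 * j.2%:num)
                     else set0)].
Proof.
move=> Vr.
pose B (i : R * {posnum R}) : set R := ball `|i.1| i.2%:num.
have bB i : is_ball (B i) by exact: is_ball_ball.
have B0 i : 0 < (radius (B i))%:num by rewrite radius_ball_num.
have Br i : V i -> (radius (B i))%:num <= r.
  by move=> Vi; rewrite radius_ball_num//; exact: Vr.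
have [D [cD DV tD covD]] := vitali_lemma_infinite_cover bB B0 Br.
have /countable_injP[f finj] := cD.
(* The selected family is countable and possibly finite: indices outside the image of the injection
   [f] are sent to [None]. *)
pose e n := if pselect (exists i, D i /\ f i = n) is left H
  then Some (projT1 (cid H)) else None.
have eS n i : e n = Some i -> D i /\ f i = n.
  by rewrite /e; case: pselect => // H [<-]; case: cid.
have eD i : D i -> e (f i) = Some i.
  move=> Di; rewrite /e; case: pselect => [H|/(_ _)[]]; last by exists i.
  congr Some; case: cid => j /= [Dj fj].
  by apply: finj; rewrite ?inE.
have shB i z : shell i.1 i.2%:num z -> closure (B i) `|z|.
  move=> h; apply: subset_closure; rewrite /B /ball/= distrC.
  exact: h.
exists e; split.
- by move=> n i /eS[/DV].
- apply/trivIsetP => i j _ _ ij.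
  case ei: (e i) => [a|]; last by rewrite set0I.
  case ej: (e j) => [b|]; last by rewrite setI0.
  have [Da fa] := eS _ _ ei; have [Db fb] := eS _ _ ej.
  apply/seteqP; split=> [z [za zb]|//].
  have ab : a = b.
    apply: (tD a b Da Db); exists `|z|; split; exact: shB.
  by case/eqP: ij; rewrite -fa -fb ab.
- move=> i Vi z iz.
  have [j Dj /= zj] : cover D (closure \o scale_ball 5%:R \o B) `|z|.
    by apply: covD; exists i => //=; exact: shB.
  exists (f j) => //; rewrite eD// /shell/=.
  move: zj; rewrite /B scale_ballE//.
  have j0 : 0 < j.2%:num by [].
  move=> /(is_ball_closureP (is_ball_ball _ _))/=.
  rewrite cpoint_ball ?mulr_gt0// radius_ball_num ?mulr_ge0// => h.
  (* Vitali's lemma covers by closed balls dilated 5 times; the factor 6 absorbs the closure and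
     leaves open shells. *)
  move: h; rewrite distrC => /le_lt_trans; apply.
  by rewrite ltr_pM2r// ltr_nat.
Qed.

(** The set [U] is the union of the dilated shells selected by Vitali's lemma, hence measurable. Its
    measure is bounded by doubling and by adding the integrals of [h] over the disjoint undilated
    shells. *)
Lemma maximal_weak_type nu : - 2^-1 <= nu ->
  exists2 C : R, 0 < C & forall (h : R -> R) (l : R),
    measurable_fun setT h -> (forall z, 0 <= h z) -> 0 < l ->
    (\int[dunkl_measure nu]_z (h z)%:E < +oo)%E ->
    exists U : set R, [/\ measurable U,
      forall x r, 0 < r ->
        ((l * shell_vol (2 * nu + 1) x r)%:E < shell_int nu h x r)%E -> U x &
      (dunkl_measure nu U <=
        (C / l)%:E * \int[dunkl_measure nu]_z (h z)%:E)%E].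
Proof.
move=> hnu; set m := 2 * nu + 1.
have m0 : 0 <= m by rewrite /m; move: hnu => ?; lra.
have C0 : 0 <= shell_cst nu * 6 `^ (m + 1) by rewrite mulr_ge0 ?shell_cst_ge0 ?powR_ge0.
exists (shell_cst nu * 6 `^ (m + 1) + 1); first by rewrite ltr_pwDr.
move=> h l mh h0 l0 hfin; set J := (\int[_]_z _)%E.
have J0 : (0 <= J)%E by apply: integral_ge0 => z _; rewrite lee_fin.
have Jf : J \is a fin_num by rewrite ge0_fin_numE.
pose V := [set i : R * {posnum R} |
  ((l * shell_vol m i.1 i.2%:num)%:E < shell_int nu h i.1 i.2%:num)%E].
have QJ x r : (shell_int nu h x r <= J)%E.
  apply: ge0_subset_integral => //.
  - exact: measurable_shell.
  - exact/measurable_EFinP.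
  - by move=> z _; rewrite lee_fin.
(* Vitali's lemma needs bounded radii. A shell in [V] has volume less than [J / l], and its volume
   is at least its radius once the radius is at least 1. *)
have Vr i : V i -> i.2%:num <= 1 + fine J / l.
  move=> Vi; have := lt_le_trans Vi (QJ _ _).
  have J0' : 0 <= fine J by exact: fine_ge0.
  rewrite -[J in (_ < J)%E](fineK Jf) lte_fin mulrC -ltr_pdivlMr// => Vl.
  rewrite leNgt; apply/negP => ir.
  suff : i.2%:num <= shell_vol m i.1 i.2%:num.
    have : 0 <= 1 :> R by []. move: Vl ir; lra.
  have i1 : 1 <= i.2%:num.
    apply: (le_trans _ (ltW ir)).
    by rewrite lerDl divr_ge0 ?(ltW l0).
  rewrite /shell_vol ler_peMr//.
  have : 1 `^ m <= Num.max `|i.1| i.2%:num `^ m.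
    by apply: ge0_ler_powR; rewrite ?nnegrE ?le_max ?i1 ?normr_ge0 ?orbT.
  by rewrite powR1.
have [e [eV eT ecov]] := shell_vitali Vr.
pose A n := if e n is Some i then shell i.1 i.2%:num else set0 : set R.
pose A6 n := if e n is Some i then shell i.1 (6 * i.2%:num) else set0 : set R.
have mA n : measurable (A n).
  by rewrite /A; case: (e n) => // i; exact: measurable_shell.
have mA6 n : measurable (A6 n).
  by rewrite /A6; case: (e n) => // i; exact: measurable_shell.
have mU : measurable (\bigcup_n A6 n) by exact: bigcup_measurable.
exists (\bigcup_n A6 n); split => //.
  move=> x r r0 hx; apply: (ecov (x, PosNum r0) hx) => /=.
  by rewrite /shell/= subrr normr0.
have mhE : measurable_fun setT (fun z => (h z)%:E) by exact/measurable_EFinP.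
have -> : (((shell_cst nu * 6 `^ (m + 1) + 1) / l)%:E * J)%E =
  ((shell_cst nu * 6 `^ (m + 1) + 1)%:E * (l^-1%:E * J))%E by rewrite EFinM muleA.
apply: (@le_trans _ _ ((shell_cst nu * 6 `^ (m + 1))%:E * (l^-1%:E * J))%E); last first.
  apply: lee_wpmul2r; last by rewrite lee_fin lerDl.
  by rewrite mule_ge0// lee_fin invr_ge0 (ltW l0).
apply: (@le_trans _ _ ((shell_cst nu * 6 `^ (m + 1))%:E * (l^-1%:E *
   \int[dunkl_measure nu]_(z in \bigcup_n A n) (h z)%:E))%E); last first.
  apply: lee_wpmul2l; first by rewrite lee_fin.
  apply: lee_wpmul2l; first by rewrite lee_fin invr_ge0 (ltW l0).
  apply: ge0_subset_integral => //.
  - exact: (bigcup_measurable (fun n _ => mA n)).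
  - by move=> z _; rewrite lee_fin.
rewrite ge0_integral_bigcup//; last 2 first.
- exact: measurable_funTS.
- by move=> z _; rewrite lee_fin.
have subA : (dunkl_measure nu (\bigcup_n A6 n) <=
    \sum_(0 <= n <oo) dunkl_measure nu (A6 n))%E.
  exact: measure_sigma_subadditive.
apply: (le_trans subA).
have IA0 n : (0 <= \int[dunkl_measure nu]_(z in A n) (h z)%:E)%E.
  by apply: integral_ge0 => z _; rewrite lee_fin.
rewrite -!nneseriesZl//; last first.
  by move=> n _; rewrite mule_ge0// lee_fin invr_ge0 (ltW l0).
apply: lee_nneseries => [n _ _|n _]; first exact: (measure_ge0 (dunkl_measure nu)).
rewrite /A6 /A; case en: (e n) => [i|]; last first.
  by rewrite measure0 integral_set0 !mule0.
have i0 : 0 < i.2%:num by [].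
have /= Vi := eV _ _ en.
apply: (le_trans (dunkl_shell_le hnu _ _)); first by rewrite mulr_gt0.
apply: (@le_trans _ _ ((shell_cst nu * 6 `^ (m + 1))%:E * (shell_vol m i.1 i.2%:num)%:E)%E).
  rewrite -EFinM lee_fin -(mulrA (shell_cst nu)); apply: ler_wpM2l; first exact: shell_cst_ge0.
  by apply: shell_vol_scale; rewrite ?ler1n.
apply: lee_wpmul2l; first by rewrite lee_fin.
rewrite lee_pdivlMl//  -EFinM.
exact: ltW Vi.
Qed.

End maximal.

Lemma measurable_gt_indic d (T : measurableType d) (R : realType)
    (F : T -> R) (c : R) : measurable_fun setT F ->
  measurable_fun setT (fun z => (c < F z)%R%:R : R).
Proof.
move=> mF; have mD : measurable (F @^-1` `]c, +oo[%classic).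
  by rewrite -[X in measurable X]setTI; exact: mF.
rewrite (_ : (fun _ => _) = \1_(F @^-1` `]c, +oo[%classic)).
  exact: measurable_indic.
apply/funext => z; rewrite indicE; congr (nat_of_bool _)%:R.
by apply/idP/idP; rewrite inE/= in_itv/= andbT.
Qed.

Section dyadic_sum.
Context {R : realType}.
Implicit Types (nu x r a l : R).

(** A geometric sum is controlled by its largest term, here the last threshold below [T]. This is
    the discrete layer-cake formula that turns a sum over levels into a power of [F]. *)
Lemma dyadic_threshold_sum_le a l : 0 < a -> 0 < l -> forall T, 0 <= T ->
  (\sum_(k <oo) ((2 ^+ k * l) `^ a * (2 ^+ k * l < T)%R%:R)%:E <=
   (2 `^ a / (2 `^ a - 1) * T `^ a)%:E)%E.
Proof.
move=> a0 l0 T T0.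
have q1 : 1 < 2 `^ a :> R by apply: powR_gt1; rewrite ?ltr1n.
have q1' : 0 < 2 `^ a - 1 :> R by rewrite subr_gt0.
have l2 k : 0 < 2 ^+ k * l by rewrite mulr_gt0// exprn_gt0.
apply: nneseries_le_bound => n; first by rewrite lee_fin mulr_ge0 ?powR_ge0.
(* The minimum carries the induction: it doubles exactly like the threshold while [2^n l < T], and
   afterwards never exceeds [2 T]. *)
suff H : (2 `^ a - 1) * \sum_(0 <= k < n) ((2 ^+ k * l) `^ a * (2 ^+ k * l < T)%R%:R) <=
    Num.min (2 ^+ n * l) (2 * T) `^ a.
  rewrite sumEFin lee_fin mulrAC ler_pdivlMr// mulrC (le_trans H)// -powRM//.
  apply: ge0_ler_powR; rewrite ?nnegrE ?ge_min ?lexx ?orbT ?le_min ?mulr_ge0 ?(ltW a0)//.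
  by rewrite ltW.
elim: n => [|n IH]; first by rewrite big_geq// mulr0 powR_ge0.
rewrite big_nat_recr//= mulrDr; have [lT|lT] := ltP (2 ^+ n * l) T; last first.
  rewrite !mulr0 addr0 (le_trans IH)//; apply: ge0_ler_powR.
  - exact: ltW.
  - by rewrite nnegrE le_min (ltW (l2 _)) mulr_ge0.
  - by rewrite nnegrE le_min (ltW (l2 _)) mulr_ge0.
  - have := l2 n; rewrite exprS -mulrA; move: (2 ^+ n * l) lT => w lT w0.
    rewrite le_min !ge_min; apply/andP; split; last by rewrite lexx orbT.
    by apply/orP; left; lra.
rewrite mulr1 exprS -mulrA; have := l2 n; move: IH.
move: (\sum_(_ <= _ < _) _) (2 ^+ n * l) lT => S w lT IH w0.
rewrite min_l; last by rewrite ler_pM2l// ltW.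
move: IH; rewrite min_l; last by lra.
rewrite (powRM _ _ (ltW w0))//; move: (2 `^ a) (w `^ a) => A W.
lra.
Qed.

End dyadic_sum.

(** * Level sets under a Morrey bound *)

Section morrey_levels.
Context {R : realType}.
Variables (nu p b : R).
Hypotheses (hnu : - 2^-1 <= nu) (p1 : 1 < p) (b0 : 0 < b).
Local Notation m := (2 * nu + 1).
Local Notation mu := (dunkl_measure nu).

(** Where [f > l], the factor [(f / l)^(p - 1)] is at least 1. This replaces Hölder's inequality in
    passing from averages of [F^p] to averages of [F]. *)
Lemma truncation_powR_le (f l : R) : 0 <= f -> 0 < l -> f <= l `^ (1 - p) * f `^ p + l.
Proof.
move=> f0 l0; have [fl|lf] := leP f l.
  by rewrite (le_trans fl)// lerDr mulr_ge0 ?powR_ge0.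
have fp := lt_trans l0 lf.
apply: (@le_trans _ _ (l `^ (1 - p) * f `^ p)); last by rewrite lerDl ltW.
have -> : f `^ p = f * f `^ (p - 1).
  rewrite -{2}(powRr1 (ltW fp)) -powRD_gt0//.
  by congr (_ `^ _); lra.
rewrite mulrCA ler_peMr//.
have -> : 1 - p = - (p - 1) by lra.
rewrite powRN mulrC ler_pdivlMr ?powR_gt0// mul1r.
by apply: ge0_ler_powR; rewrite ?nnegrE ?(ltW lf) ?(ltW l0)//; move: p1; lra.
Qed.

(** The shell form of the Morrey condition; in the application [b] is [d / q] and [N] a multiple of
    the norm. *)
Definition morrey_bound (F : R -> R) (N : R) : Prop := forall x r, 0 < r ->
  (shell_int nu (fun z => F z `^ p)%R x r <=
   (N `^ p * r `^ (- (p * b)) * shell_vol m x r)%:E)%E.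

(** Truncation at the height [l = N r^(- b)]: since [N^p r^(- p b) = l^p], both terms of
    [truncation_powR_le] integrate to multiples of [l V]. *)
Lemma morrey_bound_average (F : R -> R) (N x r : R) : measurable_fun setT F ->
  (forall z, 0 <= F z) -> 0 < N -> morrey_bound F N -> 0 < r ->
  (shell_int nu F x r <= ((shell_cst nu + 1) * (N * r `^ (- b)) * shell_vol m x r)%:E)%E.
Proof.
move=> mF F0 N0 HF r0; set l := N * r `^ (- b).
have l0 : 0 < l by rewrite mulr_gt0 ?powR_gt0.
have mFp : measurable_fun setT (fun z => F z `^ p).
  by apply: (measurableT_comp (measurable_powR _)).
apply: (@le_trans _ _ (\int[mu]_(z in shell x r)
    ((l `^ (1 - p))%:E * (F z `^ p)%:E + l%:E))%E).
  apply: ge0_le_integral => //.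
  - exact: measurable_shell.
  - by move=> z _; rewrite lee_fin.
  - by apply/measurable_funTS/measurable_EFinP.
  - apply/measurable_funTS; apply: emeasurable_funD => //.
    by apply: measurable_funeM; exact/measurable_EFinP.
  - by move=> z _; rewrite -EFinM -EFinD lee_fin truncation_powR_le.
rewrite ge0_integralD//; last 4 first.
- exact: measurable_shell.
- by move=> z _; rewrite -EFinM lee_fin mulr_ge0 ?powR_ge0.
- apply/measurable_funTS; apply: measurable_funeM; exact/measurable_EFinP.
- by move=> z _; rewrite lee_fin ltW.
rewrite (_ : (fun _ => l%:E) = cst l%:E)// integral_cst; last exact: measurable_shell.
rewrite ge0_integralZl_EFin ?powR_ge0//; last 3 first.
- exact: measurable_shell.
- by move=> z _; rewrite lee_fin powR_ge0.
- by apply/measurable_funTS/measurable_EFinP.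
apply: (@le_trans _ _ ((l `^ (1 - p))%:E * (N `^ p * r `^ (- (p * b)) * shell_vol m x r)%:E
    + l%:E * (shell_cst nu * shell_vol m x r)%:E)%E).
  apply: leeD.
    by apply: lee_wpmul2l; [rewrite lee_fin powR_ge0|exact: HF].
  apply: lee_wpmul2l; first by rewrite lee_fin ltW.
  exact: dunkl_shell_le.
rewrite -!EFinM -EFinD lee_fin.
have -> : N `^ p * r `^ (- (p * b)) = l `^ p.
  by rewrite /l powRM ?powR_ge0 ?(ltW N0)// -powRrM mulNr (mulrC b).
have -> : l `^ (1 - p) * (l `^ p * shell_vol m x r) = l * shell_vol m x r.
  rewrite mulrA -powRD_gt0//.
  by rewrite subrK powRr1 ?ltW.
by rewrite le_eqVlt; apply/orP; left; apply/eqP; ring.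
Qed.

(** [U k] plays the part of the set where the maximal function exceeds [2^k L]. The weak type bound
    at each level, multiplied by the [p]-th power of the level and summed, yields the integral of
    [F^p] over the double shell. *)
Lemma morrey_level_sets : exists C : R * R, [/\ 0 < C.1, 0 < C.2 &
  forall (F : R -> R) N x0 r0, measurable_fun setT F -> (forall z, 0 <= F z) ->
    0 < N -> 0 < r0 -> morrey_bound F N ->
    exists U : nat -> set R, [/\ forall k, measurable (U k),
      forall k x r, shell x0 r0 x -> ~ U k x -> 0 < r ->
        (shell_int nu F x r <=
          (2 ^+ k * (C.1 * (N * r0 `^ (- b))) * shell_vol m x r)%:E)%E &
      (\sum_(k <oo) (((2 ^+ k * (C.1 * (N * r0 `^ (- b)))) `^ p)%:E * mu (U k)) <=
        (C.2 * (N `^ p * r0 `^ (- (p * b)) * shell_vol m x0 r0))%:E)%E]].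
Proof.
have m0 : 0 <= m by move: hnu => ?; lra.
have [Cw Cw0 Hw] := maximal_weak_type hnu.
set C0 := shell_cst nu + 1.
have C00 : 0 < C0 by rewrite ltr_pwDr ?shell_cst_ge0.
set a := p - 1; have a0 : 0 < a by rewrite /a; move: p1 => ?; lra.
have q1 : 1 < 2 `^ a :> R by apply: powR_gt1; rewrite ?ltr1n.
have q1' : 0 < 2 `^ a - 1 :> R by rewrite subr_gt0.
set Ca := 2 `^ a / (2 `^ a - 1).
have Ca0 : 0 < Ca by rewrite divr_gt0 ?powR_gt0.
exists (C0, 2 * Cw * (Ca * (2 * C0) `^ a) * 2 `^ (m + 1)); split => //=.
  by repeat (apply: mulr_gt0 || apply: powR_gt0) => //.
move=> F N x0 r0 mF F0 N0 r00 HF.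
(* The bound of [morrey_bound_average] at the radius [r0]; levels start here because averages over
   larger radii never exceed it. *)
set L := C0 * (N * r0 `^ (- b)).
have L0 : 0 < L by rewrite !mulr_gt0 ?powR_gt0.
have Lk k : 0 < 2 ^+ k * L by rewrite mulr_gt0 ?exprn_gt0.
have mFp : measurable_fun setT (fun z => F z `^ p).
  by apply: (measurableT_comp (measurable_powR _)).
pose S := shell x0 (2 * r0).
have mS : measurable S by exact: measurable_shell.
(* The part of [F] dropped on [S] is at most [2^k L / (2 C0)], so its integral over a shell is at
   most [2^k L / 2] times the volume. The weak type bound for [h k] is therefore used at the level
   [2^k L / 2]. *)
pose h k z := F z * \1_S z * (2 ^+ k * L < 2 * C0 * F z)%R%:R.
have h0 k z : 0 <= h k z by rewrite !mulr_ge0.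
have mI k : measurable_fun setT (fun z => (2 ^+ k * L < 2 * C0 * F z)%R%:R : R).
  by apply: measurable_gt_indic; exact: measurable_funM.
have mh k : measurable_fun setT (h k).
  apply: measurable_funM => //; apply: measurable_funM => //.
have mhE k : measurable_fun setT (fun z => (h k z)%:E).
  by apply/measurable_EFinP; exact: mh.
have hF k : (\int[mu]_z (h k z)%:E <= shell_int nu F x0 (2 * r0))%E.
  rewrite shell_intE//; apply: ge0_le_integral => //.
  - by move=> z _; rewrite lee_fin.
  - exact: mhE.
  - by apply/measurable_EFinP; apply: measurable_funM.
  - by move=> z _; rewrite lee_fin ler_piMr ?mulr_ge0// lern1 leq_b1.
have hfin k : (\int[mu]_z (h k z)%:E < +oo)%E.
  apply: (le_lt_trans (hF k)); apply: (le_lt_trans (morrey_bound_average _ mF F0 N0 HF _)).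
    by rewrite mulr_gt0.
  exact: ltry.
have mG k : measurable_fun setT
   (fun z => (F z * ((2 ^+ k * L) `^ a * (2 ^+ k * L < 2 * C0 * F z)%R%:R))%:E).
  by apply/measurable_EFinP; apply: measurable_funM => //; apply: measurable_funM.
have G0 k z : 0 <= F z * ((2 ^+ k * L) `^ a * (2 ^+ k * L < 2 * C0 * F z)%R%:R).
  by rewrite !mulr_ge0 ?powR_ge0.
have lC k : 0 <= 2 ^+ k * L / (2 * C0) by rewrite ltW// divr_gt0// mulr_gt0.
have l2 k : 0 < 2 ^+ k * L / 2 by rewrite divr_gt0.
pose U k := projT1 (cid (Hw (h k) _ (mh k) (h0 k) (l2 k) (hfin k))).
have UP k := projT2 (cid (Hw (h k) _ (mh k) (h0 k) (l2 k) (hfin k))).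
exists U; split.
- by move=> k; have [] := UP k.
- move=> k x r xS nU r_gt0.
  have V0 := shell_vol_gt0 m x r_gt0.
  (* For [r >= r0] the Morrey average suffices; a smaller shell centred in [shell x0 r0] stays
     inside [S], where [h k] sees it. *)
  have [r0r|rr0] := leP r0 r.
    apply: (le_trans (morrey_bound_average _ mF F0 N0 HF _)) => //.
    rewrite lee_fin ler_pM2r// -/C0.
    apply: (@le_trans _ _ L).
      rewrite ler_pM2l// ler_pM2l//.
      by apply: powR_antitone => //; rewrite oppr_le0 ltW.
    by rewrite ler_peMl ?(ltW L0)// exprn_ege1// ler1n.
  have xS' : shell x r `<=` S.
    apply: subset_shell; move: xS; rewrite /shell/= => xS.
    have := ltW xS; lra.
  have Qh : (shell_int nu (h k) x r <= (2 ^+ k * L / 2 * shell_vol m x r)%:E)%E.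
    rewrite leNgt; apply/negP => H; apply: nU.
    by have [_ + _] := UP k; apply; last exact: H.
  apply: (@le_trans _ _ (\int[mu]_(z in shell x r)
      ((h k z)%:E + (2 ^+ k * L / (2 * C0))%:E))%E).
    apply: ge0_le_integral => //.
    - exact: measurable_shell.
    - by move=> z _; rewrite lee_fin.
    - by apply/measurable_funTS/measurable_EFinP.
    - apply/measurable_funTS; apply: emeasurable_funD => //.
      exact: mhE.
    - move=> z xz; rewrite -EFinD lee_fin /h.
      rewrite indicE mem_set ?mulr1; last exact: xS'.
      case: ltP => [_|H]; first by rewrite mulr1 lerDl.
      by rewrite mulr0 add0r ler_pdivlMr ?mulr_gt0// mulrC.
  rewrite ge0_integralD//; last 4 first.
  - exact: measurable_shell.
  - by move=> z _; rewrite lee_fin.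
  - exact: (measurable_funTS (mhE k)).
  - by move=> z _; rewrite lee_fin.
  rewrite (_ : (fun _ => (2 ^+ k * L / (2 * C0))%:E) = cst (2 ^+ k * L / (2 * C0))%:E)//.
  rewrite integral_cst; last exact: measurable_shell.
  apply: (@le_trans _ _ ((2 ^+ k * L / 2 * shell_vol m x r)%:E +
     (2 ^+ k * L / (2 * C0))%:E * (shell_cst nu * shell_vol m x r)%:E)%E).
    apply: leeD => //; apply: lee_wpmul2l.
      by rewrite lee_fin.
    exact: dunkl_shell_le.
  rewrite -EFinM -EFinD lee_fin.
  have -> : 2 ^+ k * L / (2 * C0) * (shell_cst nu * shell_vol m x r) =
    (2 ^+ k * L / 2 * shell_vol m x r) * (shell_cst nu / C0).
    by field; rewrite gt_eqF.
  have : shell_cst nu / C0 <= 1 by rewrite ler_pdivrMr// mul1r /C0 lerDl.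
  have : 0 <= 2 ^+ k * L / 2 * shell_vol m x r by rewrite mulr_ge0 ?(ltW V0) ?(ltW (l2 _)).
  have -> : 2 ^+ k * L * shell_vol m x r = (2 ^+ k * L / 2 * shell_vol m x r) * 2 by field.
  move: (_ / 2 * _) (_ / C0) => X Y X0 Y1.
  by rewrite -[X in X + _]mulr1 -mulrDr ler_wpM2l//; lra.
(* The weak type bound costs one power of the level, leaving the exponent [a = p - 1]. Summing over
   [k] under the integral gives [F F^(p - 1) = F^p]. *)
- apply: (@le_trans _ _ (\sum_(k <oo) (2 * Cw)%:E * \int[mu]_(z in S)
     (F z * ((2 ^+ k * L) `^ a * (2 ^+ k * L < 2 * C0 * F z)%R%:R))%:E)%E).
    apply: lee_nneseries => [k _ _|k _].
      by apply: mule_ge0; [rewrite lee_fin powR_ge0|exact: (measure_ge0 mu)].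
    have [_ _ muU] := UP k.
    apply: (@le_trans _ _ (((2 ^+ k * L) `^ p)%:E *
       ((Cw / (2 ^+ k * L / 2))%:E * \int[mu]_z (h k z)%:E))%E).
      by apply: lee_wpmul2l; [rewrite lee_fin powR_ge0|exact: muU].
    rewrite muleA -EFinM.
    have -> : (2 ^+ k * L) `^ p * (Cw / (2 ^+ k * L / 2)) = (2 * Cw) * (2 ^+ k * L) `^ a.
      have -> : (2 ^+ k * L) `^ p = (2 ^+ k * L) * (2 ^+ k * L) `^ a.
        rewrite -{2}(powRr1 (ltW (Lk k))) -powRD_gt0//.
        by congr (_ `^ _); rewrite /a; lra.
      by field; rewrite gt_eqF//= gt_eqF ?exprn_gt0.
    rewrite EFinM -muleA; apply: lee_wpmul2l; first by rewrite lee_fin mulr_ge0 ?(ltW Cw0).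
    rewrite -ge0_integralZl_EFin ?powR_ge0//; last 2 first.
    - by move=> z _; rewrite lee_fin.
    - exact: mhE.
    rewrite [leRHS]integral_mkcond; apply: ge0_le_integral => //.
    - by move=> z _; rewrite -EFinM lee_fin mulr_ge0 ?powR_ge0.
    - by apply: measurable_funeM; exact: mhE.
    - apply/(measurable_restrictT _ _).1 => //.
      exact: (measurable_funTS (mG k)).
    - move=> z _; rewrite -EFinM /h patchE indicE.
      by case: (z \in S); rewrite lee_fin ?mulr1 ?mulr0 ?mul0r ?mulr0// mulrCA.
  rewrite nneseriesZl; last first.
    by move=> k _; apply: integral_ge0 => z _; rewrite lee_fin.
  rewrite -integral_nneseries//; last 2 first.
  - by move=> k; exact: (measurable_funTS (mG k)).
  - by move=> k z _; rewrite lee_fin.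
  apply: (@le_trans _ _ ((2 * Cw)%:E * ((Ca * (2 * C0) `^ a)%:E *
      shell_int nu (fun z => F z `^ p)%R x0 (2 * r0)))%E).
    apply: lee_wpmul2l; first by rewrite lee_fin mulr_ge0 ?(ltW Cw0).
    rewrite -ge0_integralZl_EFin//; last 3 first.
    - by move=> z _; rewrite lee_fin powR_ge0.
    - by apply/measurable_funTS/measurable_EFinP.
    - by rewrite mulr_ge0 ?powR_ge0 ?(ltW Ca0).
    apply: ge0_le_integral => //.
    - by move=> z _; apply: nneseries_ge0 => k _ _; rewrite lee_fin.
    - apply/measurable_funTS; apply: measurable_nneseries => [k z|k].
        by rewrite lee_fin.
      exact: mG.
    - by apply/measurable_funTS; apply: measurable_funeM; exact/measurable_EFinP.
    - move=> z _; under eq_eseriesr do rewrite EFinM.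
      rewrite nneseriesZl; last by move=> k _; rewrite lee_fin mulr_ge0 ?powR_ge0.
      apply: (@le_trans _ _ ((F z)%:E * (Ca * (2 * C0 * F z) `^ a)%:E)%E).
        apply: lee_wpmul2l; first by rewrite lee_fin.
        by apply: dyadic_threshold_sum_le => //; rewrite !mulr_ge0 ?(ltW C00).
      rewrite -!EFinM lee_fin (powRM _ _ (F0 z)) ?mulr_ge0 ?(ltW C00)//.
      rewrite mulrCA -(mulrA Ca) ler_pM2l// mulrCA ler_pM2l ?powR_gt0 ?mulr_gt0//.
      have [->|Fz] := eqVneq (F z) 0; first by rewrite mul0r powR_ge0.
      rewrite -{1}(powRr1 (F0 z)) -powRD; last by rewrite Fz implybT.
      by rewrite (_ : 1 + a = p)// /a; lra.
  apply: (@le_trans _ _ ((2 * Cw)%:E * ((Ca * (2 * C0) `^ a)%:E *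
      (N `^ p * (2 * r0) `^ (- (p * b)) * shell_vol m x0 (2 * r0))%:E))%E).
    apply: lee_wpmul2l; first by rewrite lee_fin mulr_ge0 ?(ltW Cw0).
    apply: lee_wpmul2l; first by rewrite lee_fin mulr_ge0 ?powR_ge0 ?(ltW Ca0).
    by apply: HF; rewrite mulr_gt0.
  rewrite -!EFinM lee_fin -!mulrA.
  do 3 (rewrite ler_pM2l//).
  rewrite ler_pM2l ?invr_gt0// ler_pM2l ?powR_gt0 ?mulr_gt0// [leRHS]mulrCA.
  rewrite ler_pM2l ?powR_gt0// [leRHS]mulrCA; apply: ler_pM; rewrite ?powR_ge0 ?(ltW (shell_vol_gt0 _ _ _)) ?mulr_gt0//.
    apply: powR_antitone => //; first by lra.
    by rewrite oppr_le0 mulr_ge0 ?(ltW b0)//; move: p1; lra.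
  by apply: shell_vol_scale => //; rewrite ler1n.
Qed.

End morrey_levels.

(** * Domination of the Riesz majorant *)

Section domination.
Context {R : realType}.
Variables (nu g p s b : R).
Hypotheses (hnu : - 2^-1 <= nu) (g0 : 0 < g) (gd : g < dunkl_dim nu).
Hypotheses (p1 : 1 < p) (gb : g < b) (s0 : 0 < s) (sp : s * (1 - g / b) = p).
Local Notation m := (2 * nu + 1).
Local Notation mu := (dunkl_measure nu).

(** At a point lying in every level set the dominating series is infinite, so the domination holds
    there without any control of averages. *)
Lemma level_series_pinfty (L : R) (u : nat -> R) : 0 < L ->
  (forall k, u k = 1) -> (\sum_(k <oo) ((2 ^+ k * L) `^ p * u k)%:E = +oo)%E.
Proof.
move=> L0 u1; apply: eq_infty => r.
pose k := (Num.truncn `|r / L `^ p|).+1.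
apply: (@le_trans _ _ ((2 ^+ k * L) `^ p * u k)%:E); last first.
  apply: (nneseries_term_le (u := fun k => ((2 ^+ k * L) `^ p * u k)%:E)) => n.
  by rewrite u1 mulr1 lee_fin powR_ge0.
rewrite lee_fin u1 mulr1 powRM ?exprn_ge0 ?(ltW L0)// -ler_pdivrMr ?powR_gt0//.
apply: (le_trans (ler_norm _)).
have rk : `|r / L `^ p| <= k%:R by rewrite ltW// truncnS_gt.
apply: (le_trans rk); apply: (@le_trans _ _ (2 ^+ k)).
  by rewrite -natrX ler_nat ltnW// ltn_expl.
have k0 : 0 <= 2 ^+ k :> R by exact: exprn_ge0.
rewrite -[leLHS](powRr1 k0).
by apply: ler_powR; [rewrite exprn_ege1// ler1n|move: p1; exact: ltW].
Qed.

(** At the first level [k] whose set misses [x], Hedberg's inequality with [A = 2^k L] bounds the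
    majorant. Its [s]-th power has the factor [(2^k L)^p] because [s (1 - g / b) = p], and this
    factor is charged to the preceding level set. *)
Lemma riesz_majorant_domination : exists2 C : R, 0 < C &
  forall (F : R -> R) (N x0 r0 : R), measurable_fun setT F ->
    (forall z, 0 <= F z) -> 0 < N -> 0 < r0 -> morrey_bound nu p b F N ->
    exists H : R -> \bar R, [/\ measurable_fun setT H,
      forall x, (0 <= H x)%E,
      forall x, shell x0 r0 x -> (riesz_majorant nu g F x `^ s <= H x)%E &
      (\int[mu]_(x in shell x0 r0) H x <=
        (C * (N `^ s * r0 `^ (- (p * b)) * shell_vol m x0 r0))%:E)%E].
Proof.
have b0 : 0 < b := lt_trans g0 gb.
have [[Cl Cm] [/= Cl0 Cm0 HU]] := morrey_level_sets hnu p1 b0.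
have [Ch Ch0 HH] := riesz_majorant_hedberg hnu g0 gd gb.
set c0 := shell_cst nu + 1.
have c00 : 0 < c0 by rewrite ltr_pwDr ?shell_cst_ge0.
have sgb : s * (g / b) = s - p by rewrite -sp mulrBr mulr1 opprB addrCA subrr addr0.
set B := Ch `^ s * c0 `^ (s - p).
have B0 : 0 < B by rewrite mulr_gt0 ?powR_gt0.
exists (B * (Cl `^ p * c0 + 2 `^ p * Cm)).
  by rewrite mulr_gt0// addr_gt0 ?mulr_gt0 ?powR_gt0.
move=> F N x0 r0 mF F0 N0 r00 HF.
have [U [mU UQ Usum]] := HU F N x0 r0 mF F0 N0 r00 HF.
set L := Cl * (N * r0 `^ (- b)) in UQ Usum.
have L0 : 0 < L by rewrite !mulr_gt0 ?powR_gt0.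
have Lk k : 0 < 2 ^+ k * L by rewrite mulr_gt0 ?exprn_gt0.
pose S x := (\sum_(k <oo) ((2 ^+ k * L) `^ p * \1_(U k) x)%:E)%E.
pose c := B * N `^ (s - p).
have c_gt0 : 0 < c by rewrite mulr_gt0 ?powR_gt0.
have u0 k x : 0 <= (2 ^+ k * L) `^ p * \1_(U k) x by rewrite mulr_ge0 ?powR_ge0.
have mu_ k : measurable_fun setT (fun x => ((2 ^+ k * L) `^ p * \1_(U k) x)%:E).
  by apply/measurable_EFinP; apply: measurable_funM => //; exact: measurable_indic.
have mI_ k : measurable_fun setT (fun x => (\1_(U k) x : R)%:E).
  by apply/measurable_EFinP; exact: measurable_indic.
have S0 x : (0 <= S x)%E by apply: nneseries_ge0 => k _ _; rewrite lee_fin.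
have mS : measurable_fun setT S.
  by apply: measurable_nneseries => // k x; rewrite lee_fin.
have pp : 0 < p by move: p1; apply: lt_trans.
exists (fun x => c%:E * ((L `^ p)%:E + (2 `^ p)%:E * S x))%E; split.
- apply: measurable_funeM; apply: emeasurable_funD => //.
  exact: measurable_funeM.
- move=> x; apply: mule_ge0; first by rewrite lee_fin ltW.
  by apply: adde_ge0; rewrite ?lee_fin ?powR_ge0// mule_ge0// lee_fin powR_ge0.
- move=> x xS; have [|/existsNP exk] := pselect (forall k, U k x).
    move=> xU; rewrite /S level_series_pinfty//; last first.
      by move=> k; rewrite indicE mem_set.
    by rewrite gt0_muley ?lte_fin ?powR_gt0// addey// gt0_muley ?lte_fin ?leey.
  have ex : exists k, `[< ~ U k x >].
    by have [k nU] := exk; exists k; exact/asboolP.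
  have [k /asboolP nU kmin] := ex_minnP ex.
  have G : (riesz_majorant nu g F x <=
      (Ch * ((2 ^+ k * L) `^ (1 - g / b) * (c0 * N) `^ (g / b)))%:E)%E.
    apply: HH => //; first by rewrite mulr_gt0.
      by move=> r r_gt0; exact: UQ.
    move=> r r_gt0; rewrite -(mulrA c0).
    exact: (morrey_bound_average hnu p1 x mF F0 N0 HF r_gt0).
  apply: (@le_trans _ _ (c%:E * ((2 ^+ k * L) `^ p)%:E)%E).
    apply: (@le_trans _ _ ((Ch * ((2 ^+ k * L) `^ (1 - g / b) *
        (c0 * N) `^ (g / b)))%:E `^ s)%E).
      apply: gt0_ler_poweR => //; first exact: ltW.
      - rewrite in_itv/= leey andbT; apply: integral_ge0 => y _.
        by rewrite lee_fin mulr_ge0.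
      - by rewrite in_itv/= leey andbT lee_fin !mulr_ge0 ?powR_ge0 ?(ltW Ch0).
    rewrite poweR_EFin -EFinM lee_fin le_eqVlt; apply/orP; left; apply/eqP.
    rewrite powRM ?mulr_ge0 ?powR_ge0 ?(ltW Ch0)// powRM ?powR_ge0//.
    rewrite -!powRrM (mulrC _ s) sp (mulrC _ s) sgb [(c0 * N) `^ _]powRM ?(ltW c00) ?(ltW N0)//.
    by rewrite /c /B; ring.
  apply: lee_wpmul2l; first by rewrite lee_fin ltW.
  (* For [k = 0] the constant term [L^p] of [H] suffices. Otherwise [x] lies in the preceding set,
     whose term is smaller by the factor [2^p]. *)
  case: k nU kmin G => [|k] nU kmin _.
    by rewrite expr0 mul1r leeDl// mule_ge0// lee_fin powR_ge0.
  have Uk : U k x.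
    apply: contrapT => nUk; have := kmin k; rewrite ltnn => -/(_ _)H.
    by have /H : `[< ~ U k x >] by exact/asboolP.
  apply: (@le_trans _ _ ((2 `^ p)%:E * S x)%E); last first.
    by rewrite leeDr// lee_fin powR_ge0.
  rewrite exprS -mulrA powRM ?(ltW (Lk _))// EFinM.
  apply: lee_wpmul2l; first by rewrite lee_fin powR_ge0.
  have := nneseries_term_le (u := fun k => ((2 ^+ k * L) `^ p * \1_(U k) x)%:E) k.
  by rewrite indicE mem_set// mulr1; apply => n; rewrite lee_fin.
- have mD := @measurable_shell R x0 r0.
  have V0 := shell_vol_gt0 m x0 r00.
  rewrite ge0_integralZl_EFin ?(ltW c_gt0)//; last 2 first.
  - by move=> x _; apply: adde_ge0; rewrite ?lee_fin ?powR_ge0// mule_ge0// lee_fin powR_ge0.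
  - apply/measurable_funTS; apply: emeasurable_funD => //; exact: measurable_funeM.
  rewrite ge0_integralD//; last 3 first.
  - by move=> x _; rewrite lee_fin powR_ge0.
  - by move=> x _; rewrite mule_ge0// lee_fin powR_ge0.
  - apply/measurable_funTS; exact: measurable_funeM.
  rewrite (_ : (fun _ => (L `^ p)%:E) = cst (L `^ p)%:E)// integral_cst//.
  rewrite ge0_integralZl_EFin ?powR_ge0//; last exact: measurable_funTS.
  apply: (@le_trans _ _ (c%:E * ((L `^ p)%:E * (c0 * shell_vol m x0 r0)%:E +
     (2 `^ p)%:E * (Cm * (N `^ p * r0 `^ (- (p * b)) * shell_vol m x0 r0))%:E))%E).
    apply: lee_wpmul2l; first by rewrite lee_fin ltW.
    apply: leeD; apply: lee_wpmul2l; rewrite ?lee_fin ?powR_ge0//.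
      apply: (le_trans (dunkl_shell_le hnu x0 r00)).
      by rewrite lee_fin ler_pM2r// lerDl.
    apply: (le_trans _ Usum).
    apply: (@le_trans _ _ (\int[mu]_x S x)%E).
      exact: ge0_subset_integral.
    rewrite /S integral_nneseries//; last by move=> k x _; rewrite lee_fin.
    apply: lee_nneseries => [k _ _|k _].
      by apply: integral_ge0 => x _; rewrite lee_fin.
    under eq_integral do rewrite EFinM.
    rewrite ge0_integralZl_EFin ?powR_ge0//; last first.
      exact: mI_.
    have -> : (\int[mu]_x (\1_(U k) x)%:E = mu (U k))%E.
      by rewrite -[in RHS](setIT (U k)); exact: (@integral_indic _ (measurableTypeR R) R mu setT measurableT (U k) (mU k)).
    by [].
  rewrite -!(EFinM, EFinD) lee_fin.
  have Lp : L `^ p = Cl `^ p * (N `^ p * r0 `^ (- (p * b))).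
    rewrite /L powRM ?mulr_ge0 ?powR_ge0 ?(ltW Cl0) ?(ltW N0)//.
    by rewrite powRM ?powR_ge0 ?(ltW N0)// -powRrM mulNr (mulrC b).
  have Ns : N `^ s = N `^ (s - p) * N `^ p by rewrite -powRD_gt0// subrK.
  by rewrite Lp Ns /c le_eqVlt; apply/orP; left; apply/eqP; ring.
Qed.

End domination.

Lemma ae_integral_ge0 d (T : measurableType d) (R : realType)
    (m : {measure set T -> \bar R}) (D : set T) (f : T -> \bar R) :
  measurable D -> measurable_fun D f ->
  {ae m, forall x, D x -> (0 <= f x)%E} -> (0 <= \int[m]_(x in D) f x)%E.
Proof.
move=> mD mf f0; have -> : (\int[m]_(x in D) f x = \int[m]_(x in D) `|f x|)%E.
  apply: ae_eq_integral => //; first exact: measurableT_comp.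
  by apply: filterS f0 => x /[apply] f0; rewrite gee0_abs.
exact: integral_ge0.
Qed.

(** * Positivity of translations integrated over symmetric intervals *)

Section translation_positive.
Context {R : realType}.
Variable nu : R.
Local Notation leb := (@lebesgue_measure R).
Local Notation mu := (dunkl_measure nu).
Implicit Types (F : R -> R) (x y z r u : R).

(** Completing the square: [rho^2 = (x + u y)^2 + y^2 (1 - u^2)]. *)
Lemma dunkl_rho_bound x y u : -1 <= u -> u <= 1 ->
  `|(x + u * y) / dunkl_rho x y u| <= 1.
Proof.
move=> u1 u2; set p := dunkl_rho x y u.
have [p0|p0] := eqVneq p 0; first by rewrite p0 invr0 mulr0 normr0.
have w0 : 0 <= 1 - u ^+ 2.
  have -> : 1 - u ^+ 2 = (1 - u) * (1 + u) by ring.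
  by rewrite mulr_ge0//; lra.
have pp : 0 < p by rewrite lt_def p0 sqrtr_ge0.
have E : (x + u * y) ^+ 2 + y ^+ 2 * (1 - u ^+ 2) = p ^+ 2.
  rewrite /p /dunkl_rho sqr_sqrtr; first by ring.
  have -> : x ^+ 2 + y ^+ 2 + 2 * x * y * u = (x + u * y) ^+ 2 + y ^+ 2 * (1 - u ^+ 2) by ring.
  by rewrite addr_ge0 ?sqr_ge0// mulr_ge0 ?sqr_ge0.
rewrite normrM normfV (ger0_norm (ltW pp)) ler_pdivrMr// mul1r.
rewrite -(@ler_pXn2r _ 2)// ?nnegrE ?(ltW pp)// real_normK ?num_real// -E lerDl.
by apply: mulr_ge0; rewrite ?sqr_ge0.
Qed.

(* The part of the translation kernel that is even in y is nonnegative, since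
   |x + u y| <= rho. *)
Lemma translation_pair_ge0 F x y : nu != - 2^-1 -> 0 <= dunkl_const nu ->
  measurable_fun [set: R] F -> (forall z, 0 <= F z) ->
  (bessel nu (even_sum F) x y < +oo)%E ->
  0 <= dunkl_translation nu x F y + dunkl_translation nu x F (- y).
Proof.
move=> nuN c0 mF F0 fin.
have mE := measurable_even_sum mF; have E0 := even_sum_ge0 F0.
have fin3 : (bessel nu (even_sum F) x (- y) < +oo)%E by rewrite besselNr.
have I1 := integrable_translation_integrand mF F0 fin.
have I3 := integrable_translation_integrand mF F0 fin3.
have rN u : dunkl_rho x (- y) (- u) = dunkl_rho x y u.
  by rewrite /dunkl_rho; congr Num.sqrt; ring.
rewrite !dunkl_translationE// -mulrDr; apply: mulr_ge0; first exact: divr_ge0.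
have mT z : measurable_fun [set: R] (translation_integrand nu F x z).
  exact: measurable_translation_integrandr.
rewrite [X in _ + X]Rintegral_opp_itv//.
have I3' : leb.-integrable `[(-1), 1]%classic
    (EFin \o (fun u => translation_integrand nu F x (- y) (- u))).
  have mN : measurable_fun [set: R] (fun u => translation_integrand nu F x (- y) (- u)).
    exact: (measurableT_comp (mT _)).
  apply/integrableP; split; first exact/measurable_EFinP/measurable_funTS.
  have /integrableP[_ fi] := I3; apply: le_lt_trans fi.
  rewrite le_eqVlt; apply/orP; left; apply/eqP/esym.
  apply: (@integral_opp_sym R leb `[-1, 1]%classic
    (fun u => `|translation_integrand nu F x (- y) u|%:E)).
  - by move=> k mk k0; exact: ge0_integral_opp.
  - by [].
  - by move=> z /=; rewrite !in_itv/= lerN2 lerNl andbC.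
  - by apply/measurable_EFinP; exact: measurableT_comp.
rewrite -RintegralD//; apply: Rintegral_ge0 => u.
rewrite /= in_itv/= => /andP[u1 u2].
rewrite /translation_integrand rN /bessel_weight sqrrN.
have /ler_normlP[h1 h2] := dunkl_rho_bound x y u1 u2.
set p := dunkl_rho x y u; set w := _ `^ _.
(* The weights combine through [(1 + u) (x + y) + (1 - u) (x - y) = 2 (x + u y)]. *)
have -> : (F p * (1 + (x + y) / p) + F (- p) * (1 - (x + y) / p)) * (1 + u) * w +
   (F p * (1 + (x + - y) / p) + F (- p) * (1 - (x + - y) / p)) * (1 + - u) * w =
   2 * w * (F p * (1 + (x + u * y) / p) + F (- p) * (1 - (x + u * y) / p)) by ring.
rewrite mulr_ge0//; first by rewrite mulr_ge0// powR_ge0.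
by rewrite addr_ge0// mulr_ge0//; move: h1 h2; rewrite -/p; lra.
Qed.

(* The upper bound alone would not do for a Morrey norm: [T `^ s^-1] is 1 for [T < 0]. *)
Lemma translation_int_ge0 F x r : - 2^-1 <= nu -> 0 <= dunkl_const nu ->
  measurable_fun [set: R] F -> (forall z, 0 <= F z) -> 0 < r ->
  (shell_int nu F x r < +oo)%E -> (0 <= translation_int nu F x r)%E.
Proof.
move=> hnu c0 mF F0 r0 Ffin; have [nuE|nuN] := eqVneq nu (- 2^-1).
  by rewrite translation_int_shift//; apply: integral_ge0 => z _; rewrite lee_fin.
have {}hnu : - 2^-1 < nu by rewrite lt_def nuN.
have [C C0 hC] := bessel_shell_le hnu.
have mE := measurable_even_sum mF; have E0 := even_sum_ge0 F0.
pose D : set (measurableTypeR R) := `](- r), r[%classic.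
have mD : measurable D by exact: measurable_itv.
pose b y := bessel nu (even_sum F) x y.
have mb : measurable_fun [set: R] b by exact: measurable_besselr.
have b0 y : (0 <= b y)%E by exact: bessel_ge0.
have Ib : mu.-integrable D b.
  apply/integrableP; split; first exact: measurable_funTS.
  under eq_integral do rewrite gee0_abs//.
  apply: (le_lt_trans (hC F x r mF F0 r0)).
  by apply: lte_mul_pinfty => //; rewrite lee_fin mulr_ge0 ?powR_ge0// ltW.
have mt : measurable_fun [set: R] (fun z => (dunkl_translation nu x F z)%:E).
  by apply/measurable_EFinP; exact: measurable_dunkl_translationr.
have mtN : measurable_fun [set: R] (fun z => (dunkl_translation nu x F (- z))%:E).
  exact: (measurableT_comp mt).
have It k : (forall z, k z = z) \/ (forall z, k z = - z) ->
    measurable_fun [set: R] (fun z => (dunkl_translation nu x F (k z))%:E) ->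
    mu.-integrable D (fun z => (dunkl_translation nu x F (k z))%:E).
  move=> kz mk.
  apply: (@le_integrable _ (measurableTypeR R) R mu _ _ _ (fun z => (2 * dunkl_const nu)%:E * b z)%E) => //.
  - exact: measurable_funTS.
  - move=> z _; apply: (le_trans (dunkl_translation_le _ _ nuN c0 mF F0)).
    rewrite gee0_abs; last by rewrite mule_ge0// lee_fin mulr_ge0.
    by rewrite /b; case: kz => ->; rewrite ?besselNr.
  - exact: integrableZl.
have I1 := It id (or_introl (fun=> erefl)) mt.
have I3 := It -%R (or_intror (fun=> erefl)) mtN.
have TE : translation_int nu F x r = (\int[mu]_(z in D) (dunkl_translation nu x F (- z))%:E)%E.
  rewrite /translation_int (@integral_opp_sym R mu D (fun z => (dunkl_translation nu x F z)%:E))//.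
  - by move=> k mk k0; exact: ge0_integral_dunkl_opp.
  - by move=> z; rewrite /D/= !in_itv/= ltrN2 ltrNl andbC.
set T := translation_int nu F x r in TE *.
have fT : T \is a fin_num by exact: (integrable_fin_num mD I1).
have T2 : (0 <= T + T)%E.
  rewrite {2}TE.
  have -> : (T + \int[mu]_(z in D) (dunkl_translation nu x F (- z))%:E =
     \int[mu]_(z in D) ((dunkl_translation nu x F z)%:E +
      (dunkl_translation nu x F (- z))%:E))%E by exact: (esym (integralD mD I1 I3)).
  have ms := measurable_funTS (D := D) (emeasurable_funD mt mtN).
  refine (@ae_integral_ge0 _ (measurableTypeR R) R mu D _ mD ms _).
  have := integrable_ae mD Ib; apply: filterS => z h Dz.
  have bf := h Dz.
  rewrite -EFinD lee_fin.
  apply: (translation_pair_ge0 nuN c0 mF F0).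
  by move: bf; rewrite ge0_fin_numE.
by rewrite (fin_num_halves fT); apply: mule_ge0; first by rewrite lee_fin.
Qed.

End translation_positive.

Section cmodulus.
Context {R : realType}.
Implicit Types (z : R[i]) (f : R -> R[i]).

Lemma cmodulus_ge0 z : 0 <= cmodulus z.
Proof. by case: z => a b; exact: sqrtr_ge0. Qed.

Lemma cmodulus_le_ReIm z :
  cmodulus z <= `|complex.Re z| + `|complex.Im z|.
Proof.
case: z => a b; rewrite /cmodulus/=.
rewrite -(@ler_pXn2r _ 2)// ?nnegrE ?addr_ge0 ?sqrtr_ge0//.
rewrite sqr_sqrtr ?addr_ge0 ?sqr_ge0// sqrrD !real_normK ?num_real//.
by rewrite lerD2r lerDl mulrn_wge0// mulr_ge0.
Qed.

Lemma norm_Re_le z : `|complex.Re z| <= cmodulus z.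
Proof.
case: z => a b; rewrite /cmodulus/= -sqrtr_sqr.
by rewrite ler_sqrt ?lerDl ?addr_ge0 ?sqr_ge0.
Qed.

Lemma norm_Im_le z : `|complex.Im z| <= cmodulus z.
Proof.
case: z => a b; rewrite /cmodulus/= -sqrtr_sqr.
by rewrite ler_sqrt ?lerDr ?addr_ge0 ?sqr_ge0.
Qed.

Lemma measurable_cmodulus f : cmeasurable f ->
  measurable_fun [set: R] (fun x => cmodulus (f x)).
Proof.
move=> [m1 m2]; rewrite (_ : (fun _ => _) = fun x =>
  (complex.Re (f x) ^+ 2 + complex.Im (f x) ^+ 2) `^ 2^-1).
  apply: (measurableT_comp (measurable_powR _)).
  by apply: measurable_funD; apply: measurable_funX.
apply/funext => x; rewrite /cmodulus; case: (f x) => a b /=.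
by rewrite powR12_sqrt// addr_ge0 ?sqr_ge0.
Qed.

Lemma Re_mulC z (k : R) : complex.Re (z * (k +i* 0)%C) = complex.Re z * k.
Proof. by case: z => a b /=; rewrite mulr0 subr0. Qed.

Lemma Im_mulC z (k : R) : complex.Im (z * (k +i* 0)%C) = complex.Im z * k.
Proof. by case: z => a b /=; rewrite mulr0 add0r. Qed.

Lemma cmodulus0 : cmodulus (0 : R[i]) = 0.
Proof. by rewrite /cmodulus/= expr0n/= addr0 sqrtr0. Qed.

End cmodulus.

(** * From the Morrey norm to shell averages *)

Section local_norms.
Context {R : realType}.
Variable nu : R.
Local Notation d := (dunkl_dim nu).
Local Notation m := (2 * nu + 1).
Implicit Types (h : R -> R) (x r : R).

Lemma shell_int_lty h x r : dunkl_locally_integrable nu h -> (forall z, 0 <= h z) ->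
  (shell_int nu h x r < +oo)%E.
Proof.
move=> [mh hK] h0.
apply: le_lt_trans (hK _ (@segment_compact R (- (`|x| + r)) (`|x| + r))).
under [leRHS]eq_integral do rewrite ger0_norm//.
apply: ge0_subset_integral => //.
- exact: measurable_shell.
- by apply/measurable_funTS/measurable_EFinP.
- by move=> z _; rewrite lee_fin.
- exact: subset_shell_itv.
Qed.

Lemma shell_locally_integrable h : measurable_fun [set: R] h -> (forall z, 0 <= h z) ->
  (forall r, 0 < r -> (shell_int nu h 0 r < +oo)%E) -> dunkl_locally_integrable nu h.
Proof.
move=> mh h0 hr; split=> // K cK.
have mK : measurable K by apply: compact_measurable.
have [M M0 HM] := ex_strict_bound_gt0 (compact_bounded cK).
apply: le_lt_trans (hr _ M0); under eq_integral do rewrite ger0_norm//.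
apply: ge0_subset_integral => //.
- exact: measurable_shell.
- by apply/measurable_funTS/measurable_EFinP.
- by move=> z _; rewrite lee_fin.
- by move=> z Kz; have := HM z Kz; rewrite /shell/= normr0 subr0 normr_id.
Qed.

(** The sign of [T] is left open, as translation integrals are signed; for [T <= 0] the conclusion
    is trivial. *)
Lemma poweR_root_le (a N p : R) (T : \bar R) : 0 < a -> 0 <= N -> 0 < p ->
  (a%:E * T `^ p^-1 <= N%:E)%E -> (T <= ((N / a) `^ p)%:E)%E.
Proof.
move=> a0 N0 p0; case: T => [T| |]; last by rewrite leNye.
  have [T0 _|T0] := leP T 0; first by rewrite lee_fin (le_trans T0)// powR_ge0.
  rewrite poweR_EFin -EFinM !lee_fin mulrC -ler_pdivlMr// => H.
  rewrite -[leLHS](powRr1 (ltW T0)) -[X in T `^ X](mulVf (lt0r_neq0 p0)) powRrM.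
  by apply: ge0_ler_powR; rewrite ?nnegrE ?powR_ge0 ?divr_ge0 ?(ltW p0) ?(ltW a0).
by rewrite poweRyr ?gt_eqF ?invr_gt0// gt0_muley ?lte_fin// leye_eq.
Qed.

Lemma morrey_norm_translation_le p q (f : R -> R[i]) (N : R) : 0 < p -> 0 <= N ->
  (dunkl_morrey_norm nu p q f <= N%:E)%E ->
  dunkl_locally_integrable nu (fun x => cmodulus (f x) `^ p) /\
  forall x r, 0 < r ->
    (translation_int nu (fun x => cmodulus (f x) `^ p)%R x r <=
     ((N / r `^ (d * (q^-1 - p^-1))) `^ p)%:E)%E.
Proof.
move=> p0 N0; rewrite /dunkl_morrey_norm; case: asboolP => // lf supN; split => //.
move=> x r r0; apply: poweR_root_le => //; first exact: powR_gt0.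
by apply: le_trans supN; apply: ereal_sup_ubound; exists x, r.
Qed.

Lemma morrey_norm_ge0 p q (f : R -> R[i]) : (0 <= dunkl_morrey_norm nu p q f)%E.
Proof.
rewrite /dunkl_morrey_norm; case: ifP => // _.
apply: le_ereal_sup_tmp; eexists; first by exists 0, 1; split.
by apply: mule_ge0; rewrite ?lee_fin ?powR_ge0// poweR_ge0.
Qed.

(** The norm controls the translations by [x] and by [- x] alike, so the lower bound for their sum
    applies; the factor [r^d] in [shell_ratio] cancels the one in the norm and leaves
    [r^(- p d / q)]. *)
Lemma morrey_norm_bound p q : - 2^-1 <= nu -> (nu != - 2^-1 -> 0 < dunkl_const nu) ->
    0 < p -> 0 < q ->
  exists2 C : R, 0 < C & forall (f : R -> R[i]) (N : R), 0 < N ->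
    (dunkl_morrey_norm nu p q f <= N%:E)%E ->
    morrey_bound nu p (d / q) (fun x => cmodulus (f x)) (C * N).
Proof.
move=> hnu cpos p0 q0; have [c c0 hc] := translation_int_ge hnu cpos.
have m0 : 0 <= m by move: hnu => ?; lra.
(* The 2 counts the translations by [x] and [- x]; the power of 2 is the doubling constant. *)
set A := 2 / c * 2 `^ (m + 1); have A0 : 0 < A by rewrite mulr_gt0 ?divr_gt0 ?powR_gt0.
have Q0 : 0 < A * 2 `^ (- (p * (d / q))) by rewrite mulr_gt0 ?powR_gt0.
exists ((A * 2 `^ (- (p * (d / q)))) `^ p^-1); first exact: powR_gt0.
move=> f N N0 fN x r r0.
have [lf HT] := morrey_norm_translation_le p0 (ltW N0) fN.
set F := fun z : R => cmodulus (f z) `^ p.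
have r2 : 0 < 2 * r by rewrite mulr_gt0.
have [mF _] := lf.
have F0 z : 0 <= F z by exact: powR_ge0.
(* The lower bound sees only the shell of half the radius, so it is applied at [2 r]. *)
have := hc F x (2 * r) mF F0 (fun y s => shell_int_lty y s lf F0) r2.
rewrite mulrAC divff// mul1r => H.
have {}H := le_trans H (leeD (HT x _ r2) (HT (- x) _ r2)).
have V0 := shell_vol_gt0 m x r2.
have V1 := shell_vol_gt0 m x r0.
have k0 : 0 < c * shell_ratio m x (2 * r).
  by rewrite mulr_gt0// shell_ratioE// divr_gt0 ?powR_gt0.
move: H; rewrite -lee_pdivlMl// => /le_trans; apply.
rewrite -EFinD -EFinM lee_fin shell_ratioE//.
have -> : (N / (2 * r) `^ (d * (q^-1 - p^-1))) `^ p =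
    N `^ p * ((2 * r) `^ (- (p * (d / q))) * (2 * r) `^ (m + 1)).
  rewrite powRM ?invr_ge0 ?powR_ge0 ?(ltW N0)// -powRN -powRrM -powRD_gt0//.
  congr (_ * _ `^ _); rewrite /dunkl_dim; field.
  by rewrite !gt_eqF.
rewrite [in leRHS]powRM ?powR_ge0 ?(ltW N0)// -powRrM mulVf ?gt_eqF//.
rewrite powRr1 ?(ltW Q0)//.
have R0 : 0 < (2 * r) `^ (m + 1) by exact: powR_gt0.
have Vs : shell_vol m x (2 * r) <= 2 `^ (m + 1) * shell_vol m x r.
  by apply: shell_vol_scale; rewrite ?ler1n.
set w := (2 * r) `^ (m + 1) in R0 *.
have -> : (2 * r) `^ (- (p * (d / q))) = 2 `^ (- (p * (d / q))) * r `^ (- (p * (d / q))).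
  by rewrite powRM ?(ltW r0).
set E := 2 `^ (- _); set G := r `^ _; set Np := N `^ p.
have E0 : 0 <= E by exact: powR_ge0.
have G0 : 0 <= G by exact: powR_ge0.
have Np0 : 0 <= Np by exact: powR_ge0.
have -> : (c * (w / shell_vol m x (2 * r)))^-1 *
   (Np * (E * G * w) + Np * (E * G * w)) = 2 / c * E * Np * G * shell_vol m x (2 * r).
  by field; rewrite !gt_eqF.
have -> : A * E * Np * G * shell_vol m x r =
  2 / c * E * Np * G * (2 `^ (m + 1) * shell_vol m x r) by rewrite /A; ring.
apply: ler_wpM2l => //.
by rewrite !mulr_ge0// invr_ge0 ltW.
Qed.

End local_norms.

(** * Pointwise control of the fractional integral *)

Section riesz_bound.
Context {R : realType}.
Variables (nu g : R).
Local Notation mu := (dunkl_measure nu).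
Local Notation K := (dunkl_riesz_kernel nu g).
Local Notation I := (dunkl_fractional_integral nu g).
Implicit Types (f : R -> R[i]) (x y : R).

Lemma measurable_translation_kernelr x :
  measurable_fun [set: R] (fun y => dunkl_translation nu y K x).
Proof.
by have /(@measurable_fun_pair2 _ _ _ _ _ _ _ x) := measurable_translation_kernel nu g.
Qed.

Lemma Re_fractional_integral f x : complex.Re (I f x) =
  \int[mu]_(y in setT) (complex.Re (f y) * dunkl_translation nu y K x).
Proof. by apply: eq_Rintegral => y _; rewrite -Re_mulC. Qed.

Lemma Im_fractional_integral f x : complex.Im (I f x) =
  \int[mu]_(y in setT) (complex.Im (f y) * dunkl_translation nu y K x).
Proof. by apply: eq_Rintegral => y _; rewrite -Im_mulC. Qed.

Lemma measurable_fractional_part (h : R -> R) : measurable_fun [set: R] h ->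
  measurable_fun [set: R]
    (fun x => \int[mu]_(y in setT) (h y * dunkl_translation nu y K x)).
Proof.
move=> mh.
have mhk : measurable_fun [set: R * R]
    (fun w => h w.2 * dunkl_translation nu w.2 K w.1).
  apply: measurable_funM; first exact: (measurableT_comp mh).
  exact: measurable_translation_kernel.
have H := (@measurable_fun_Rintegral_param _ _ R _ R mu
  (fun w => h w.2 * dunkl_translation nu w.2 K w.1) setT measurableT mhk).
exact H.
Qed.

Lemma cmeasurable_fractional_integral f : cmeasurable f -> cmeasurable (I f).
Proof.
move=> [m1 m2]; split.
- under eq_fun do rewrite Re_fractional_integral.
  exact: measurable_fractional_part.
- under eq_fun do rewrite Im_fractional_integral.
  exact: measurable_fractional_part.
Qed.

(** Convergence is not assumed: an infinite integral is read as 0 by [fine]. *)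
Lemma fractional_part_le (h F : R -> R) x :
  measurable_fun [set: R] h -> measurable_fun [set: R] F -> (forall y, `|h y| <= F y) ->
  (`|\int[mu]_(y in setT) (h y * dunkl_translation nu y K x)|%:E <= riesz_majorant nu g F x)%E.
Proof.
move=> mh mF hF; have mk := measurable_translation_kernelr x.
have mhk : measurable_fun [set: R] (fun y => (h y * dunkl_translation nu y K x)%:E).
  by apply/measurable_EFinP; exact: measurable_funM.
have mFk : measurable_fun [set: R] (fun y => (F y * `|dunkl_translation nu y K x|)%:E).
  by apply/measurable_EFinP; apply: measurable_funM => //; exact: measurableT_comp.
apply: (le_trans (fine_le_abse _)).
apply: (le_trans (@le_abse_integral _ (measurableTypeR R) R mu setT _ measurableT mhk)).
apply: ge0_le_integral => //.
- have mhn : measurable_fun [set: R] (fun y => (`|h y * dunkl_translation nu y K x|)%:E).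
    by apply/measurable_EFinP; apply: measurableT_comp => //; exact: measurable_funM.
  exact: mhn.
- by move=> y _ /=; rewrite lee_fin normrM ler_wpM2r.
Qed.

(** Treating real and imaginary parts separately costs a factor 2 and reduces everything to real
    integrals. *)
Lemma cmodulus_fractional_integral_le f x : cmeasurable f ->
  ((cmodulus (I f x))%:E <=
    2%:E * riesz_majorant nu g (fun y => cmodulus (f y)) x)%E.
Proof.
move=> mf; have [m1 m2] := mf; have mF := measurable_cmodulus mf.
apply: (@le_trans _ _ (`|complex.Re (I f x)| + `|complex.Im (I f x)|)%:E).
  by rewrite lee_fin cmodulus_le_ReIm.
rewrite EFinD (_ : 2%:E = 1 + 1)%E// ge0_muleDl// mul1e.
rewrite Re_fractional_integral Im_fractional_integral.
apply: leeD; apply: fractional_part_le => // y.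
- exact: norm_Re_le.
- exact: norm_Im_le.
Qed.

Lemma fractional_definedP f x : cmeasurable f ->
  (riesz_majorant nu g (fun y => cmodulus (f y)) x < +oo)%E ->
  dunkl_fractional_defined nu g f x.
Proof.
move=> mf Gx; have mF := measurable_cmodulus mf; apply/integrableP; split.
  apply/measurable_EFinP; apply: measurable_funM => //.
  exact: measurable_translation_kernelr.
apply: le_lt_trans Gx; rewrite le_eqVlt; apply/orP; left; apply/eqP.
by apply: eq_integral => y _ /=; rewrite normrM ger0_norm// cmodulus_ge0.
Qed.

End riesz_bound.

Lemma ge0_itv (R : realType) (x : \bar R) : (0 <= x)%E -> x \in `[0%E, +oo%E].
Proof. by move=> x0; rewrite in_itv/= x0 leey. Qed.

(** * Boundedness on Morrey spaces *)

Section fractional_bound.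
Context {R : realType}.
Variables (nu g p q s t : R).
Hypotheses (hnu : - 2^-1 <= nu) (cpos : nu != - 2^-1 -> 0 < dunkl_const nu).
Hypotheses (g0 : 0 < g) (gd : g < dunkl_dim nu) (p1 : 1 < p) (q0 : 0 < q).
Hypotheses (gq : g < dunkl_dim nu / q) (s1 : 1 < s).
Hypotheses (sp : s * (1 - g / (dunkl_dim nu / q)) = p).
Local Notation mu := (dunkl_measure nu).
Local Notation d := (dunkl_dim nu).
Local Notation m := (2 * nu + 1).
Local Notation I := (dunkl_fractional_integral nu g).

Lemma fractional_integral_shell_int : exists2 C : R, 0 < C &
  forall (f : R -> R[i]) (N : R), cmeasurable f -> 0 < N ->
    (dunkl_morrey_norm nu p q f <= N%:E)%E ->
    {ae mu, forall x, dunkl_fractional_defined nu g f x} /\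
    forall x r, 0 < r ->
      (shell_int nu (fun z => cmodulus (I f z) `^ s)%R x r <=
       ((C * N) `^ s * r `^ (- (p * (d / q))) * shell_vol m x r)%:E)%E.
Proof.
have p0 : 0 < p by apply: lt_trans p1.
have s0 : 0 < s by apply: lt_trans s1.
have [Cm Cm0 Hm] := morrey_norm_bound hnu cpos p0 q0.
have [Cd Cd0 Hd] := riesz_majorant_domination hnu g0 gd p1 gq s0 sp.
have A0 : 0 < 2 `^ s * Cd by rewrite mulr_gt0 ?powR_gt0.
exists ((2 `^ s * Cd) `^ s^-1 * Cm); first by rewrite mulr_gt0 ?powR_gt0.
move=> f N mf N0 fN.
have mF := measurable_cmodulus mf.
have mI := measurable_cmodulus (cmeasurable_fractional_integral nu g mf).
have F0 x : 0 <= cmodulus (f x) by exact: cmodulus_ge0.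
have N1 : 0 < Cm * N by rewrite mulr_gt0.
have {}Hm := Hm f N N0 fN.
have {}Hd x r r0 := Hd _ _ x r mF F0 N1 r0 Hm.
split.
(* The dominating function is integrable on each shell around 0, hence finite almost everywhere
   there; these intervals exhaust the line. *)
- have H n : {ae mu, forall x, shell 0 n.+1%:R x -> dunkl_fractional_defined nu g f x}.
    have [H [mH H0 GH IH]] := Hd 0 n.+1%:R (ltr0Sn _ _).
    pose D : set (measurableTypeR R) := shell 0 n.+1%:R.
    have mD : measurable D by exact: measurable_shell.
    have Hi : mu.-integrable D H.
      apply/integrableP; split; first exact: measurable_funTS.
      under eq_integral do rewrite gee0_abs//.
      by apply: le_lt_trans IH _; rewrite ltry.
    have := integrable_ae mD Hi; apply: filterS => x Hx xD.
    apply: fractional_definedP => //.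
    apply: (@lty_poweRy _ _ s); first by rewrite gt_eqF.
    apply: (le_lt_trans (GH x xD)).
    by rewrite -ge0_fin_numE// Hx.
  apply: filterS (ae_foralln H) => x Hx.
  apply: (Hx (Num.truncn `|x|)); rewrite /shell/= normr0 subr0 normr_id.
  exact: truncnS_gt.
- move=> x r r0; have [H [mH H0 GH IH]] := Hd x r r0.
  have mD := @measurable_shell R x r.
  apply: (@le_trans _ _ (\int[mu]_(z in shell x r) ((2 `^ s)%:E * H z))%E).
    apply: ge0_le_integral => //.
    - by move=> z _; rewrite lee_fin powR_ge0.
    - apply/measurable_EFinP/measurable_funTS.
      exact: (measurableT_comp (measurable_powR _) mI).
    - by apply: measurable_funTS; exact: measurable_funeM.
    - move=> z zD; apply: (@le_trans _ _ ((2 `^ s)%:E *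
        riesz_majorant nu g (fun y => cmodulus (f y)) z `^ s)%E); last first.
        by apply: lee_wpmul2l; [rewrite lee_fin powR_ge0|exact: GH].
      have G0 : (0 <= riesz_majorant nu g (fun y => cmodulus (f y)) z)%E.
        by apply: integral_ge0 => y _; rewrite lee_fin mulr_ge0.
      rewrite -poweR_EFin -poweRM// -poweR_EFin.
      apply: gt0_ler_poweR; first exact: ltW.
      - by apply: ge0_itv; rewrite lee_fin cmodulus_ge0.
      - by apply: ge0_itv; rewrite mule_ge0.
      - exact: cmodulus_fractional_integral_le.
  rewrite ge0_integralZl_EFin ?powR_ge0//; last exact: measurable_funTS.
  apply: (@le_trans _ _ ((2 `^ s)%:E *
    (Cd * ((Cm * N) `^ s * r `^ (- (p * (d / q))) * shell_vol m x r))%:E)%E).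
    by apply: lee_wpmul2l; first by rewrite lee_fin powR_ge0.
  rewrite -EFinM lee_fin -(mulrA _ Cm) [in leRHS]powRM ?powR_ge0 ?(ltW N1)//.
  rewrite -powRrM mulVf ?gt_eqF// powRr1 ?(ltW A0)//.
  by rewrite le_eqVlt; apply/orP; left; apply/eqP; ring.
Qed.

Hypotheses (c0 : 0 <= dunkl_const nu) (t0 : 0 < t) (hr : s / t = p / q).

Lemma morrey_norm_of_shell_int : exists2 C : R, 0 < C &
  forall (f : R -> R[i]) (N : R), cmeasurable f -> 0 < N ->
    (forall x r, 0 < r -> (shell_int nu (fun z => cmodulus (f z) `^ s)%R x r <=
       (N `^ s * r `^ (- (p * (d / q))) * shell_vol m x r)%:E)%E) ->
    dunkl_clocally_integrable nu f /\ (dunkl_morrey_norm nu s t f <= (C * N)%:E)%E.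
Proof.
have s0 : 0 < s by apply: lt_trans s1.
have [Ct Ct0 Ht] := translation_int_le hnu c0.
exists (Ct `^ s^-1); first exact: powR_gt0.
move=> f N mf N0 HQ.
have mF := measurable_cmodulus mf.
have mFs : measurable_fun [set: R] (fun z => cmodulus (f z) `^ s).
  exact: (measurableT_comp (measurable_powR _) mF).
have Fs0 z : 0 <= cmodulus (f z) `^ s by exact: powR_ge0.
have F0 z : 0 <= cmodulus (f z) by exact: cmodulus_ge0.
have Qfin x r : 0 < r -> (shell_int nu (fun z => cmodulus (f z) `^ s)%R x r < +oo)%E.
  by move=> r0; apply: le_lt_trans (HQ x r r0) _; rewrite ltry.
have lfs := shell_locally_integrable mFs Fs0 (Qfin 0).
split.
- split => //; apply: shell_locally_integrable => // r r0.
  (* Since [s > 1], [a <= 1 + a^s]; local integrability of the [s]-th power passes to the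
     modulus. *)
  apply: (@le_lt_trans _ _ (\int[mu]_(z in shell 0 r) (1%:E + (cmodulus (f z) `^ s)%:E))%E).
    apply: ge0_le_integral => //.
    - exact: measurable_shell.
    - by move=> z _; rewrite lee_fin.
    - by apply/measurable_EFinP/measurable_funTS.
    - apply: emeasurable_funD => //.
      by apply/measurable_EFinP/measurable_funTS.
    - move=> z _; rewrite -EFinD lee_fin.
      have [h|h] := leP (cmodulus (f z)) 1; first by rewrite (le_trans h)// lerDl.
      apply: ler_wpDl => //; rewrite -[leLHS](powRr1 (F0 z)).
      by apply: ler_powR; apply: ltW.
  have mD := @measurable_shell R 0 r.
  rewrite ge0_integralD//; last 2 first.
  - by move=> z _; rewrite lee_fin.
  - by apply/measurable_EFinP/measurable_funTS.
  rewrite (_ : (fun _ => 1%:E) = cst 1%:E)// integral_cst// mul1e.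
  apply: lte_add_pinfty; last exact: Qfin.
  by apply: le_lt_trans (dunkl_shell_le hnu 0 r0) _; rewrite ltry.
- rewrite /dunkl_morrey_norm; case: asboolP => // _; apply: ge_ereal_sup => _ [x [r [r0 ->]]].
  rewrite -/(translation_int nu (fun z => cmodulus (f z) `^ s)%R x r).
  have T0 := translation_int_ge0 hnu c0 mFs Fs0 r0 (Qfin x r r0).
  have TT := Ht _ x r mFs Fs0 r0.
  have V0 := shell_vol_gt0 m x r0.
  have k0 : (0 <= (Ct * shell_ratio m x r)%:E)%E.
    by rewrite lee_fin shell_ratioE// !mulr_ge0 ?invr_ge0 ?powR_ge0// ltW.
  have {}TT := le_trans TT (lee_wpmul2l k0 (HQ x r r0)).
  have E : Ct * shell_ratio m x r * (N `^ s * r `^ (- (p * (d / q))) * shell_vol m x r) =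
      Ct * (N `^ s * (r `^ (- (p * (d / q))) * r `^ (m + 1))).
    by rewrite shell_ratioE//; field; rewrite gt_eqF.
  rewrite -EFinM E -powRD_gt0// in TT.
  apply: (@le_trans _ _ ((r `^ (d * (t^-1 - s^-1)))%:E *
    (Ct * (N `^ s * r `^ (- (p * (d / q)) + (m + 1))))%:E `^ s^-1)%E).
    apply: lee_wpmul2l; first by rewrite lee_fin powR_ge0.
    apply: gt0_ler_poweR => //; first by rewrite invr_ge0 ltW.
    - by rewrite in_itv/= leey andbT.
    - by rewrite in_itv/= leey andbT lee_fin !mulr_ge0 ?powR_ge0// ltW.
  rewrite poweR_EFin -EFinM lee_fin !powRM ?mulr_ge0 ?powR_ge0 ?(ltW Ct0)//.
  rewrite -!powRrM divff ?gt_eqF// powRr1 ?(ltW N0)//.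
  set a := r `^ _; set c := r `^ _; set k := Ct `^ _.
  have -> : a * (k * (N * c)) = k * N * (c * a) by ring.
  rewrite /a /c /k -powRD_gt0//.
  (* Here [s / t = p / q] makes all powers of [r] cancel. *)
  have -> : (- (p * (d / q)) + (m + 1)) / s + d * (t^-1 - s^-1) = 0.
    have -> : p * (d / q) = d * (s / t) by rewrite hr; ring.
    rewrite /dunkl_dim; field.
    by rewrite !gt_eqF.
  by rewrite powRr0 mulr1.
Qed.

End fractional_bound.

(* Positivity of [gamma_fun] is not proved; if its junk value makes [dunkl_const nu]
   vanish, then the fractional integral is 0. *)
Section degenerate.
Context {R : realType}.
Variable nu : R.
Hypotheses (nuN : nu != - 2^-1) (c0 : dunkl_const nu = 0).

Lemma degenerate_translation x F y : dunkl_translation nu x F y = 0.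
Proof. by rewrite /dunkl_translation (negbTE nuN) c0 !mul0r. Qed.

Lemma degenerate_fractional_integral g f x : dunkl_fractional_integral nu g f x = 0 :> R[i].
Proof.
apply/eqP; rewrite eq_complex Re_fractional_integral Im_fractional_integral.
have Z (h : R -> R) : \int[dunkl_measure nu]_(y in setT)
    (h y * dunkl_translation nu y (dunkl_riesz_kernel nu g) x) = 0.
  under eq_Rintegral do rewrite degenerate_translation mulr0.
  by rewrite Rintegral_cst// mul0r.
by rewrite !Z eqxx.
Qed.

Lemma degenerate_fractional_defined g f x : dunkl_fractional_defined nu g f x.
Proof.
rewrite /dunkl_fractional_defined.
under eq_fun do rewrite degenerate_translation mulr0.
exact: integrable0.
Qed.

Lemma degenerate_morrey s t : 0 < s ->
  dunkl_clocally_integrable nu (fun=> 0 : R[i]) /\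
  dunkl_morrey_norm nu s t (fun=> 0 : R[i]) = 0%E.
Proof.
move=> s0; have L0 : dunkl_locally_integrable nu (fun=> 0 : R).
  split=> // K _; under eq_integral do rewrite normr0.
  by rewrite integral0.
have Z : (fun x : R => cmodulus ((fun=> 0 : R[i]) x)) = fun=> 0.
  by apply/funext => x; exact: cmodulus0.
have Zs : (fun x : R => cmodulus ((fun=> 0 : R[i]) x) `^ s) = fun=> 0.
  by apply/funext => x; rewrite cmodulus0 powR0// gt_eqF.
split; first by split => //; rewrite Z.
rewrite /dunkl_morrey_norm Zs asboolT//; apply/eqP; rewrite eq_le; apply/andP; split.
  apply: ge_ereal_sup => _ [x [r [r0 ->]]].
  under eq_integral do rewrite degenerate_translation.
  by rewrite integral0 poweR0r ?mule0// gt_eqF ?invr_gt0.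
apply: ereal_sup_ubound; exists 0, 1; split => //.
under eq_integral do rewrite degenerate_translation.
by rewrite integral0 poweR0r ?mule0// gt_eqF ?invr_gt0.
Qed.

End degenerate.

Theorem lemma3p1 (R : realType) (nu g p q s t : R)
    (hnu : - 2^-1 <= nu)
    (hg0 : 0 < g) (hgd : g < dunkl_dim nu)
    (hp : 1 < p) (hpq : p <= q) (hq : q < dunkl_dim nu / g)
    (hs : 1 < s) (hst : s <= t)
    (ht : t^-1 = q^-1 - g / dunkl_dim nu)
    (hr : s / t = p / q) :
  exists C : R, 0 < C /\
    forall f : R -> R[i], dunkl_morrey nu p q f ->
      [/\ {ae dunkl_measure nu, forall x, dunkl_fractional_defined nu g f x},
          dunkl_morrey nu s t (dunkl_fractional_integral nu g f) &
          (dunkl_morrey_norm nu s t (dunkl_fractional_integral nu g f)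
             <= C%:E * dunkl_morrey_norm nu p q f)%E].
Proof.
have s0 : 0 < s by apply: lt_trans hs.
have t0 : 0 < t by apply: lt_le_trans hst.
have q0 : 0 < q by apply: lt_le_trans hpq; apply: lt_trans hp.
have d0 : 0 < dunkl_dim nu by apply: lt_trans hgd.
have cge0 : 0 <= dunkl_const nu.
  rewrite /dunkl_const divr_ge0 ?gamma_fun_ge0// mulr_ge0 ?sqrtr_ge0//.
  exact: gamma_fun_ge0.
have [/andP[nuN /eqP cE]|nd] := boolP ((nu != - 2^-1) && (dunkl_const nu == 0)).
  exists 1; split => // f fM.
  have -> : dunkl_fractional_integral nu g f = fun=> 0.
    by apply/funext => x; exact: degenerate_fractional_integral.
  have [L ->] := degenerate_morrey nuN cE t s0.
  split.
  - by apply: aeW => x; exact: degenerate_fractional_defined.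
  - by split => //; rewrite (degenerate_morrey nuN cE t s0).2.
  - by rewrite mul1e morrey_norm_ge0.
have cpos : nu != - 2^-1 -> 0 < dunkl_const nu.
  by move=> nuN; rewrite lt_def cge0 andbT; move: nd; rewrite nuN.
have gq : g < dunkl_dim nu / q by rewrite ltr_pdivlMr// mulrC -ltr_pdivlMr.
(* The relation between [t] and [q] says [1 - g q / d = q / t], and [s q / t = p] by [hr]. *)
have sp : s * (1 - g / (dunkl_dim nu / q)) = p.
  have -> : 1 - g / (dunkl_dim nu / q) = q * (q^-1 - g / dunkl_dim nu).
    by field; rewrite !gt_eqF.
  rewrite -ht mulrCA hr mulrC mulfVK// gt_eqF//.
have [C1 C10 H1] := fractional_integral_shell_int hnu cpos hg0 hgd hp q0 gq hs sp.
have [C2 C20 H2] := morrey_norm_of_shell_int hnu hs cge0 t0 hr.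
exists (C2 * C1); split; first exact: mulr_gt0.
move=> f [[mf _] fin].
have n0 := morrey_norm_ge0 nu p q f.
have If := cmeasurable_fractional_integral nu g mf.
(* Hedberg's scale requires [N > 0], whereas the norm of [f] may vanish; so the bound is proved for
   every positive [N] above the norm. *)
have key N : 0 < N -> (dunkl_morrey_norm nu p q f <= N%:E)%E ->
    [/\ {ae dunkl_measure nu, forall x, dunkl_fractional_defined nu g f x},
      dunkl_clocally_integrable nu (dunkl_fractional_integral nu g f) &
      (dunkl_morrey_norm nu s t (dunkl_fractional_integral nu g f) <= (C2 * C1 * N)%:E)%E].
  move=> N0 fN; have [ae1 HQ] := H1 f N mf N0 fN.
  have [|L nL] := H2 _ (C1 * N) If _ HQ; first by rewrite mulr_gt0.
  by split => //; rewrite -mulrA.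
have nf : dunkl_morrey_norm nu p q f \is a fin_num by rewrite ge0_fin_numE.
set n := dunkl_morrey_norm nu p q f in n0 nf key fin *.
have r0 : 0 <= fine n by exact: fine_ge0.
have [||ae1 L nL] := key (fine n + 1); first by rewrite ltr_wpDl.
  by rewrite EFinD fineK// leeDl.
split => //.
  by split => //; apply: le_lt_trans nL _; rewrite ltry.
(* Letting [N] decrease to the norm recovers the bound with the norm itself, zero included. *)
apply/lee_addgt0Pr => e e0.
have [||_ _ ne] := key (fine n + e / (C2 * C1)).
- by rewrite ltr_wpDl// divr_gt0// mulr_gt0.
- by rewrite EFinD fineK// leeDl// lee_fin ltW// divr_gt0// mulr_gt0.
apply: (le_trans ne).
rewrite -[n in (_ * n)%E]fineK// -EFinM -EFinD lee_fin mulrDr lerD2l.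
by rewrite mulrC divfK// gt_eqF// mulr_gt0.
Qed.
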